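(* Let $K$ be an infinite field and let $\sigma : M_{[\infty]} \to M_{[\infty]}$ be a stable operator. If $I \subset R_{[\infty]}$ is a finitely generated strongly stable ideal, then $\mathrm{gin}(\sigma(I)) = I$.
   Context: $K$ is an infinite field, $R_{[n]}=K[x_1,\dots,x_n]$ with each $\deg x_i=1$, $R_{[\infty]}=K[x_1,x_2,x_3,\dots]$ is the polynomial ring in infinitely many variables, and $M_{[\infty]}$ is the set of monomials of $R_{[\infty]}$. Generic initial ideals: for a graded ideal $I\subset R_{[n]}$, $\mathrm{gin}(I)$ is the generic initial ideal of $I$ with respect to the degree reverse lexicographic order induced by $x_1>x_2>\cdots>x_n$, i.e. the common value of the initial ideals $\mathrm{in}(\varphi(I))$ for all $\varphi$ in a suitable nonempty Zariski open subset of $GL_n(K)$ (acting on $R_{[n]}$ by linear changes of variables). For a monomial $u$, $m(u)=\max\{i : x_i \text{ divides } u\}$. For a finitely generated monomial ideal $I\subset R_{[\infty]}$, $G(I)$ is its set of minimal monomial generators and $\max(I)=\max\{m(u):u\in G(I)\}$. Set $\mathrm{gin}(I)=\mathrm{gin}(I\cap R_{[\max(I)]})R_{[\infty]}$, and let $\beta_{ij}(I)$ be the graded Betti numbers of $I\cap R_{[\max(I)]}$ over $R_{[\max(I)]}$, where $\beta_{ij}(M)=\dim_K \mathrm{Tor}_i(M,K)_j$. (Both are unchanged if $\max(I)$ is replaced by any $k\ge \max(I)$.) For monomials $u=x_{i_1}\cdots x_{i_d}$, $v=x_{j_1}\cdots x_{j_d}$ of the same degree with $i_1\le\cdots\le i_d$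 and $j_1\le\cdots\le j_d$, write $u\preceq v$ if $i_k\le j_k$ for all $1\le k\le d$. A monomial ideal $I\subset R_{[n]}$ is strongly stable if $v\in I$ and $u\preceq v$ imply $u\in I$. A finitely generated monomial ideal $I\subset R_{[\infty]}$ is strongly stable if $I\cap R_{[\max(I)]}$ is strongly stable. For a map $\sigma:M_{[\infty]}\to M_{[\infty]}$ and a finitely generated monomial ideal $I$, $\sigma(I)$ denotes the ideal of $R_{[\infty]}$ generated by $\{\sigma(u):u\in G(I)\}$. The map $\sigma$ is a stable operator if (i) $\beta_{ij}(I)=\beta_{ij}(\sigma(I))$ for all $i,j$ and every finitely generated strongly stable ideal $I\subset R_{[\infty]}$; and (ii) $J\subset I$ implies $\sigma(J)\subset\sigma(I)$ for finitely generated strongly stable ideals $J,I$ of $R_{[\infty]}$. *)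

(* Defs.v *)
From mathcomp Require Import all_boot all_order all_algebra.
From mathcomp Require Import finmap.
(* The notations of monalg ({mpoly _}, 'X_{1.._}, ...) clash with those of
   mpoly. *)
From mathcomp Require Import -(notations) monalg.
From mathcomp Require Import mpoly.
From Stdlib Require Import ClassicalEpsilon.

Set Implicit Arguments.
Unset Strict Implicit.
Unset Printing Implicit Defensive.

Import GRing.Theory.

Local Open Scope ring_scope.

Definition infinite_field (K : fieldType) : Prop :=
  forall s : seq K, exists x : K, x \notin s.

(* Variables are indexed from 0: in 'X_{1..n} and in [cmonom nat], the index k
   stands for x_{k+1}. *)

Definition Minf : Type := cmonom nat.
Definition Rinf (K : fieldType) : comNzRingType := malg (cmonom nat) K.

Definition monom_inf (K : fieldType) (u : Minf) : Rinf K :=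
  mkmalgU u (1 : K).

(* The inclusion of K[x_1, ..., x_n] in K[x_1, x_2, ...]. *)
Definition incl (K : fieldType) (n : nat) (p : {mpoly K[n]}) : Rinf K :=
  mmap (fun c : K => mkmalgU (mone : cmonom nat) c : Rinf K)
       (fun i : 'I_n => monom_inf K (ucm (i : nat))) p.

Definition ideal_gen (R : comNzRingType) (A : R -> Prop) (f : R) : Prop :=
  exists s : seq (R * R),
    (forall c, c \in s -> A c.2) /\ f = \sum_(c <- s) c.1 * c.2.

Definition restrict (K : fieldType) (n : nat) (I : Rinf K -> Prop) :
  {mpoly K[n]} -> Prop := fun p => I (incl p).

Definition extend (K : fieldType) (n : nat) (J : {mpoly K[n]} -> Prop) :
  Rinf K -> Prop := ideal_gen (fun f => exists2 p, J p & f = incl p).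

Definition fg_monomial_ideal (K : fieldType) (I : Rinf K -> Prop) : Prop :=
  exists s : seq Minf, forall f,
    I f <-> ideal_gen (fun g => exists2 u, u \in s & g = monom_inf K u) f.

Definition mdivides (v u : Minf) : Prop := exists w : Minf, u = mmul v w.

Definition min_gen (K : fieldType) (I : Rinf K -> Prop) (u : Minf) : Prop :=
  I (monom_inf K u) /\
  (forall v, mdivides v u -> I (monom_inf K v) -> v = u).

Definition max_var (u : Minf) : nat := \max_(k <- finsupp u) k.+1.

Definition is_max_var_ideal (K : fieldType) (I : Rinf K -> Prop) (n : nat) :=
  (forall u, min_gen I u -> (max_var u <= n)%N) /\
  (forall n', (forall u, min_gen I u -> (max_var u <= n')%N) -> (n <= n')%N).

(* The zero ideal and the unit ideal have value 0. *)
Definition max_var_ideal (K : fieldType) (I : Rinf K -> Prop) : nat :=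
  epsilon (inhabits 0%N) (is_max_var_ideal I).

(* The weakly increasing sequence of the indices of the variables of m,
   repeated according to their exponents. *)
Definition var_seq (n : nat) (m : 'X_{1..n}) : seq nat :=
  flatten [seq nseq (m i) (i : nat) | i <- enum 'I_n].

(* [all2] is false on sequences of different sizes. *)
Definition preceq (n : nat) (u v : 'X_{1..n}) : bool :=
  all2 leq (var_seq u) (var_seq v).

Definition strongly_stable_mpoly (K : fieldType) (n : nat)
    (I : {mpoly K[n]} -> Prop) : Prop :=
  forall u v : 'X_{1..n}, I 'X_[v] -> preceq u v -> I 'X_[u].

Definition fg_strongly_stable (K : fieldType) (I : Rinf K -> Prop) : Prop :=
  fg_monomial_ideal I /\
  strongly_stable_mpoly (restrict (n := max_var_ideal I) I).

(* Degree reverse lexicographic order with x_1 > ... > x_n: u < v when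
   deg u < deg v, or the degrees agree and, at the last variable where they
   differ, u has the larger exponent.  The order (_ < _)%O that mpoly puts on
   'X_{1..n} is instead the degree lexicographic one. *)
Definition revlex_lt (n : nat) (u v : 'X_{1..n}) : bool :=
  (mdeg u < mdeg v)%N ||
  (mdeg u == mdeg v) &&
  [exists i : 'I_n, (v i < u i)%N &&
    [forall j : 'I_n, (i < j)%N ==> (u j == v j)]].

Definition is_initial (K : fieldType) (n : nat) (f : {mpoly K[n]})
    (m : 'X_{1..n}) : Prop :=
  m \in msupp f /\ (forall m', m' \in msupp f -> m' != m -> revlex_lt m' m).

Definition initial_ideal (K : fieldType) (n : nat) (J : {mpoly K[n]} -> Prop) :
  {mpoly K[n]} -> Prop :=
  ideal_gen (fun h => exists f m, [/\ J f, is_initial f m & h = 'X_[m]]).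

(* The K-algebra endomorphism with x_i |-> \sum_j g_{ij} x_j. *)
Definition linear_change (K : fieldType) (n : nat) (g : 'M[K]_n)
    (p : {mpoly K[n]}) : {mpoly K[n]} :=
  p \mPo [tuple \sum_(j < n) g i j *: 'X_j | i < n].

Definition linear_image (K : fieldType) (n : nat) (g : 'M[K]_n)
    (J : {mpoly K[n]} -> Prop) : {mpoly K[n]} -> Prop :=
  fun f => exists2 p, J p & f = linear_change g p.

(* U is an open subset of GL_n(K): the complement in GL_n(K) of the zero set
   of a family S of polynomials in the n * n matrix entries. *)
Definition zariski_open_GL (K : fieldType) (n : nat) (U : 'M[K]_n -> Prop) :
    Prop :=
  exists S : {mpoly K[n * n]} -> Prop, forall g,
    U g <-> g \in unitmx /\ exists2 p, S p & p.@[mxvec g 0] != 0.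

Definition is_gin (K : fieldType) (n : nat) (J L : {mpoly K[n]} -> Prop) :
    Prop :=
  exists U : 'M[K]_n -> Prop,
    [/\ zariski_open_GL U, exists g, U g &
        forall g, U g ->
          forall f, initial_ideal (linear_image g J) f <-> L f].

Definition gin_mpoly (K : fieldType) (n : nat) (J : {mpoly K[n]} -> Prop) :
  {mpoly K[n]} -> Prop := epsilon (inhabits (fun _ => False)) (is_gin J).

Definition gin (K : fieldType) (I : Rinf K -> Prop) : Rinf K -> Prop :=
  extend (gin_mpoly (restrict (n := max_var_ideal I) I)).

(* A sequence of maps ... -> F_1 -> F_0 -> S over S = K[x_1, ..., x_n], where
   F_i is the free module of rows of length [rk i], whose k-th basis vector has
   degree [dg i k]; maps act by right multiplication, [dif i] is
   F_{i+1} -> F_i and [aug] is F_0 -> S. *)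
Record free_complex (K : fieldType) (n : nat) := FreeComplex {
  rk : nat -> nat;
  dg : forall i, 'I_(rk i) -> nat;
  aug : 'cV[{mpoly K[n]}]_(rk 0);
  dif : forall i, 'M[{mpoly K[n]}]_(rk i.+1, rk i)
}.

Arguments dg [K n] f [i] _ : rename.

(* The maps preserve degrees. *)
Definition is_graded (K : fieldType) (n : nat) (F : free_complex K n) : Prop :=
  (forall k, aug F k 0 \is (dg F k).-homog) /\
  (forall i k l,
     if (dg F l <= dg F k)%N
     then dif F i k l \is (dg F k - dg F l)%N.-homog
     else dif F i k l == 0).

(* F is a graded free resolution of the ideal J, regarded as an S-module:
   ... -> F_1 -> F_0 -> J -> 0 is exact. *)
Definition is_free_resolution (K : fieldType) (n : nat) (F : free_complex K n)
    (J : {mpoly K[n]} -> Prop) : Prop :=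
  [/\ is_graded F,
      forall f, J f <-> exists v : 'rV_(rk F 0), f = (v *m aug F) 0 0,
      forall v : 'rV_(rk F 0),
        v *m aug F = 0 <-> exists w, v = w *m dif F 0 &
      forall i (v : 'rV_(rk F i.+1)),
        v *m dif F i = 0 <-> exists w, v = w *m dif F i.+1].

(* The degree j component of dif i (x) K : F_{i+1} (x) K -> F_i (x) K, where
   K = S / (x_1, ..., x_n): the constant coefficients of dif i, on the basis
   vectors of degree j only. *)
Definition dif_K (K : fieldType) (n : nat) (F : free_complex K n) (i j : nat) :
    'M[K]_(rk F i.+1, rk F i) :=
  \matrix_(k, l)
    if (dg F k == j) && (dg F l == j) then (dif F i k l)@_0%MM else 0.

(* dim_K H_i(F (x) K)_j, by rank-nullity. *)
Definition tor_dim (K : fieldType) (n : nat) (F : free_complex K n)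
    (i j : nat) : nat :=
  #|[pred k : 'I_(rk F i) | dg F k == j]|
  - (if i is i'.+1 then \rank (dif_K F i' j) else 0)
  - \rank (dif_K F i j).

(* beta_{ij}(J) = dim_K Tor_i(J, K)_j = b.  The homology of F (x) K does not
   depend on the resolution F, and such an F exists as S is Noetherian, so there
   is exactly one such b. *)
Definition betti_mpoly (K : fieldType) (n : nat) (J : {mpoly K[n]} -> Prop)
    (i j b : nat) : Prop :=
  exists2 F : free_complex K n, is_free_resolution F J & tor_dim F i j = b.

Definition betti (K : fieldType) (I : Rinf K -> Prop) (i j b : nat) : Prop :=
  betti_mpoly (restrict (n := max_var_ideal I) I) i j b.

Definition sigma_ideal (K : fieldType) (sigma : Minf -> Minf)
    (I : Rinf K -> Prop) : Rinf K -> Prop :=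
  ideal_gen (fun f => exists2 u, min_gen I u & f = monom_inf K (sigma u)).

Definition stable_operator (K : fieldType) (sigma : Minf -> Minf) : Prop :=
  (forall I : Rinf K -> Prop, fg_strongly_stable I ->
     forall i j, exists2 b, betti I i j b & betti (sigma_ideal sigma I) i j b)
  /\
  (forall J I : Rinf K -> Prop,
     fg_strongly_stable J -> fg_strongly_stable I ->
     (forall f, J f -> I f) ->
     forall f, sigma_ideal sigma J f -> sigma_ideal sigma I f).

(* Main.v *)
From HB Require Import structures.
Require Import Defs.
From mathcomp Require Import all_boot all_order all_algebra.
From mathcomp Require Import finmap.
From mathcomp Require Import -(notations) monalg.
From mathcomp Require Import mpoly.
From mathcomp Require Import ring zify.
From Stdlib Require Import Classical ClassicalEpsilon.

Set Implicit Arguments.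
Unset Strict Implicit.
Unset Printing Implicit Defensive.

Import GRing.Theory.

Local Open Scope ring_scope.

(** The image of an ideal under sigma has the Betti numbers of the ideal, hence
    its Hilbert function in every large polynomial ring [hilbert_sigma]; and the
    initial monomials of a linear image of an ideal are counted by the Hilbert
    function of that ideal [initials_image_count].  So in(g sigma(I)) = I for a
    change of variables g as soon as one inclusion holds, and it suffices to find
    each minimal generator u of I among the initial monomials of g sigma(I).

    The case that carries the proof is the power P = (x_1, ..., x_m)^j.  Its
    minimal resolution has length less than m, so Tor_i(sigma(P), K) = 0 for
    i >= m.  This vanishing lets the resolution of sigma(P) be cut by generic
    hyperplanes, one at a time, until m variables are left, without losing its
    exactness at the ideal [generic_section].  Consequently the monomials
    sigma(w), for w of degree j in x_1, ..., x_m, stay linearly independent when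
    the variables are replaced by generic linear forms in m variables
    [generic_independence].  They have degree j and are as many as the monomials
    of degree j in m variables, so a certain determinant is a nonzero polynomial
    in the entries of g [generic_coefs_det].  Where it does not vanish,
    combinations of the g sigma(w) restrict on x_{m+1} = x_{m+2} = ... = 0 to
    each monomial of degree j in x_1, ..., x_m, and in the reverse lexicographic
    order that monomial is then the initial one [drop_vars_initial].  Hence P is
    contained in in(g sigma(P)), and equality follows by counting.

    Let s_k(u) be the number of the variables x_1, ..., x_k in u, with
    multiplicity.  The smallest strongly stable ideal <u> containing u is the
    intersection of the powers (x_1, ..., x_k)^(s_k(u)).  As sigma preserves
    inclusions, the initial monomials of g sigma(<u>) belong to each of these
    powers, hence to <u>; by counting they are all the monomials of <u>, so u is
    an initial monomial of g sigma(<u>), and a fortiori of g sigma(I)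
    [initials_min_gen].  Finitely many powers occur, so all this holds for g
    outside the zero set of one polynomial [initials_large].

    The counting takes place in a number N of variables that may exceed
    n = max(sigma(I)).  If g is good in N variables, its upper left n x n block
    is good in n variables, by the reverse lexicographic order and one more
    count [corner_init].  The blocks that extend, by the remaining entries of
    one fixed good matrix, to a good matrix form a non-empty open set
    [gin_sigma].  Over an infinite field two such sets meet, so the generic
    initial ideal is the one found there [gin_unique]. *)

(** * Complexes of free modules and reduction modulo a regular element *)

Definition exact_at (R : pzRingType) (c : nat -> nat)
    (D : forall p, 'M[R]_(c p.+1, c p)) (p : nat) : Prop :=
  forall v : 'rV[R]_(c p.+1), v *m D p = 0 -> exists w, v = w *m D p.+1.

Definition is_complex (R : pzRingType) (c : nat -> nat)
    (D : forall p, 'M[R]_(c p.+1, c p)) : Prop :=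
  forall p, D p.+1 *m D p = 0.

Definition map_cpx (R S : pzRingType) (f : R -> S) (c : nat -> nat)
    (D : forall p, 'M[R]_(c p.+1, c p)) : forall p, 'M[S]_(c p.+1, c p) :=
  fun p => map_mx f (D p).

Definition torsion_free (R : pzRingType) (l : R) (a b : nat)
    (D : 'M[R]_(a, b)) : Prop :=
  forall w : 'rV[R]_b, (exists v, l *: w = v *m D) -> exists v, w = v *m D.

(** The reduction modulo a regular element, presented by any surjective map
    rather than by a quotient type, so that it may land in a polynomial ring. *)
Record quotient_by (A B : comNzRingType) (rho : A -> B) (l : A) : Prop :=
  QuotientBy {
    quot_surj : forall b, exists a, rho a = b;
    quot_ker : forall a, rho a = 0 -> exists q, a = l * q;
    quot_gen : rho l = 0;
    quot_reg : GRing.lreg l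
  }.

Section Reduce.

Variables (A B : comNzRingType) (rho : {rmorphism A -> B}) (l : A).
Hypothesis quot : quotient_by rho l.

Lemma quot_rV_surj n (v : 'rV[B]_n) : exists w, map_mx rho w = v.
Proof.
have [f Hf] : exists f : 'I_n -> A, forall i, rho (f i) = v 0 i.
  by apply: (fin_all_exists (P := fun i a => rho a = v 0 i)) => i; exact: quot_surj quot _.
exists (\row_i f i); apply/rowP => i; by rewrite !mxE Hf.
Qed.

Lemma quot_rV_ker n (v : 'rV[A]_n) : map_mx rho v = 0 -> exists w, v = l *: w.
Proof.
move=> H.
have [f Hf] : exists f : 'I_n -> A, forall i, v 0 i = l * f i.
  apply: (fin_all_exists (P := fun i a => v 0 i = l * a)) => i.
  by apply: (quot_ker quot); move/rowP/(_ i): H; rewrite !mxE.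
exists (\row_i f i); apply/rowP => i; by rewrite !mxE Hf.
Qed.

Lemma lreg_rV n (v w : 'rV[A]_n) : l *: v = l *: w -> v = w.
Proof.
move=> H; apply/rowP => i; move/rowP/(_ i): H; rewrite !mxE.
exact: (quot_reg quot).
Qed.

Variables (c : nat -> nat) (D : forall p, 'M[A]_(c p.+1, c p)).

Lemma map_complex : is_complex D -> is_complex (map_cpx rho D).
Proof. by move=> H p; rewrite /map_cpx -map_mxM H map_mx0. Qed.

(** The cokernel of D (p+1) embeds into a free module, through D p. *)
Lemma exact_torsion_free p :
  is_complex D -> exact_at D p -> torsion_free l (D p.+1).
Proof.
move=> cD ex w [v Hv]; apply: ex.
by apply: lreg_rV; rewrite scaler0 scalemxAl Hv -mulmxA cD mulmx0.
Qed.

(** A lift of a cycle modulo l has its boundary divisible by l; as the cokernel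
    of D p has no l-torsion, the lift can be corrected to a true cycle. *)
Lemma reduce_exact p :
  torsion_free l (D p) -> exact_at D p -> exact_at (map_cpx rho D) p.
Proof.
move=> tf ex v; have [w <-] := quot_rV_surj v.
rewrite /map_cpx -map_mxM => /quot_rV_ker [u Hu].
have [u' Hu'] := tf u (ex_intro _ w (esym Hu)).
have [z Hz] : exists z, w - l *: u' = z *m D p.+1.
  by apply: ex; rewrite mulmxBl -scalemxAl -Hu' Hu subrr.
exists (map_mx rho z); rewrite -map_mxM -Hz map_mxB map_mxZ (quot_gen quot).
by rewrite scale0r subr0.
Qed.

End Reduce.

Lemma mpoly_ring_ind (n : nat) (R : nzRingType) (P : {mpoly R[n]} -> Prop) :
  (forall c, P c%:MP) -> (forall i, P 'X_i) ->
  (forall p q, P p -> P q -> P (p + q)) ->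
  (forall p q, P p -> P q -> P (p * q)) -> forall p, P p.
Proof.
move=> PC PX PD PM; move=> p; elim/mpolyind: p => [|c m p _ _ IH]; first by rewrite -mpolyC0.
apply: (PD) => //; rewrite -mul_mpolyC; apply: (PM) => //.
rewrite mpolyXE_id; apply: (big_ind P _ PM) => [|i _]; first by rewrite -mpolyC1.
elim: (m i) => [|k IHk]; first by rewrite expr0 -mpolyC1.
by rewrite exprS; apply: PM.
Qed.

Lemma mpoly_hom_eq (n : nat) (R : nzRingType) (S : nzRingType)
    (f g : {rmorphism {mpoly R[n]} -> S}) :
  (forall c, f c%:MP = g c%:MP) -> (forall i, f 'X_i = g 'X_i) -> f =1 g.
Proof.
move=> HC HX p; elim/mpoly_ring_ind: p => // p q Hp Hq.
  by rewrite !rmorphD Hp Hq.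
by rewrite !rmorphM Hp Hq.
Qed.

(** Membership in s (rho a) + l A is stable under products when s is
    multiplicative. *)
Lemma mul_shift (A : comNzRingType) (l a b p q : A) :
  (p + l * a) * (q + l * b) = p * q + l * (p * b + q * a + l * a * b).
Proof. by ring. Qed.

Lemma quotient_of_section (A B : comNzRingType) (rho : {rmorphism A -> B})
    (s : B -> A) (l : A) :
  (forall b, rho (s b) = b) -> (s 0 = 0) ->
  (forall a, exists q, a = s (rho a) + l * q) -> rho l = 0 -> GRing.lreg l ->
  quotient_by rho l.
Proof.
move=> rs s0 Hs rl lr; split=> //; first by move=> b; exists (s b).
by move=> a ra; have [q] := Hs a; rewrite ra s0 add0r; exists q.
Qed.

Lemma lift_max_widen n (i : 'I_n) : lift ord_max i = widen_ord (leqnSn n) i.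
Proof. by apply: val_inj; rewrite /= /bump leqNgt ltn_ord. Qed.

Section KillLast.

Variables (T : idomainType) (n : nat).

Definition last_zero (i : 'I_n.+1) : {mpoly T[n]} :=
  if unlift ord_max i is Some j then 'X_j else 0.

Definition kill_last : {mpoly T[n.+1]} -> {mpoly T[n]} :=
  mmap (@mpolyC n T) last_zero.

HB.instance Definition _ := GRing.RMorphism.on kill_last.

Lemma kill_lastC c : kill_last c%:MP = c%:MP.
Proof. exact: mmapC. Qed.

Lemma kill_last_max : kill_last 'X_ord_max = 0.
Proof. by rewrite /kill_last mmapX mmap1U /last_zero unlift_none. Qed.

Lemma kill_last_widen i : kill_last 'X_(widen_ord (leqnSn n) i) = 'X_i.
Proof. by rewrite /kill_last mmapX mmap1U /last_zero -lift_max_widen liftK. Qed.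

Lemma mwidenXU i : mwiden 'X_i = 'X_(widen_ord (leqnSn n) i) :> {mpoly T[n.+1]}.
Proof. by rewrite mwidenX mnmwiden1. Qed.

Lemma kill_lastK p : kill_last (mwiden p) = p.
Proof.
elim/mpoly_ring_ind: p => [c|i|p q Hp Hq|p q Hp Hq].
- by rewrite mwidenC kill_lastC.
- by rewrite mwidenXU kill_last_widen.
- by rewrite !rmorphD /= Hp Hq.
by rewrite !rmorphM /= Hp Hq.
Qed.

Lemma kill_last_quotient : quotient_by kill_last ('X_ord_max : {mpoly T[n.+1]}).
Proof.
apply: (quotient_of_section (s := @mwiden n T)).
- exact: kill_lastK.
- exact: rmorph0.
- move=> p; elim/mpoly_ring_ind: p => [c|i|p q [a Ha] [b Hb]|p q [a Ha] [b Hb]].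
  + by exists 0; rewrite /= kill_lastC mwidenC mulr0 addr0.
  + case: (unliftP ord_max i) => [j ->|->].
      by exists 0; rewrite /= lift_max_widen kill_last_widen mwidenXU mulr0 addr0.
    by exists 1; rewrite /= kill_last_max rmorph0 mulr1 add0r.
  + by exists (a + b); rewrite {1}Ha {1}Hb !rmorphD /= mulrDr addrACA.
  + exists (mwiden (kill_last p) * b + mwiden (kill_last q) * a
            + 'X_ord_max * a * b).
    rewrite {1}Ha {1}Hb !rmorphM /=; exact: mul_shift.
- exact: kill_last_max.
apply/lregP; rewrite -msupp_eq0 msuppX //.
Qed.

Lemma mcoeff0_kill_last p : (kill_last p)@_0%MM = p@_0%MM.
Proof.
elim/mpoly_ring_ind: p => [c|i|p q Hp Hq|p q Hp Hq].
- by rewrite kill_lastC !mcoeffC !eqxx.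
- case: (unliftP ord_max i) => [j ->|->].
    by rewrite lift_max_widen kill_last_widen !mcoeffX !mnm1_eq0.
  by rewrite kill_last_max mcoeff0 mcoeffX mnm1_eq0.
- by rewrite rmorphD !mcoeffD Hp Hq.
by rewrite rmorphM !rmorphM /= Hp Hq.
Qed.

End KillLast.

(** * Constant terms, socles and McCoy's lemma *)

Lemma eq_exact_at (R : pzRingType) (c : nat -> nat)
    (D E : forall p, 'M[R]_(c p.+1, c p)) p :
  (forall q, D q = E q) -> exact_at D p -> exact_at E p.
Proof. by move=> H ex v; rewrite -H => /ex [w ->]; exists w; rewrite H. Qed.

Section ConstantTerm.

Variables (n : nat) (T : idomainType).

(** The complex tensored with the residue field at the origin. *)
Definition const_cpx (c : nat -> nat)
    (D : forall p, 'M[{mpoly T[n]}]_(c p.+1, c p)) :=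
  map_cpx (mcoeff 0%MM) D.

End ConstantTerm.

Lemma const_kill_last n (T : idomainType) c
    (D : forall p, 'M[{mpoly T[n.+1]}]_(c p.+1, c p)) p :
  const_cpx (map_cpx (@kill_last T n) D) p = const_cpx D p.
Proof. by apply/matrixP=> i j; rewrite !mxE /= mcoeff0_kill_last. Qed.

Lemma const_rV0 (T : idomainType) a b (v : 'rV[{mpoly T[0]}]_a)
    (D : 'M[{mpoly T[0]}]_(a, b)) :
  v *m D = map_mx (@mpolyC 0 T) (map_mx (mcoeff 0%MM) v *m map_mx (mcoeff 0%MM) D).
Proof.
rewrite -map_mxM; apply/matrixP => i j; rewrite !mxE.
by rewrite -nvar0_mpolyC.
Qed.

Lemma const_exact0 (T : idomainType) c
    (D : forall p, 'M[{mpoly T[0]}]_(c p.+1, c p)) p :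
  exact_at (const_cpx D) p <-> exact_at D p.
Proof.
split=> ex v Hv.
  have [|w Hw] := ex (map_mx (mcoeff 0%MM) v).
    by rewrite -map_mxM Hv map_mx0.
  exists (map_mx (@mpolyC 0 T) w); rewrite const_rV0.
  have -> : map_mx (mcoeff 0) (map_mx (@mpolyC 0 T) w) = w.
    by apply/matrixP => i j; rewrite !mxE /= mpolyCK.
  rewrite -[map_mx _ (D _)]/(const_cpx D _) -Hw.
  by apply/matrixP => i j; rewrite !mxE /= -nvar0_mpolyC.
have [|w Hw] := ex (map_mx (@mpolyC 0 T) v).
  rewrite const_rV0; have -> : map_mx (mcoeff 0) (map_mx (@mpolyC 0 T) v) = v.
    by apply/matrixP => i j; rewrite !mxE /= mpolyCK.
  by rewrite -[map_mx _ (D _)]/(const_cpx D _) Hv map_mx0.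
exists (map_mx (mcoeff 0%MM) w); rewrite -map_mxM -Hw.
by apply/matrixP => i j; rewrite !mxE /= mpolyCK.
Qed.

(** Each variable is regular on the images, so reducing modulo the variables
    one at a time keeps the complex exact, except that one position is lost
    each time. *)
Lemma const_exact n (T : idomainType) c
    (D : forall p, 'M[{mpoly T[n]}]_(c p.+1, c p)) p0 :
  is_complex D -> (forall p, p0 <= p -> exact_at D p)%N ->
  forall p, (p0 + n <= p)%N -> exact_at (const_cpx D) p.
Proof.
elim: n D p0 => [|n IH] D p0 cD ex p le_p.
  by apply/const_exact0/ex; rewrite addn0 in le_p.
apply: (eq_exact_at (const_kill_last D)).
apply: (IH _ p0.+1); [exact: map_complex| |by rewrite addSnnS].
case=> // q lt_q; have quo := kill_last_quotient T n.
apply: (reduce_exact quo); last by apply: ex; apply: leqW.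
by apply: (exact_torsion_free quo) => //; apply: ex.
Qed.

(** If all the variables multiply z into the image of D1, the multiplier w of
    the last variable, modulo that variable, represents a socle element one
    step further in the complex and with one variable less. *)
Lemma socle_step (T : idomainType) (n a b e : nat)
    (D1 : 'M[{mpoly T[n.+1]}]_(b, a)) (D2 : 'M[{mpoly T[n.+1]}]_(e, b))
    (z : 'rV[{mpoly T[n.+1]}]_a) :
  D2 *m D1 = 0 -> (forall v : 'rV_b, v *m D1 = 0 -> exists w, v = w *m D2) ->
  (forall w : 'rV[{mpoly T[n]}]_b, w *m map_mx (@kill_last T n) D1 = 0 ->
     (forall l : 'I_n, exists u, ('X_l : {mpoly T[n]}) *: w = u *m map_mx (@kill_last T n) D2) ->
     exists u, w = u *m map_mx (@kill_last T n) D2) ->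
  (forall l : 'I_n.+1, exists w, ('X_l : {mpoly T[n.+1]}) *: z = w *m D1) -> exists w, z = w *m D1.
Proof.
move=> D21 ex IH soc; have quo := kill_last_quotient T n.
have [w Hw] := soc ord_max.
have [|l|u Hu] := IH (map_mx (@kill_last T n) w).
- by rewrite -map_mxM -Hw map_mxZ /= kill_last_max scale0r.
- have [wl Hwl] := soc (widen_ord (leqnSn n) l).
  have [u Hu] : exists u, 'X_(widen_ord (leqnSn n) l) *: w - 'X_ord_max *: wl
                          = u *m D2.
    apply: ex; rewrite mulmxBl -!scalemxAl -Hw -Hwl !scalerA.
    by rewrite mulrC subrr.
  exists (map_mx (@kill_last T n) u); rewrite -map_mxM -Hu map_mxB !map_mxZ /=.
  by rewrite kill_last_max scale0r subr0 kill_last_widen.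
have [u' Hu'] := quot_rV_surj quo u.
have [v Hv] : exists v, w - u' *m D2 = 'X_ord_max *: v.
  by apply: (quot_rV_ker quo); rewrite map_mxB map_mxM Hu' /= -Hu subrr.
exists v; apply: (lreg_rV quo).
by rewrite Hw scalemxAl -Hv mulmxBl -mulmxA D21 mulmx0 subr0.
Qed.

(** A socle element of the cokernel of D (p+1) inside the kernel of D p is a
    class in the top Koszul homology of that cokernel, hence corresponds to a
    homology class of the complex of constant terms n steps further;
    [socle_step] trades one variable for one step. *)
Lemma socle_free (T : idomainType) n c
    (D : forall p, 'M[{mpoly T[n]}]_(c p.+1, c p)) p (z : 'rV_(c p.+1)) :
  is_complex D -> (forall q, (p < q)%N -> exact_at D q) ->
  exact_at (const_cpx D) (p + n) -> z *m D p = 0 ->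
  (forall l : 'I_n, exists w, ('X_l : {mpoly T[n]}) *: z = w *m D p.+1) -> exists w, z = w *m D p.+1.
Proof.
elim: n c D p z => [|n IH] c D p z cD ex ex0 Dz soc.
  by apply: (proj1 (const_exact0 D p)); rewrite addn0 in ex0.
have quo := kill_last_quotient T n.
apply: (socle_step (cD p.+1)) => //; first exact: ex.
move=> w Dw socw; apply: (IH _ (map_cpx (@kill_last T n) D) p.+1 w) => //.
- exact: map_complex.
- case=> // q lt_q; apply: (reduce_exact quo); last by apply: ex; apply: ltnW.
  by apply: (exact_torsion_free quo) => //; apply: ex.
apply: (eq_exact_at (D := const_cpx D)); last by rewrite addSnnS.
by move=> q; rewrite const_kill_last.
Qed.

Lemma socle_free0 (T : idomainType) n c
    (D : forall p, 'M[{mpoly T[n.+1]}]_(c p.+1, c p)) (z : 'rV_(c 0)) :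
  is_complex D -> (forall q, exact_at D q) -> exact_at (const_cpx D) n ->
  (forall l : 'I_n.+1, exists w, ('X_l : {mpoly T[n.+1]}) *: z = w *m D 0) -> exists w, z = w *m D 0.
Proof.
move=> cD ex ex0 soc; have quo := kill_last_quotient T n.
apply: (socle_step (cD 0)) => //; first exact: ex.
move=> w Dw socw.
apply: (@socle_free _ _ _ (map_cpx (@kill_last T n) D) 0 w) => //.
- exact: map_complex.
- case=> // q lt_q; apply: (reduce_exact quo) => //.
  exact: (exact_torsion_free quo).
by apply: (eq_exact_at (D := const_cpx D)) => // q; rewrite const_kill_last.
Qed.

Section PolyBase.

Variable A : comNzRingType.

(** Rows over A[t] are handled through their coefficient rows, on which a
    matrix with entries in A acts one power of t at a time. *)
Definition cfrow a (k : nat) (v : 'rV[{poly A}]_a) : 'rV[A]_a :=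
  map_mx (coefp k) v.

Lemma cfrowE a k (v : 'rV[{poly A}]_a) i : cfrow k v 0 i = (v 0 i)`_k.
Proof. by rewrite mxE. Qed.

Lemma cfrowP a (v w : 'rV[{poly A}]_a) :
  (forall k, cfrow k v = cfrow k w) -> v = w.
Proof.
move=> H; apply/rowP => i; apply/polyP => k.
by move/rowP/(_ i): (H k); rewrite !cfrowE.
Qed.

Lemma cfrowM a b k (v : 'rV[{poly A}]_a) (D : 'M[A]_(a, b)) :
  cfrow k (v *m map_mx polyC D) = cfrow k v *m D.
Proof.
apply/rowP => i; rewrite cfrowE !mxE coef_sum; apply: eq_bigr => j _.
by rewrite !mxE coefMC.
Qed.

Lemma cfrow_bound a (v : 'rV[{poly A}]_a) :
  exists s, forall k, (s <= k)%N -> cfrow k v = 0.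
Proof.
exists (\max_i size (v 0%R i))%N => k le_k; apply/rowP => i.
rewrite cfrowE mxE nth_default //; apply: leq_trans le_k.
exact: (leq_bigmax i).
Qed.

Definition of_cfrows a (s : nat) (f : nat -> 'rV[A]_a) : 'rV[{poly A}]_a :=
  \row_i \poly_(k < s) (f k 0 i).

Lemma cfrow_of a s (f : nat -> 'rV[A]_a) k :
  cfrow k (of_cfrows s f) = if (k < s)%N then f k else 0.
Proof.
apply/rowP => i; rewrite cfrowE mxE coef_poly.
by case: ifP => // _; rewrite mxE.
Qed.

Lemma polyC_exact c (D : forall p, 'M[A]_(c p.+1, c p)) p :
  exact_at D p -> exact_at (map_cpx polyC D) p.
Proof.
move=> ex v Hv; have [s Hs] := cfrow_bound v.
have /choice [f Hf] : forall k, exists w, cfrow k v = w *m D p.+1.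
  move=> k; apply: ex; rewrite -cfrowM Hv; apply/rowP => i.
  by rewrite cfrowE !mxE coef0.
exists (of_cfrows s f); apply: cfrowP => k; rewrite cfrowM cfrow_of.
by case: ltnP => [_|/Hs->]; rewrite ?Hf ?mul0mx.
Qed.

(** McCoy's theorem for the module A^a / M: if l kills a nonzero element of
    (A^a / M)[t], then some nonzero element of A^a / M is killed by all the
    coefficients of l.  The degree of b is lowered by multiplying it with a
    coefficient of l, the coefficients being treated from the leading one down. *)
Lemma mccoy a (M : 'rV[A]_a -> Prop) (l : {poly A}) :
  (forall k u v, M u -> M v -> M (k *: u + v)) -> M 0 ->
  (forall z, (forall i, M (l`_i *: z)) -> M z) ->
  forall b : 'rV[{poly A}]_a, (forall k, M (cfrow k (l *: b))) ->
  forall k, M (cfrow k b).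
Proof.
move=> Mlin M0 soc b; have [s Hs] := cfrow_bound b.
have MD u v : M u -> M v -> M (u + v).
  by move=> Mu Mv; rewrite -[u]scale1r; apply: Mlin.
have MZ k u : M u -> M (k *: u) by move=> Mu; rewrite -[_ *: _]addr0; apply: Mlin.
have MN u v : M (u + v) -> M u -> M v.
  by move=> Muv Mu; rewrite -[v](addKr u) -scaleN1r; apply: Mlin.
have Msum (I : finType) (P : pred I) (F : I -> 'rV[A]_a) :
    (forall i, P i -> M (F i)) -> M (\sum_(i | P i) F i).
  by move=> MF; apply: (big_ind M).
have cfZ k (p : {poly A}) (v : 'rV_a) :
    cfrow k (p *: v) = \sum_(i < k.+1) p`_i *: cfrow (k - i) v.
  apply/rowP => i; rewrite cfrowE mxE coefM summxE.
  by apply: eq_bigr => j _; rewrite !mxE.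
have cfD k (v w : 'rV_a) : cfrow k (v + w) = cfrow k v + cfrow k w.
  by rewrite /cfrow map_mxD.
elim: s b Hs => [|s IH] b Hs Mb k; first by rewrite Hs.
(* b is its top term plus a row b' of smaller degree *)
pose top : 'rV_a := cfrow s b; pose b' := of_cfrows s (fun k => cfrow k b).
have b'E j : cfrow j b' = if (j < s)%N then cfrow j b else 0 by exact: cfrow_of.
have b'0 j : (s <= j)%N -> cfrow j b' = 0 by rewrite b'E; case: ltnP.
have cfC j (x : A) (w : 'rV_a) : cfrow j (x%:P *: w) = x *: cfrow j w.
  by apply/rowP => q; rewrite cfrowE mxE coefCM mxE cfrowE.
have lb' (x : A) : (forall j, M (x *: cfrow j (l *: b))) -> M (x *: top) ->
    forall j, M (x *: cfrow j b').
  move=> Mx Mtop j; have -> : x *: cfrow j b' = cfrow j (x%:P *: b').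
    by rewrite cfC.
  apply: IH => [{}j le_j|{}j]; first by rewrite cfC b'0 // scaler0.
  have -> : cfrow j (l *: (x%:P *: b')) = x *: cfrow j (l *: b').
    by rewrite -cfC !scalerA mulrC.
  apply: (MN (if (s <= j)%N then l`_(j - s) *: (x *: top) else 0)); last first.
    by case: ifP => // _; apply: MZ.
  suff -> : (if (s <= j)%N then l`_(j - s) *: (x *: top) else 0)
          + x *: cfrow j (l *: b') = x *: cfrow j (l *: b) by exact: Mx.
  rewrite !cfZ; case: leqP => [le_sj|lt_js].
    have lt_o : (j - s < j.+1)%N by rewrite ltnS leq_subr.
    rewrite [in RHS](bigD1 (Ordinal lt_o)) //= subKn // scalerDr.
    rewrite [\sum_(i < j.+1) _ *: cfrow _ b'](bigD1 (Ordinal lt_o)) //= subKn //.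
    rewrite b'0 // scaler0 add0r !scalerA [l`_ _ * x]mulrC; congr (_ + _ *: _).
    apply: eq_bigr => i /eqP ne_i; rewrite b'E; case: ltnP => // le_s.
    rewrite leq_eqVlt in le_s; case/orP: le_s => [/eqP E|lt_s].
      case: ne_i; apply: val_inj => /=; have := ltn_ord i; lia.
    by rewrite Hs ?scaler0.
  rewrite add0r; congr (_ *: _); apply: eq_bigr => i _; rewrite b'E.
  by rewrite (leq_ltn_trans (leq_subr _ _) lt_js).
have Ml i : forall j, M (l`_i *: cfrow j b).
  have : (size l <= i + size l)%N by rewrite leq_addl.
  move: {2}(size l) => d; elim: d i => [|d IHd] i le_d.
    move=> j; rewrite addn0 in le_d; by rewrite nth_default // scale0r.
  have [lt_i|le_i] := ltnP i (size l); last by move=> j; rewrite nth_default // scale0r.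
  have Hgt i' : (i < i')%N -> forall j, M (l`_i' *: cfrow j b).
    move=> lt_i'; apply: IHd; lia.
  (* Above i the products vanish modulo M, so the coefficient i + s of l * b
     gives the product of the coefficient i with the top term. *)
  have Mtop : M (l`_i *: top).
    have lt_o : (i < (i + s).+1)%N by rewrite ltnS leq_addr.
    move: (Mb (i + s)%N); rewrite cfZ (bigD1 (Ordinal lt_o)) //= addKn => M1.
    apply: MN; first by rewrite addrC; apply: M1.
    apply: Msum => o ne_o; have [lt_oi|le_oi] := ltnP o i.
      by rewrite Hs ?scaler0 //; lia.
    by apply: Hgt; rewrite ltn_neqAle le_oi andbT eq_sym; exact: ne_o.
  have Mi : forall j, M (l`_i *: cfrow j (l *: b)) by move=> j; apply: MZ.
  move=> j; have := lb' _ Mi Mtop j; rewrite b'E; case: ltnP => // le_s _.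
  rewrite leq_eqVlt in le_s; case/orP: le_s => [/eqP <- //|lt_s].
  by rewrite Hs // scaler0.
have Mtop : M top by apply: soc => i; apply: Ml.
have := lb' 1; rewrite scale1r => /(_ _ Mtop k).
rewrite scale1r b'E; case: (ltngtP k s) => [lt_k|lt_k|->] //; last first.
  by move=> _; rewrite Hs.
by apply=> j; rewrite scale1r.
Qed.

End PolyBase.

(** * Specialization to a generic linear section *)

Lemma poly_ring_ind (A : nzRingType) (P : {poly A} -> Prop) :
  (forall c, P c%:P) -> P 'X ->
  (forall p q, P p -> P q -> P (p + q)) ->
  (forall p q, P p -> P q -> P (p * q)) -> forall p, P p.
Proof.
move=> PC PX PD PM; elim/poly_ind => [|p c Hp]; first by rewrite -polyC0.
by apply: (PD) => //; apply: (PM).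
Qed.

Section GenericHyperplane.

Variables (T : idomainType) (n : nat).

(** The variables restricted to the hyperplane x_{n+1} = - (t x_1 + t^2 x_2 +
    ... + t^n x_n). *)
Definition hyp_var (i : 'I_n.+1) : {mpoly {poly T}[n]} :=
  if unlift ord_max i is Some j then 'X_j
  else - \sum_(j < n) ('X^(j.+1) : {poly T}) *: 'X_j.

Definition hyp_sub : {mpoly T[n.+1]} -> {mpoly {poly T}[n]} :=
  mmap (@mpolyC n {poly T} \o polyC) hyp_var.

HB.instance Definition _ := GRing.RMorphism.on hyp_sub.

Lemma hyp_subC c : hyp_sub c%:MP = c%:P%:MP.
Proof. exact: mmapC. Qed.

Lemma hyp_sub_max :
  hyp_sub 'X_ord_max = - \sum_(j < n) ('X^(j.+1) : {poly T}) *: 'X_j.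
Proof. by rewrite /hyp_sub mmapX mmap1U /hyp_var unlift_none. Qed.

Lemma hyp_sub_widen i : hyp_sub 'X_(widen_ord (leqnSn n) i) = 'X_i.
Proof. by rewrite /hyp_sub mmapX mmap1U /hyp_var -lift_max_widen liftK. Qed.

Definition hyp_quo : {poly {mpoly T[n.+1]}} -> {mpoly {poly T}[n]} :=
  horner_eval ('X%:MP) \o map_poly hyp_sub.

HB.instance Definition _ := GRing.RMorphism.on hyp_quo.

Lemma hyp_quoC c : hyp_quo c%:P = hyp_sub c.
Proof. by rewrite /hyp_quo /= /horner_eval map_polyC hornerC. Qed.

Lemma hyp_quoX : hyp_quo 'X = 'X%:MP.
Proof. by rewrite /hyp_quo /= /horner_eval map_polyX hornerX. Qed.

(** The generic linear form: every variable occurs among its coefficients, and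
    a single parameter t serves for all of them. *)
Definition hyp_lin : {poly {mpoly T[n.+1]}} :=
  ('X_ord_max)%:P + \sum_(j < n) ('X_(widen_ord (leqnSn n) j))%:P * 'X^(j.+1).

Definition hyp_sec : {mpoly {poly T}[n]} -> {poly {mpoly T[n.+1]}} :=
  mmap (map_poly (@mpolyC n.+1 T)) (fun j => ('X_(widen_ord (leqnSn n) j))%:P).

HB.instance Definition _ := GRing.RMorphism.on hyp_sec.

Lemma hyp_secC c : hyp_sec c%:MP = map_poly (@mpolyC n.+1 T) c.
Proof. exact: mmapC. Qed.

Lemma hyp_secX i : hyp_sec 'X_i = ('X_(widen_ord (leqnSn n) i))%:P.
Proof. by rewrite /hyp_sec mmapX mmap1U. Qed.

Lemma hyp_quo_sec p : hyp_quo (hyp_sec p) = p.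
Proof.
elim/mpoly_ring_ind: p => [c|i|p q Hp Hq|p q Hp Hq].
- rewrite hyp_secC; elim/poly_ring_ind: c => [c||p q Hp Hq|p q Hp Hq].
  + by rewrite map_polyC hyp_quoC /= hyp_subC.
  + by rewrite map_polyX hyp_quoX.
  + by rewrite !rmorphD /= Hp Hq.
  + by rewrite !rmorphM /= Hp Hq.
- by rewrite hyp_secX hyp_quoC hyp_sub_widen.
- by rewrite !rmorphD /= Hp Hq.
by rewrite !rmorphM /= Hp Hq.
Qed.

Lemma hyp_lin_coef i : hyp_lin`_i =
  if i is j.+1 then (if insub j is Some o then 'X_(widen_ord (leqnSn n) o) else 0)
  else 'X_ord_max.
Proof.
rewrite /hyp_lin coefD coefC coef_sum.
rewrite (eq_bigr (fun j : 'I_n =>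
           if i == j.+1 then 'X_(widen_ord (leqnSn n) j) else 0)); last first.
  by move=> j _; rewrite coefCM coefXn; case: eqP; rewrite ?mulr1 ?mulr0.
case: i => [|i] /=; first by rewrite big1 ?addr0.
rewrite add0r -big_mkcond /=; case: insubP => [o lt_i <-|ge_i].
  by rewrite (big_pred1 o).
by rewrite big_pred0 // => j; apply/negP => /eqP [E]; rewrite E ltn_ord in ge_i.
Qed.

Lemma hyp_lin_quo : hyp_quo hyp_lin = 0.
Proof.
rewrite /hyp_lin rmorphD rmorph_sum /= hyp_quoC hyp_sub_max.
rewrite [X in _ + X](eq_bigr (fun j : 'I_n => ('X^(j.+1) : {poly T}) *: 'X_j)).
  by rewrite addNr.
move=> j _; rewrite rmorphM rmorphXn /= hyp_quoC hyp_quoX hyp_sub_widen.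
by rewrite -rmorphXn /= mulrC mul_mpolyC.
Qed.

Lemma hyp_quotient : quotient_by hyp_quo hyp_lin.
Proof.
apply: (quotient_of_section (s := hyp_sec)).
- exact: hyp_quo_sec.
- exact: rmorph0.
- have step (p q : {poly {mpoly T[n.+1]}}) :
    (exists a, p = hyp_sec (hyp_quo p) + hyp_lin * a) ->
    (exists b, q = hyp_sec (hyp_quo q) + hyp_lin * b) ->
    (exists a, p + q = hyp_sec (hyp_quo (p + q)) + hyp_lin * a) /\
    (exists a, p * q = hyp_sec (hyp_quo (p * q)) + hyp_lin * a).
    move=> [a Ha] [b Hb]; split.
      by exists (a + b); rewrite {1}Ha {1}Hb !rmorphD /= mulrDr addrACA.
    exists (hyp_sec (hyp_quo p) * b + hyp_sec (hyp_quo q) * a + hyp_lin * a * b).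
    rewrite {1}Ha {1}Hb !rmorphM /=; exact: mul_shift.
  move=> p; elim/poly_ring_ind: p => [c||p q Hp Hq|p q Hp Hq].
  + rewrite /= hyp_quoC; elim/mpoly_ring_ind: c => [c|i|p q Hp Hq|p q Hp Hq].
    * by exists 0; rewrite hyp_subC hyp_secC map_polyC mulr0 addr0.
    * case: (unliftP ord_max i) => [j ->|->].
        exists 0; rewrite lift_max_widen hyp_sub_widen hyp_secX.
        by rewrite mulr0 addr0.
      exists 1; rewrite hyp_sub_max rmorphN rmorph_sum /= mulr1 /hyp_lin addrC.
      rewrite -addrA -sumrB big1 ?addr0 // => j _.
      rewrite -mul_mpolyC rmorphM /= hyp_secC hyp_secX map_polyXn.
      by rewrite mulrC subrr.
    * rewrite -hyp_quoC in Hp; rewrite -hyp_quoC in Hq.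
      have [[a Ha] _] := step _ _ Hp Hq; exists a.
      by rewrite -hyp_quoC polyCD.
    * rewrite -hyp_quoC in Hp; rewrite -hyp_quoC in Hq.
      have [_ [a Ha]] := step _ _ Hp Hq; exists a.
      by rewrite -hyp_quoC polyCM.
  + by exists 0; rewrite /= hyp_quoX hyp_secC map_polyX mulr0 addr0.
  + exact: (proj1 (step _ _ Hp Hq)).
  + exact: (proj2 (step _ _ Hp Hq)).
- exact: hyp_lin_quo.
apply/lregP/eqP => /polyP/(_ 0); rewrite hyp_lin_coef coef0 => /eqP.
by rewrite -msupp_eq0 msuppX.
Qed.

Lemma mcoeff0_hyp_sub p : (hyp_sub p)@_0%MM = (p@_0%MM)%:P.
Proof.
elim/mpoly_ring_ind: p => [c|i|p q Hp Hq|p q Hp Hq].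
- by rewrite hyp_subC !mcoeffC !eqxx !mulr1.
- rewrite [in RHS]mcoeffX mnm1_eq0; case: (unliftP ord_max i) => [j ->|->].
    by rewrite lift_max_widen hyp_sub_widen mcoeffX mnm1_eq0.
  rewrite hyp_sub_max mcoeffN raddf_sum big1 ?oppr0 // => j _.
  by rewrite /= mcoeffZ mcoeffX mnm1_eq0 mulr0.
- by rewrite rmorphD !mcoeffD /= Hp Hq polyCD.
by rewrite rmorphM !rmorphM /= Hp Hq.
Qed.

(** Cutting by the generic hyperplane is the base change to T[t], followed by
    the reduction modulo [hyp_lin]. Away from position 0 this form is regular
    on the images; at position 0, by McCoy's theorem, it is so unless some
    nonzero class is killed by all the coefficients of the form, that is by all
    the variables. *)
Lemma hyp_exact c (D : forall p, 'M[{mpoly T[n.+1]}]_(c p.+1, c p)) :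
  is_complex D -> (forall q, exact_at D q) -> exact_at (const_cpx D) n ->
  forall q, exact_at (map_cpx hyp_sub D) q.
Proof.
move=> cD ex ex0 q.
have exP r : exact_at (map_cpx polyC D) r by apply: polyC_exact.
apply: (eq_exact_at (D := map_cpx hyp_quo (map_cpx polyC D))).
  by move=> r; apply/matrixP => i j; rewrite !mxE /= hyp_quoC.
have cP : is_complex (map_cpx polyC D) by exact: map_complex.
apply: (reduce_exact hyp_quotient) => //.
case: q => [|q]; last exact: (exact_torsion_free hyp_quotient).
move=> w [v Hv].
(* The torsion over the generic form at position 0 is excluded by McCoy. *)
pose M (z : 'rV_(c 0)) := exists u, z = u *m D 0.
have Mw : forall k, M (cfrow k w).
  apply: (@mccoy _ _ M hyp_lin).
  - by move=> k u1 u2 [a ->] [b ->]; exists (k *: a + b); rewrite mulmxDl scalemxAl.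
  - by exists 0; rewrite mul0mx.
  - move=> z Hz; apply: (socle_free0 cD ex ex0) => l.
    case: (unliftP ord_max l) => [j ->|->].
      have := Hz j.+1; rewrite hyp_lin_coef insubT // => lt_j.
      have -> : lift ord_max j = widen_ord (leqnSn n) (Sub (nat_of_ord j) lt_j).
        by rewrite lift_max_widen; apply: val_inj.
      by [].
    by have := Hz 0%N; rewrite hyp_lin_coef.
  - by move=> k; rewrite Hv /map_cpx cfrowM; exists (cfrow k v).
have [s Hs] := cfrow_bound w.
have /choice [f Hf] := Mw.
exists (of_cfrows s f); apply: cfrowP => k; rewrite cfrowM cfrow_of.
by case: ltnP => [_|/Hs->]; rewrite ?Hf ?mul0mx.
Qed.

End GenericHyperplane.

(** Generic hyperplane sections remove the variables beyond the first m one at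
    a time; the vanishing of the homology of the constant terms from position m
    on is what [hyp_exact] needs at each stage, and it survives the section. *)
Lemma generic_section m n (T : idomainType) c
    (D : forall p, 'M[{mpoly T[n]}]_(c p.+1, c p)) :
  (m <= n)%N -> is_complex D -> (forall q, exact_at D q) ->
  (forall q, (m <= q)%N -> exact_at (const_cpx D) q) ->
  exists (T' : idomainType) (iota : {rmorphism T -> T'})
         (Xi : {rmorphism {mpoly T[n]} -> {mpoly T'[m]}})
         (G : 'M[T']_(n, m)),
    [/\ forall a, Xi a%:MP = (iota a)%:MP,
        forall i, Xi 'X_i = \sum_(j < m) G i j *: 'X_j &
        exact_at (map_cpx Xi D) 0].
Proof.
elim: n T c D => [|n IH] T c D le_mn cD ex ex0.
  have m0 : m = 0%N by apply/eqP; rewrite -leqn0.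
  rewrite m0; exists T, idfun, idfun, 0; split=> //; first by case.
  by apply: (eq_exact_at (D := D)) => // q; apply/matrixP => i j; rewrite !mxE.
rewrite leq_eqVlt in le_mn; case/orP: le_mn => [/eqP Em|lt_mn].
  rewrite Em; exists T, idfun, idfun, 1%:M; split=> //.
    move=> i /=; rewrite (bigD1 i) //= mxE eqxx scale1r big1 ?addr0 // => j ne_j.
    by rewrite mxE eq_sym (negPf ne_j) scale0r.
  by apply: (eq_exact_at (D := D)) => // q; apply/matrixP => i j; rewrite !mxE.
have exh := hyp_exact cD ex (ex0 n lt_mn).
have [] := IH {poly T} c (map_cpx (@hyp_sub T n) D) lt_mn => //.
- exact: map_complex.
- move=> q le_q; apply: (eq_exact_at (D := map_cpx polyC (const_cpx D))).
    by move=> r; apply/matrixP => i j; rewrite !mxE /= mcoeff0_hyp_sub.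
  by apply: polyC_exact; apply: ex0.
move=> T' [iota [Xi [G [XiC XiX exX]]]].
pose G' : 'M[T']_(n.+1, m) := \matrix_(i, j)
  if unlift ord_max i is Some i' then G i' j
  else - \sum_(k < n) iota 'X^(k.+1) * G k j.
exists T', (iota \o polyC), (Xi \o @hyp_sub T n), G'; split.
- by move=> a /=; rewrite hyp_subC XiC.
- move=> i /=; case: (unliftP ord_max i) => [j ->|->].
    rewrite lift_max_widen hyp_sub_widen XiX; apply: eq_bigr => k _.
    by rewrite mxE -lift_max_widen liftK.
  rewrite hyp_sub_max rmorphN rmorph_sum /=.
  under [RHS]eq_bigr => j _ do rewrite mxE unlift_none scaleNr scaler_suml.
  rewrite sumrN exchange_big /=; congr (- _); apply: eq_bigr => k _.
  rewrite -mul_mpolyC rmorphM /= XiC XiX mulr_sumr.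
  by apply: eq_bigr => j _; rewrite mul_mpolyC scalerA.
by apply: (eq_exact_at (D := map_cpx Xi (map_cpx (@hyp_sub T n) D))) => // q;
  apply/matrixP => i j; rewrite !mxE.
Qed.

(** * Graded rows and their liftings *)

Lemma mcoeff_filter n (R : nzRingType) (P : pred 'X_{1..n}) (p : {mpoly R[n]}) m :
  (\sum_(m' <- msupp p | P m') p@_m' *: 'X_[m'])@_m = if P m then p@_m else 0.
Proof.
rewrite (raddf_sum (mcoeff m)) /=.
under eq_bigr do rewrite mcoeffZ mcoeffX.
rewrite -big_filter; set s := filter _ _.
have us : uniq s by rewrite filter_uniq // msupp_uniq.
have [m_s|m_s] := boolP (m \in s).
  rewrite (bigD1_seq m) //= eqxx mulr1 big1 => [|i /negPf ->]; last by rewrite mulr0.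
  by move: m_s; rewrite mem_filter addr0 => /andP[-> _].
rewrite big_seq big1 => [|i i_s]; last first.
  by case: eqP m_s => [<-|_ _]; rewrite ?i_s ?mulr0.
move: m_s; rewrite mem_filter negb_and; case: ifP => //= _.
by move/memN_msupp_eq0.
Qed.

Section GradedRows.

Variables (n : nat) (K : fieldType).

(** Homogeneous rows of degree d, the basis vector k having degree dg k. *)
Definition gr_row c (dg : 'I_c -> nat) (d : nat) (v : 'rV[{mpoly K[n]}]_c) :=
  forall k m, (v 0 k)@_m != 0 -> (mdeg m + dg k = d)%N.

Definition gr_mx c' c (dg' : 'I_c' -> nat) (dg : 'I_c -> nat)
    (D : 'M[{mpoly K[n]}]_(c', c)) :=
  forall k, gr_row dg (dg' k) (row k D).

(** The homogeneous component of degree d. *)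
Definition pr_row c (dg : 'I_c -> nat) (d : nat) (v : 'rV[{mpoly K[n]}]_c) :=
  \row_k \sum_(m <- msupp (v 0 k) | (mdeg m + dg k == d)%N)
     (v 0 k)@_m *: 'X_[m] : 'rV[{mpoly K[n]}]_c.

Lemma coef_pr_row c (dg : 'I_c -> nat) d v k m :
  (pr_row dg d v 0 k)@_m = if (mdeg m + dg k == d)%N then (v 0 k)@_m else 0.
Proof. by rewrite mxE (mcoeff_filter (fun m => (mdeg m + dg k == d)%N)). Qed.

Lemma gr_pr_row c (dg : 'I_c -> nat) d v : gr_row dg d (pr_row dg d v).
Proof. by move=> k m; rewrite coef_pr_row; case: ifP => [/eqP //|_]; rewrite eqxx. Qed.

Lemma pr_row_id c (dg : 'I_c -> nat) d v : gr_row dg d v -> pr_row dg d v = v.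
Proof.
move=> gv; apply/rowP => k; apply/mpolyP => m; rewrite coef_pr_row.
case: ifP => // /negP ne; apply/esym/eqP/contraT => /gv E; case: ne; exact/eqP.
Qed.

Lemma pr_row_mul c' c (dg' : 'I_c' -> nat) (dg : 'I_c -> nat) d
    (D : 'M[{mpoly K[n]}]_(c', c)) v :
  gr_mx dg' dg D -> pr_row dg d (v *m D) = pr_row dg' d v *m D.
Proof.
move=> gD; apply/rowP => l; apply/mpolyP => m; rewrite coef_pr_row !mxE.
rewrite !(raddf_sum (mcoeff m)) /=.
rewrite (_ : (if _ then _ else _) = \sum_k if (mdeg m + dg l == d)%N
  then (v 0 k * D k l)@_m else 0); last by case: ifP => // _; rewrite big1.
apply: eq_bigr => k _; rewrite !mcoeffM.
rewrite (_ : (if _ then _ else _) =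
  \sum_(h : 'X_{1..n < (mdeg m).+1, (mdeg m).+1} | m == (h.1 + h.2)%MM)
    if (mdeg m + dg l == d)%N then (v 0 k)@_h.1 * (D k l)@_h.2 else 0);
  last by case: ifP => // _; rewrite big1.
apply: eq_bigr => h /eqP Em; rewrite coef_pr_row.
have [->|D0] := eqVneq (D k l)@_h.2 0; first by rewrite !mulr0; case: ifP.
have := gD k l h.2; rewrite mxE => /(_ D0) E.
have -> : (mdeg m + dg l = mdeg h.1 + dg' k)%N by have EE := congr1 mdeg Em; rewrite mdegD in EE; rewrite -E addnA -EE.
by case: ifP => // _; rewrite mul0r.
Qed.

Lemma gr_row_mul c' c (dg' : 'I_c' -> nat) (dg : 'I_c -> nat) d
    (D : 'M[{mpoly K[n]}]_(c', c)) v :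
  gr_mx dg' dg D -> gr_row dg' d v -> gr_row dg d (v *m D).
Proof.
by move=> gD gv; rewrite -(pr_row_id gv) -(pr_row_mul _ _ gD); apply: gr_pr_row.
Qed.

Lemma gr_mx_mul c'' c' c (dg'' : 'I_c'' -> nat) (dg' : 'I_c' -> nat)
    (dg : 'I_c -> nat) (E : 'M[{mpoly K[n]}]_(c'', c'))
    (D : 'M[{mpoly K[n]}]_(c', c)) :
  gr_mx dg'' dg' E -> gr_mx dg' dg D -> gr_mx dg'' dg (E *m D).
Proof. by move=> gE gD k; rewrite row_mul; apply: (gr_row_mul gD). Qed.

Lemma gr_mx1 c (dg : 'I_c -> nat) : gr_mx dg dg 1%:M.
Proof.
move=> k l m; rewrite !mxE; case: (k =P l) => [->|_]; last by rewrite mcoeff0 eqxx.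
by rewrite mcoeff1; case: (m =P 0%MM) => [-> _|_]; rewrite ?mdeg0 // eqxx.
Qed.

(** The projector on the basis vectors of degree j. *)
Definition degp c (dg : 'I_c -> nat) (j : nat) : 'M[K]_c :=
  diag_mx (\row_k (dg k == j)%:R).

Lemma degpE c (dg : 'I_c -> nat) j k l :
  degp dg j k l = ((k == l) && (dg k == j))%:R.
Proof. by rewrite !mxE; case: (k =P l) => [->|_]; rewrite ?mulr1n ?mulr0n. Qed.

Lemma mul_degp c a (dg : 'I_c -> nat) j (M : 'M[K]_(c, a)) k l :
  (degp dg j *m M) k l = if dg k == j then M k l else 0.
Proof. by rewrite mul_diag_mx !mxE; case: eqP; rewrite ?mul1r ?mul0r. Qed.

Lemma mulmx_degp c a (dg : 'I_c -> nat) j (M : 'M[K]_(a, c)) k l :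
  (M *m degp dg j) k l = if dg l == j then M k l else 0.
Proof. by rewrite mul_mx_diag !mxE; case: eqP; rewrite ?mulr1 ?mulr0. Qed.

Lemma degp_idem c (dg : 'I_c -> nat) j : degp dg j *m degp dg j = degp dg j.
Proof.
apply/matrixP=> k l; by rewrite mul_degp !degpE; case: (dg k == j); rewrite ?andbF.
Qed.

Lemma rank_degp c (dg : 'I_c -> nat) j :
  \rank (degp dg j) = #|[pred k | dg k == j]|.
Proof.
set Q := [pred k | _].
pose S : 'M[K]_(#|Q|, c) := \matrix_(i, k) (enum_val i == k)%:R.
have SS : S *m S^T = 1%:M.
  apply/matrixP => i i'; rewrite !mxE (bigD1 (enum_val i)) //= !mxE eqxx mul1r.
  rewrite big1 => [|k /negPf ne]; last by rewrite !mxE eq_sym ne mul0r.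
  by rewrite addr0 (inj_eq enum_val_inj) eq_sym.
have SP : S *m degp dg j = S.
  apply/matrixP => i k; rewrite mulmx_degp; case: eqP => // ne; rewrite mxE.
  by case: eqP => // E; case: ne; rewrite -E; have := enum_valP i; rewrite inE => /eqP.
have PS : S^T *m S = degp dg j.
  apply/matrixP => k l; rewrite degpE mxE.
  have [Qk|Qk] := boolP (k \in Q); last first.
    rewrite [dg k == j](negPf Qk) andbF big1 // => i _; rewrite !mxE.
    by case: eqP => [E|]; rewrite ?mul0r //; rewrite -E enum_valP in Qk.
  rewrite [dg k == j](Qk) andbT (bigD1 (enum_rank_in Qk k)) //= !mxE.
  rewrite enum_rankK_in // eqxx mul1r big1 ?addr0 // => i ne; rewrite !mxE.
  case: eqP => [E|]; rewrite ?mul0r //; case/eqP: ne.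
  by apply: enum_val_inj; rewrite enum_rankK_in.
apply/eqP; rewrite eqn_leq; apply/andP; split.
  by rewrite -PS (leq_trans (mxrankM_maxr _ _)) // rank_leq_row.
have r1 : \rank S = #|Q|.
  apply/eqP; rewrite eqn_leq rank_leq_row /=.
  by rewrite -{1}(mxrank1 K #|Q|) -SS mxrankM_maxl.
by rewrite -r1 -SP mxrankM_maxr.
Qed.

Lemma const_gr c' c (dg' : 'I_c' -> nat) (dg : 'I_c -> nat) j
    (D : 'M[{mpoly K[n]}]_(c', c)) :
  gr_mx dg' dg D ->
  degp dg' j *m map_mx (mcoeff 0%MM) D = map_mx (mcoeff 0%MM) D *m degp dg j.
Proof.
move=> gD; apply/matrixP=> k l; rewrite mul_degp mulmx_degp mxE /=.
have [->|D0] := eqVneq (D k l)@_0 0; first by rewrite !if_same.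
by have := gD k l 0%MM; rewrite mxE mdeg0 add0n => /(_ D0) ->.
Qed.

End GradedRows.

Section Lift.

Variables (n : nat) (K : fieldType).

Definition lift_mx (a b e : nat) (A : 'M[{mpoly K[n]}]_(a, b))
    (B : 'M[{mpoly K[n]}]_(e, b)) : 'M[{mpoly K[n]}]_(a, e) :=
  epsilon (inhabits 0) (fun X => A = X *m B).

Lemma lift_mxP a b e (A : 'M_(a, b)) (B : 'M_(e, b)) :
  (forall k, exists w, row k A = w *m B) -> A = lift_mx A B *m B.
Proof.
move=> /choice [f Hf].
apply: (epsilon_spec (inhabits 0) (fun X => A = X *m B)).
exists (\matrix_k f k); apply/row_matrixP => k.
by rewrite row_mul rowK.
Qed.

(** A lift chosen row by row need not preserve degrees, but its homogeneous
    components of the right degrees still form a lift. *)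
Definition gr_lift (a b e : nat) (dga : 'I_a -> nat) (dge : 'I_e -> nat)
    (A : 'M[{mpoly K[n]}]_(a, b)) (B : 'M_(e, b)) : 'M[{mpoly K[n]}]_(a, e) :=
  \matrix_k pr_row dge (dga k) (row k (lift_mx A B)).

Lemma gr_mx_lift a b e dga dge (A : 'M_(a, b)) (B : 'M_(e, b)) :
  gr_mx dga dge (gr_lift dga dge A B).
Proof. by move=> k; rewrite rowK; apply: gr_pr_row. Qed.

Lemma gr_liftP a b e dga dgb dge (A : 'M_(a, b)) (B : 'M_(e, b)) :
  gr_mx dga dgb A -> gr_mx dge dgb B ->
  (forall k, exists w, row k A = w *m B) -> A = gr_lift dga dge A B *m B.
Proof.
move=> gA gB /lift_mxP HX.
apply/row_matrixP => k; rewrite row_mul rowK -(pr_row_mul _ _ gB) -row_mul -HX.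
by rewrite pr_row_id //; apply: gA.
Qed.

End Lift.

(** A chain map f that is inverted by g up to a homotopy is injective on
    homology. The degree j part of the middle module is the image of the
    projector P, so the homology has dimension rank P - rank A - rank B. *)
Lemma homology_rank_le (K : fieldType) (n a b n' a' b' : nat)
    (P : 'M[K]_n) (A : 'M_(n, a)) (B : 'M_(b, n))
    (P' : 'M[K]_n') (A' : 'M_(n', a')) (B' : 'M_(b', n'))
    (f : 'M_(n, n')) (g : 'M_(n', n)) :
  P *m A = A -> B *m P = B -> B *m A = 0 ->
  P' *m A' = A' -> B' *m P' = B' -> B' *m A' = 0 ->
  (exists h, f *m A' = A *m h) -> P *m f = f *m P' ->
  (exists k, B' *m g = k *m B) ->
  (exists s t, P *m f *m g = P *m (1%:M + s *m B + A *m t)) ->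
  (\rank P + \rank A' + \rank B' <= \rank P' + \rank A + \rank B)%N.
Proof.
move=> PA BP BA PA' BP' BA' [h fA] Pf [k Bg] [s [t fg]].
pose Z := (P :&: kermx A)%MS; pose Z' := (P' :&: kermx A')%MS.
have rZ : (\rank A + \rank Z = \rank P)%N by rewrite -{1}PA mxrank_mul_ker.
have rZ' : (\rank A' + \rank Z' = \rank P')%N by rewrite -{1}PA' mxrank_mul_ker.
have BZ' : (B' <= Z')%MS.
  rewrite sub_capmx; apply/andP; split; first by apply/submxP; exists B'.
  exact/sub_kermxP.
pose C := cokermx B'.
have r1 : (\rank (Z *m (f *m C)) + \rank (Z :&: kermx (f *m C))%MS = \rank Z)%N.
  exact: mxrank_mul_ker.
have r2 : (\rank (Z' *m C) + \rank (Z' :&: kermx C)%MS = \rank Z')%N.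
  exact: mxrank_mul_ker.
have r3 : (\rank (Z :&: kermx (f *m C))%MS <= \rank B)%N.
  apply: mxrankS; set Y := (Z :&: _)%MS.
  have /submxP [y Hy] : (Y <= P)%MS.
    by rewrite (submx_trans (capmxSl _ _)) // capmxSl.
  have YA : Y *m A = 0.
    by apply/sub_kermxP; rewrite (submx_trans (capmxSl _ _)) // capmxSr.
  have /submxP [w Hw] : (Y *m f <= B')%MS.
    by rewrite submxE -mulmxA; apply/eqP/sub_kermxP/capmxSr.
  apply/submxP; exists (w *m k - Y *m s).
  rewrite mulmxBl -[w *m k *m B]mulmxA -Bg mulmxA -Hw.
  have -> : Y *m f *m g = Y + Y *m s *m B.
    rewrite {1}Hy -!mulmxA [P *m (f *m g)]mulmxA fg mulmxA -Hy.
    by rewrite !mulmxDr mulmx1 !mulmxA YA mul0mx addr0.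
  by rewrite addrK.
have r4 : (\rank B' <= \rank (Z' :&: kermx C)%MS)%N.
  apply: mxrankS; rewrite sub_capmx BZ' /=; apply/sub_kermxP; exact: mulmx_coker.
have r5 : (\rank (Z *m (f *m C)) <= \rank (Z' *m C))%N.
  rewrite mulmxA; apply: mxrankS; apply: submxMr.
  rewrite sub_capmx; apply/andP; split.
    have /submxP [y ->] : (Z <= P)%MS by exact: capmxSl.
    by rewrite -mulmxA Pf mulmxA; apply/submxP; exists (y *m f).
  apply/sub_kermxP; rewrite -mulmxA fA mulmxA.
  have -> : Z *m A = 0 by apply/sub_kermxP/capmxSr.
  exact: mul0mx.
lia.
Qed.

(** * Independence of the Betti numbers from the resolution *)

Section Resolution.

Variables (n : nat) (K : fieldType).

(** The resolution with its augmentation: position 0 is the polynomial ring and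
    position i + 1 is F_i, so that a resolution of an ideal is exact at every
    position. *)
Definition rc (F : free_complex K n) (p : nat) : nat :=
  if p is i.+1 then rk F i else 1%N.

Definition rD (F : free_complex K n) (p : nat) :
    'M[{mpoly K[n]}]_(rc F p.+1, rc F p) :=
  match p return 'M[{mpoly K[n]}]_(rc F p.+1, rc F p) with
  | 0 => aug F
  | i.+1 => dif F i
  end.

Definition rdg (F : free_complex K n) (p : nat) : 'I_(rc F p) -> nat :=
  match p return 'I_(rc F p) -> nat with
  | 0 => fun _ => 0%N
  | i.+1 => @dg K n F i
  end.
Arguments rdg : clear implicits.

(** The degree j part of the differential modulo the variables. *)
Definition rE (F : free_complex K n) (j p : nat) : 'M[K]_(rc F p.+1, rc F p) :=
  degp K (rdg F p.+1) j *m const_cpx (rD F) p.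

Lemma rD_gr F p : is_graded F -> gr_mx (rdg F p.+1) (rdg F p) (rD F p).
Proof.
case=> gr_aug gr_dif; case: p => [|i] k l m; rewrite mxE.
  rewrite ord1 => ne; rewrite addn0.
  by apply: (dhomog_mf (gr_aug k)); rewrite mcoeff_msupp.
rewrite -mcoeff_msupp => m_supp; have := gr_dif i k l; case: leqP => [le h|_ /eqP h].
  by rewrite (dhomog_mf h) // subnK.
by move: m_supp; rewrite /= h msupp0.
Qed.

Arguments rD_gr [F] p gF k l m _ : rename.

Lemma dif_KE F i j : is_graded F -> dif_K F i j = rE F j i.+1.
Proof.
move=> /(rD_gr i.+1) gF; apply/matrixP => k l; rewrite mul_degp !mxE /=.
case: (dg F k =P j) => //= Ek; case: eqP => // El.
apply/esym/eqP/contraT => ne; case: El.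
by have := gF k l 0%MM; rewrite mxE mdeg0 add0n => /(_ ne) E; rewrite -Ek.
Qed.

Lemma tor_dimE F i j : is_graded F -> tor_dim F i j =
  (\rank (degp K (rdg F i.+1) j)
   - (if i is 0 then 0 else \rank (rE F j i)) - \rank (rE F j i.+1))%N.
Proof.
move=> gF; rewrite /tor_dim rank_degp dif_KE //.
by case: i => // i; rewrite dif_KE.
Qed.

Variables (F : free_complex K n) (J : {mpoly K[n]} -> Prop).
Hypothesis resF : is_free_resolution F J.

Lemma res_graded : is_graded F. Proof. by case: resF. Qed.

Lemma res_im f : J f <-> exists v : 'rV_(rc F 1), f = (v *m rD F 0) 0 0.
Proof. by case: resF. Qed.

Lemma res_exact p : exact_at (rD F) p.
Proof. by case: resF => _ _ ex0 ex; case: p => [|i] v; [move/ex0|move/ex]. Qed.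

Lemma res_complex : is_complex (rD F).
Proof.
case: resF => _ _ ex0 ex p; apply/row_matrixP => k; rewrite row_mul row0.
by case: p k => [|i] k; [apply/ex0|apply/ex]; eexists; rewrite rowE.
Qed.

Lemma rE_mul j p : rE F j p.+1 *m rE F j p = 0.
Proof.
have gF := rD_gr p res_graded; have gF1 := rD_gr p.+1 res_graded.
rewrite /rE /const_cpx /map_cpx (const_gr j gF) mulmxA -[_ *m _ *m map_mx _ _]mulmxA.
by rewrite -map_mxM res_complex map_mx0 mulmx0 mul0mx.
Qed.

End Resolution.

Arguments rdg {n K} F p _.
Arguments rD_gr {n K F} p gF k l m _ : rename.

Section Comparison.

Variables (n : nat) (K : fieldType) (J : {mpoly K[n]} -> Prop).

(** The comparison map between two resolutions of the same ideal, lifted step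
    by step along the exactness of the target. *)
Fixpoint chain_map (F G : free_complex K n) (p : nat) :
    'M[{mpoly K[n]}]_(rc F p, rc G p) :=
  if p is q.+1 then
    gr_lift (rdg F q.+1) (rdg G q.+1) (rD F q *m chain_map F G q) (rD G q)
  else 1%:M.

Lemma gr_chain_map F G p :
  gr_mx (rdg F p) (rdg G p) (chain_map F G p).
Proof. by case: p => [|p]; [exact: gr_mx1|exact: gr_mx_lift]. Qed.

Arguments gr_chain_map : clear implicits.

Lemma chain_mapP F G p :
  is_free_resolution F J -> is_free_resolution G J ->
  rD F p *m chain_map F G p = chain_map F G p.+1 *m rD G p.
Proof.
move=> rF rG; have grF := rD_gr _ (res_graded rF).
have grG := rD_gr _ (res_graded rG).
have gDf q : gr_mx (rdg F q.+1) (rdg G q) (rD F q *m chain_map F G q).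
  by apply: gr_mx_mul; [apply: grF|apply: gr_chain_map].
elim: p => [|p IH]; apply: gr_liftP => // k.
  rewrite mulmx1; have /(res_im rG) [v Hv] : J ((row k (rD F 0)) 0 0).
    by apply/(res_im rF); exists (delta_mx 0 k); rewrite -rowE.
  by exists v; apply/rowP => l; rewrite ord1.
apply: (res_exact rG).
by rewrite -row_mul -mulmxA -IH mulmxA (res_complex rF) mul0mx row0.
Qed.

Section Homotopy.

Variables F G : free_complex K n.
Hypotheses (rF : is_free_resolution F J) (rG : is_free_resolution G J).

Let eta p := chain_map F G p *m chain_map G F p - 1%:M.

(** The composition of the two comparison maps is homotopic to the identity by
    the same step by step lifting. *)
Fixpoint homotopy (p : nat) : 'M[{mpoly K[n]}]_(rc F p, rc F p.+1) :=
  if p is q.+1 then lift_mx (eta q.+1 - rD F q *m homotopy q) (rD F q.+1) else 0.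

Lemma eta_chain p : rD F p *m eta p = eta p.+1 *m rD F p.
Proof.
rewrite /eta mulmxBr mulmxBl mulmx1 mul1mx mulmxA (chain_mapP _ rF rG).
by rewrite -!mulmxA (chain_mapP _ rG rF).
Qed.

Lemma homotopyP p :
  eta p.+1 = rD F p *m homotopy p + homotopy p.+1 *m rD F p.+1.
Proof.
suff -> : homotopy p.+1 *m rD F p.+1 = eta p.+1 - rD F p *m homotopy p.
  by rewrite addrC subrK.
elim: p => [|p IH]; apply/esym/lift_mxP => k; apply: (res_exact rF).
  rewrite mulmx0 subr0 -row_mul -eta_chain /eta /= mulmx1 subrr mulmx0.
  exact: row0.
rewrite -row_mul mulmxBl -eta_chain.
rewrite -[rD F p.+1 *m homotopy p.+1 *m _]mulmxA IH.
rewrite (mulmxBr _ (eta p.+1) (rD F p *m homotopy p)).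
by rewrite [rD F p.+1 *m (rD F p *m _)]mulmxA (res_complex rF) mul0mx subr0
  subrr row0.
Qed.

End Homotopy.

Lemma chain_block a b c d (P : 'M[K]_a) (Q : 'M_b) (x : 'M_(a, b))
    (E : 'M_(b, c)) (D : 'M_(a, d)) (y : 'M_(d, c)) :
  P *m x = x *m Q -> Q *m Q = Q -> x *m E = D *m y ->
  P *m x *m (Q *m E) = P *m D *m y.
Proof.
by move=> Px QQ xE; rewrite Px -mulmxA (mulmxA Q) QQ mulmxA -Px -!mulmxA xE.
Qed.

Lemma homology_le F G i j :
  is_free_resolution F J -> is_free_resolution G J ->
  (\rank (degp K (rdg F i.+1) j)
   + (if i is 0 then 0 else \rank (rE G j i)) + \rank (rE G j i.+1)
   <= \rank (degp K (rdg G i.+1) j)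
   + (if i is 0 then 0 else \rank (rE F j i)) + \rank (rE F j i.+1))%N.
Proof.
move=> rF rG.
pose c0 := mcoeff (R := K) (0%MM : 'X_{1..n}).
pose EI (H : free_complex K n) := if i is 0 then 0 else rE H j i.
have rEI H : (if i is 0 then 0 else \rank (rE H j i)) = \rank (EI H).
  by rewrite /EI; case: (i) => //; rewrite mxrank0.
rewrite !rEI; have gF p := const_gr j (rD_gr p (res_graded rF)).
have gG p := const_gr j (rD_gr p (res_graded rG)).
have gf p := const_gr j (gr_chain_map F G p).
have gg p := const_gr j (gr_chain_map G F p).
have EP H : degp K (rdg H i.+1) j *m EI H = EI H.
  rewrite /EI /rE; case: (i) => [|i']; first by rewrite mulmx0.
  by rewrite mulmxA degp_idem.
have BA H : is_free_resolution H J -> rE H j i.+1 *m EI H = 0.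
  move=> rH; rewrite /EI; case: (i) => [|i']; first by rewrite mulmx0.
  exact: rE_mul rH _ _.
have BP H : is_free_resolution H J ->
    rE H j i.+1 *m degp K (rdg H i.+1) j = rE H j i.+1.
  move=> rH; rewrite /rE -mulmxA -(const_gr j (rD_gr i.+1 (res_graded rH))).
  by rewrite mulmxA degp_idem.
have chf : exists h, degp K (rdg F i.+1) j *m map_mx c0 (chain_map F G i.+1)
    *m EI G = EI F *m h.
  exists (map_mx c0 (chain_map F G i)); rewrite /EI; case: (i) => [|i'].
    by rewrite mulmx0 mul0mx.
  apply: (chain_block (gf i'.+2) (degp_idem _ _ _)).
  by rewrite -!map_mxM (chain_mapP _ rF rG).
pose f := degp K (rdg F i.+1) j *m map_mx c0 (chain_map F G i.+1).
pose g := degp K (rdg G i.+1) j *m map_mx c0 (chain_map G F i.+1).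
apply: (@homology_rank_le _ _ _ _ _ _ _ _ _ _ _ _ _ f g) => //.
- exact: BP.
- exact: BA.
- exact: BP.
- exact: BA.
- by rewrite /f mulmxA degp_idem -mulmxA -gf mulmxA degp_idem.
- exists (map_mx c0 (chain_map G F i.+2)).
  by rewrite /g mulmxA BP // /rE -mulmxA -map_mxM (chain_mapP _ rG rF)
             map_mxM mulmxA (gg i.+2) -mulmxA.
- exists (map_mx c0 (homotopy F G i.+1)).
  exists (map_mx c0 (homotopy F G i) *m degp K (rdg F i.+1) j).
  set P := degp K (rdg F i.+1) j; pose a := map_mx c0 (chain_map F G i.+1).
  pose b := map_mx c0 (chain_map G F i.+1).
  have Pab : P *m (a *m b) = a *m b *m P.
    by rewrite mulmxA [P *m a]gf -/a -(mulmxA a (degp _ _ _) b) [_ *m b]gg (mulmxA a).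
  have PP : P *m P = P by exact: degp_idem.
  have -> : P *m f *m g = P *m (a *m b) *m P.
    rewrite Pab -(mulmxA (a *m b)) PP -Pab /f /g -/P -/a -/b (mulmxA P P) PP.
    rewrite -(mulmxA P a) (mulmxA a) -[a *m degp _ _ _]gf -/P -/a.
    by rewrite -(mulmxA P a b) (mulmxA P P) PP.
  have -> : a *m b = 1%:M + (map_mx c0 (rD F i) *m map_mx c0 (homotopy F G i) +
      map_mx c0 (homotopy F G i.+1) *m map_mx c0 (rD F i.+1)).
    rewrite -!map_mxM -map_mxD -(homotopyP rF rG) map_mxB map_mx1 map_mxM.
    by rewrite addrC subrK.
  have EB : rE F j i.+1 = map_mx c0 (rD F i.+1) *m P by rewrite /rE gF.
  have EA : EI F *m map_mx c0 (homotopy F G i) =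
            P *m map_mx c0 (rD F i) *m map_mx c0 (homotopy F G i).
    by rewrite /EI /P; case: (i) => [|i'] //; rewrite map_mx0 !mulmx0.
  rewrite EB -[P *m _ *m P]mulmxA; rewrite !mulmxDl !mulmxDr mul1mx mulmx1.
  rewrite PP -addrA; congr (_ + _); rewrite addrC.
  by rewrite !mulmxA (EP F) EA.
Qed.

Lemma tor_dim_unique F G i j :
  is_free_resolution F J -> is_free_resolution G J ->
  tor_dim F i j = tor_dim G i j.
Proof.
move=> rF rG; have := homology_le i j rF rG; have := homology_le i j rG rF.
rewrite (tor_dimE _ _ (res_graded rF)) (tor_dimE _ _ (res_graded rG)); lia.
Qed.

End Comparison.

(** * Dimensions of subspaces *)

Section Dimension.

Variable K : fieldType.

Definition subspace (V : lmodType K) (W : V -> Prop) : Prop :=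
  W 0 /\ forall a u v, W u -> W v -> W (a *: u + v).

(** The spaces in question are subsets of infinite-dimensional spaces of
    polynomials, so a dimension is given by a finite basis. *)
Definition has_dim (V : lmodType K) (W : V -> Prop) (r : nat) : Prop :=
  exists b : 'I_r -> V,
    [/\ forall i, W (b i),
        forall v, W v -> exists c : 'I_r -> K, v = \sum_i c i *: b i &
        forall c : 'I_r -> K, \sum_i c i *: b i = 0 -> forall i, c i = 0].

Section Subspace.

Variables (V : lmodType K) (W : V -> Prop).
Hypothesis subW : subspace W.

Lemma subspace0 : W 0. Proof. by case: subW. Qed.

Lemma subspaceD u v : W u -> W v -> W (u + v).
Proof. by move=> Wu Wv; rewrite -[u]scale1r; apply: (proj2 subW). Qed.

Lemma subspaceZ a u : W u -> W (a *: u).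
Proof. by move=> Wu; rewrite -[_ *: _]addr0; apply: (proj2 subW) => //; exact: subspace0. Qed.

Lemma subspaceB u v : W u -> W v -> W (u - v).
Proof. by move=> Wu Wv; rewrite addrC -scaleN1r; apply: (proj2 subW). Qed.

Lemma subspace_sum (I : finType) (P : pred I) (F : I -> V) :
  (forall i, P i -> W (F i)) -> W (\sum_(i | P i) F i).
Proof. by move=> WF; apply: (big_ind W) => //; [exact: subspace0|exact: subspaceD]. Qed.

End Subspace.

Lemma eq_has_dim (V : lmodType K) (W W' : V -> Prop) r :
  (forall v, W v <-> W' v) -> has_dim W r -> has_dim W' r.
Proof.
move=> E [b [Wb sp fr]]; exists b; split=> // [i|v /E]; last exact: sp.
exact/E.
Qed.

Lemma free_size_le (V : lmodType K) r s (b : 'I_r -> V) (g : 'I_s -> V) :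
  (forall i, exists c : 'I_s -> K, b i = \sum_j c j *: g j) ->
  (forall c : 'I_r -> K, \sum_i c i *: b i = 0 -> forall i, c i = 0) ->
  (r <= s)%N.
Proof.
move=> /choice [M HM] fr.
pose A : 'M[K]_(r, s) := \matrix_(i, j) M i j.
have : row_free A.
  rewrite -kermx_eq0; apply/eqP/row_matrixP => k; rewrite row0.
  have : row k (kermx A) *m A = 0 by rewrite -row_mul mulmx_ker row0.
  move: (row k _) => x xA; apply/rowP => i; rewrite mxE.
  apply: (fr (x 0)); under eq_bigr => l _ do rewrite HM scaler_sumr.
  rewrite exchange_big big1 //= => j _.
  under eq_bigr => l _ do rewrite scalerA.
  rewrite -scaler_suml (_ : \sum_l _ = (x *m A) 0 j); first by rewrite xA mxE scale0r.
  by rewrite mxE; apply: eq_bigr => l _; rewrite mxE.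
by rewrite /row_free => /eqP <-; exact: rank_leq_col.
Qed.

Lemma dim_free_le (V : lmodType K) (W : V -> Prop) r s (b : 'I_r -> V) :
  has_dim W s -> (forall i, W (b i)) ->
  (forall c : 'I_r -> K, \sum_i c i *: b i = 0 -> forall i, c i = 0) -> (r <= s)%N.
Proof. by move=> [g [_ sp _]] Wb; apply: free_size_le => i; apply: sp. Qed.

Lemma dim_uniq (V : lmodType K) (W : V -> Prop) r s :
  has_dim W r -> has_dim W s -> r = s.
Proof.
move=> dr ds; have [b [Wb _ fb]] := dr; have [g [Wg _ fg]] := ds.
by apply/eqP; rewrite eqn_leq (dim_free_le ds Wb fb) (dim_free_le dr Wg fg).
Qed.

Lemma dim_line (V : lmodType K) (W W' : V -> Prop) r w :
  subspace W' -> has_dim W' r -> (forall v, W' v -> W v) -> W w -> ~ W' w ->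
  (forall v, W v -> exists a, W' (v - a *: w)) -> has_dim W r.+1.
Proof.
move=> sW' [b [Wb sp fr]] W'W Ww nw Hw.
exists (fun i => if unlift ord0 i is Some j then b j else w); split.
- by move=> i; case: unliftP => [j _|_] //; apply: W'W.
- move=> v /Hw [a /sp [c Hc]].
  exists (fun i => if unlift ord0 i is Some j then c j else a).
  rewrite big_ord_recl unlift_none.
  under eq_bigr => i _ do rewrite liftK.
  by rewrite -Hc addrC subrK.
move=> c; rewrite big_ord_recl unlift_none.
under eq_bigr => i _ do rewrite liftK.
move=> H.
have c0 : c ord0 = 0.
  apply/eqP/contraT => ne; case: nw.
  have -> : w = - (c ord0)^-1 *: \sum_i c (lift ord0 i) *: b i.
    move/eqP: H; rewrite addr_eq0 => /eqP /(congr1 ( *:%R (c ord0)^-1)).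
    by rewrite scalerA mulVf // scale1r scalerN scaleNr.
  by apply: (subspaceZ sW'); apply: (subspace_sum sW') => i _; apply: (subspaceZ sW').
move: H; rewrite c0 scale0r add0r => /fr cl i.
by case: (unliftP ord0 i) => [j ->|->].
Qed.

Lemma dim_exists (V : lmodType K) s (g : 'I_s -> V) (W : V -> Prop) :
  subspace W -> (forall v, W v -> exists c : 'I_s -> K, v = \sum_j c j *: g j) ->
  exists r, has_dim W r.
Proof.
elim: s g W => [|s IH] g W sW sp.
  exists 0%N, (fun _ => 0); split=> [i|v /sp [c ->]|c _ i]; try by case: i.
  by exists (fun _ => 0); rewrite !big_ord0.
pose W' v := W v /\ exists c : 'I_s -> K, v = \sum_j c j *: g (lift ord0 j).
have sW' : subspace W'.
  split; first by split; [exact: subspace0|exists (fun _ => 0); rewrite big1 // => i _; rewrite scale0r].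
  move=> a u v [Wu [c Hc]] [Wv [d Hd]]; split; first by apply: (proj2 sW).
  exists (fun j => a * c j + d j); rewrite Hc Hd scaler_sumr -big_split /=.
  by apply: eq_bigr => j _; rewrite scalerA scalerDl.
have [r dr] := IH (fun j => g (lift ord0 j)) W' sW' (fun v => @proj2 _ _).
case: (classic (forall v, W v -> W' v)) => [H|].
  by exists r; apply: eq_has_dim dr => v; split=> [[]|/H].
move=> nH; have [w [Ww nw]] : exists w, W w /\ ~ W' w.
  apply: NNPP => H; apply: nH => v Wv; apply: NNPP => nv; apply: H; by exists v.
exists r.+1; apply: (dim_line sW' dr _ Ww nw) => [v [] //|v Wv].
have [c Hc] := sp _ Ww; have [d Hd] := sp _ Wv.
rewrite big_ord_recl in Hc; rewrite big_ord_recl in Hd.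
have c0 : c ord0 != 0.
  apply/eqP => c0; apply: nw; split=> //; exists (fun j => c (lift ord0 j)).
  by rewrite Hc c0 scale0r add0r.
exists (d ord0 / c ord0); split.
  by apply: (subspaceB sW) => //; apply: (subspaceZ sW).
exists (fun j => d (lift ord0 j) - d ord0 / c ord0 * c (lift ord0 j)).
rewrite {1}Hd {1}Hc scalerDr scalerA divfK // opprD addrACA subrr add0r.
rewrite scaler_sumr -sumrB; apply: eq_bigr => j _.
by rewrite scalerBl scalerA.
Qed.

Section LinearMap.

Variables (V V' : lmodType K) (phi : V -> V').
Hypothesis phi_lin : forall a u v, phi (a *: u + v) = a *: phi u + phi v.

Lemma phi0 : phi 0 = 0.
Proof. by have := phi_lin (-1) 0 0; rewrite scaler0 addr0 scaleN1r addNr. Qed.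

Lemma phi_sum r (c : 'I_r -> K) (b : 'I_r -> V) :
  phi (\sum_i c i *: b i) = \sum_i c i *: phi (b i).
Proof.
elim: r c b => [|r IH] c b; first by rewrite !big_ord0 phi0.
by rewrite !big_ord_recl phi_lin IH.
Qed.

Lemma dim_ext (W : V -> Prop) (W2 : V' -> Prop) a b :
  subspace W -> has_dim (fun v => W v /\ phi v = 0) a -> has_dim W2 b ->
  (forall v, W v -> W2 (phi v)) ->
  (forall v', W2 v' -> exists2 v, W v & phi v = v') -> has_dim W (a + b).
Proof.
move=> sW [g [Wg spg frg]] [h [Wh sph frh]] W2i W2s.
have /choice [h' Hh] : forall i, exists v, W v /\ phi v = h i.
  by move=> i; have [v] := W2s _ (Wh i); exists v.
exists (fun i => match split i with inl j => g j | inr j => h' j end).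
have splitsum (c : 'I_(a + b) -> K) :
    \sum_i c i *: match split i with inl j => g j | inr j => h' j end =
    \sum_j c (lshift b j) *: g j + \sum_j c (rshift a j) *: h' j.
  rewrite big_split_ord /=; congr (_ + _); apply: eq_bigr => j _.
    by rewrite (unsplitK (inl j)).
  by rewrite (unsplitK (inr j)).
split.
- by move=> i; case: split => j; [have [] := Wg j|have [] := Hh j].
- move=> v Wv; have [d Hd] := sph _ (W2i _ Wv).
  have [|c Hc] := spg (v - \sum_j d j *: h' j).
    split.
      apply: (subspaceB sW) => //; apply: (subspace_sum sW) => j _.
      by apply: (subspaceZ sW); have [] := Hh j.
    rewrite addrC -scaleN1r phi_lin phi_sum Hd scaleN1r.
    apply/eqP; rewrite addrC subr_eq0; apply/eqP/eq_bigr => j _.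
    by have [_ ->] := Hh j.
  exists (fun i => match split i with inl j => c j | inr j => d j end).
  rewrite splitsum.
  under eq_bigr => j _ do rewrite (unsplitK (inl j)).
  under [X in _ + X]eq_bigr => j _ do rewrite (unsplitK (inr j)).
  by rewrite -Hc subrK.
move=> c; rewrite splitsum => H.
have d0 j : c (rshift a j) = 0.
  apply: (frh (fun j => c (rshift a j))).
  have := congr1 phi H; rewrite phi0 -[X in phi (X + _)]scale1r phi_lin !phi_sum.
  rewrite big1 => [|i _]; last by have [_ ->] := Wg i; rewrite scaler0.
  rewrite scaler0 add0r => E; rewrite -[RHS]E; apply: eq_bigr => i _.
  by have [_ ->] := Hh i.
have c0 j : c (lshift b j) = 0.
  apply: (frg (fun j => c (lshift b j))); rewrite -[RHS]H [X in _ = _ + X]big1 ?addr0 //.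
  by move=> i _; rewrite d0 scale0r.
by move=> i; rewrite -(splitK i); case: split.
Qed.

Lemma dim_inj (W : V -> Prop) (W2 : V' -> Prop) r :
  has_dim W r -> (forall v, W v -> phi v = 0 -> v = 0) -> subspace W ->
  (forall v, W v -> W2 (phi v)) ->
  (forall v', W2 v' -> exists2 v, W v & phi v = v') -> has_dim W2 r.
Proof.
move=> [b [Wb sp fr]] inj sW W2i W2s; exists (fun i => phi (b i)); split.
- by move=> i; apply: W2i.
- move=> v' /W2s [v /sp [c ->] <-]; exists c; exact: phi_sum.
move=> c; rewrite -phi_sum => /inj H; apply: fr; apply: H.
by apply: (subspace_sum sW) => i _; apply: (subspaceZ sW).
Qed.

End LinearMap.

End Dimension.

(** * Hilbert functions of images *)

(** Rows of polynomials are canonically a module over the polynomials; this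
    copy of the type carries their structure of vector space over the ground
    field. *)
Definition krow (K : fieldType) (n c : nat) : Type := 'rV[{mpoly K[n]}]_c.

HB.instance Definition _ (K : fieldType) (n c : nat) :=
  GRing.Zmodule.on (krow K n c).

Section KRow.

Variables (K : fieldType) (n c : nat).

Definition scale_krow (a : K) (v : krow K n c) : krow K n c := map_mx ( *:%R a) v.

Lemma scale_krowA a b v : scale_krow a (scale_krow b v) = scale_krow (a * b) v.
Proof. by apply/rowP => i; rewrite !mxE scalerA. Qed.

Lemma scale_krow1 : left_id 1 scale_krow.
Proof. by move=> v; apply/rowP => i; rewrite !mxE scale1r. Qed.

Lemma scale_krowDr : right_distributive scale_krow +%R.
Proof. by move=> a u v; apply/rowP => i; rewrite !mxE scalerDr. Qed.

Lemma scale_krowDl v : {morph scale_krow^~ v : a b / a + b}.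
Proof. by move=> a b; apply/rowP => i; rewrite !mxE scalerDl. Qed.

HB.instance Definition _ := GRing.Zmodule_isLmodule.Build K (krow K n c)
  scale_krowA scale_krow1 scale_krowDr scale_krowDl.

Lemma krowZE (a : K) (v : krow K n c) : a *: v = a%:MP *: (v : 'rV[{mpoly K[n]}]_c) :> 'rV__.
Proof. by apply/rowP => i; rewrite !mxE mul_mpolyC. Qed.

Lemma krowZ_coef (a : K) (v : krow K n c) i m :
  ((a *: v : 'rV[{mpoly K[n]}]_c) 0 i)@_m = a * ((v : 'rV[{mpoly K[n]}]_c) 0 i)@_m.
Proof. by rewrite krowZE mxE mcoeffCM. Qed.

Lemma krow_sum_coef r (a : 'I_r -> K) (v : 'I_r -> krow K n c) i m :
  ((\sum_k a k *: v k : 'rV[{mpoly K[n]}]_c) 0 i)@_m =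
  \sum_k a k * ((v k : 'rV[{mpoly K[n]}]_c) 0 i)@_m.
Proof.
rewrite summxE (raddf_sum (mcoeff m)); apply: eq_bigr => k _; exact: krowZ_coef.
Qed.

End KRow.

Lemma mdeg_mnmwiden n (m : 'X_{1..n}) : mdeg (mnmwiden m) = mdeg m.
Proof.
rewrite !mdegE big_ord_recr /= mnmwiden_ordmax addn0.
by apply: eq_bigr => i _; rewrite mnmwiden_widen.
Qed.

Lemma kill_last_coef (T : idomainType) n (p : {mpoly T[n.+1]}) m :
  (kill_last p)@_m = p@_(mnmwiden m).
Proof.
have [_ ker _ _] := kill_last_quotient T n.
have [q Hq] : exists q, p - mwiden (kill_last p) = 'X_ord_max * q.
  by apply: ker; rewrite rmorphB /= kill_lastK subrr.
have -> : p = mwiden (kill_last p) + 'X_ord_max * q by rewrite -Hq addrC subrK.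
rewrite rmorphD rmorphM /= kill_lastK kill_last_max mul0r addr0 mcoeffD.
rewrite mwiden_mnmwiden mulrC [X in _ + X](_ : _ = 0) ?addr0 //.
apply: memN_msupp_eq0; rewrite (perm_mem (msuppMX _ _)); apply/negP.
case/mapP => m' _ /(congr1 (fun m : 'X_{1..n.+1} => m ord_max)).
by rewrite mnmwiden_ordmax mnmDE mnm1E eqxx add1n.
Qed.

Section GradedImage.

Variable K : fieldType.

Definition gr_im n c' c (dg : 'I_c -> nat) (D : 'M[{mpoly K[n]}]_(c', c))
    (d : nat) (v : krow K n c) : Prop :=
  gr_row dg d v /\ exists w : 'rV_c', v = w *m D.

Lemma gr_row_subspace n c (dg : 'I_c -> nat) d :
  subspace (fun v : krow K n c => gr_row dg d v).
Proof.
split; first by move=> k m; rewrite mxE mcoeff0 eqxx.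
move=> a u v gu gv k m; rewrite mxE mcoeffD krowZ_coef => ne.
have [u0|/gu //] := eqVneq ((u : 'rV_c) 0 k)@_m 0.
by apply: gv; move: ne; rewrite u0 mulr0 add0r.
Qed.

Lemma gr_im_subspace n c' c (dg : 'I_c -> nat) (D : 'M[{mpoly K[n]}]_(c', c)) d :
  subspace (gr_im dg D d).
Proof.
have [g0 gl] := @gr_row_subspace n c dg d.
split; first by split=> //; exists 0; rewrite mul0mx.
move=> a u v [gu [x Hx]] [gv [y Hy]]; split; first exact: gl.
by exists (a%:MP *: x + y); rewrite krowZE Hx Hy mulmxDl scalemxAl.
Qed.

Lemma gr_row_dim n c (dg : 'I_c -> nat) d (W : krow K n c -> Prop) :
  subspace W -> (forall v, W v -> gr_row dg d v) -> exists r, has_dim W r.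
Proof.
move=> sW Wg; pose B := ('I_c * 'X_{1..n < d.+1})%type.
pose e (j : 'I_#|{: B}|) : B := enum_val j.
pose g (j : 'I_#|{: B}|) : krow K n c :=
  \row_k (if k == (e j).1 then 'X_[(e j).2] else 0).
apply: (dim_exists (g := g) sW) => v /Wg gv.
exists (fun j => ((v : 'rV_c) 0 (e j).1)@_(e j).2).
apply/rowP => k; apply/mpolyP => m; rewrite krow_sum_coef.
under eq_bigr => j _ do rewrite mxE.
rewrite (reindex (@enum_rank {: B})) /=; last first.
  by apply: onW_bij; exact: enum_rank_bij.
under eq_bigr => j _ do rewrite /e enum_rankK.
have [v0|/gv Hd] := eqVneq ((v : 'rV_c) 0 k)@_m 0.
  rewrite v0 big1 // => -[k' m'] _ /=; case: (k =P k') => [<-|_].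
    by rewrite mcoeffX; case: eqP => [->|_]; rewrite ?v0 ?mul0r ?mulr0.
  by rewrite mcoeff0 mulr0.
have lt_m : (mdeg m < d.+1)%N by rewrite ltnS -Hd leq_addr.
rewrite (bigD1 (k, BMultinom lt_m)) //= eqxx mcoeffX eqxx mulr1.
rewrite big1 ?addr0 // => -[k' m'] /= ne; case: (k =P k') => [E|_]; last first.
  by rewrite mcoeff0 mulr0.
rewrite mcoeffX; case: eqP => [Em|_]; last by rewrite mulr0.
by case/eqP: ne; congr (_, _); [rewrite E|apply: val_inj].
Qed.

Lemma gr_im_dim n c' c (dg : 'I_c -> nat) (D : 'M[{mpoly K[n]}]_(c', c)) d :
  exists r, has_dim (gr_im dg D d) r.
Proof. by apply: (gr_row_dim (dg := dg) (d := d) (gr_im_subspace _ _ _)) => v []. Qed.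

Lemma gr_imP n c' c (dg' : 'I_c' -> nat) (dg : 'I_c -> nat)
    (D : 'M[{mpoly K[n]}]_(c', c)) d (v : krow K n c) :
  gr_mx dg' dg D ->
  gr_im dg D d v <-> exists2 w : 'rV_c', gr_row dg' d w & v = w *m D.
Proof.
move=> gD; split=> [[gv [w Hw]]|[w gw ->]].
  exists (pr_row dg' d w); first exact: gr_pr_row.
  by rewrite -(pr_row_mul _ _ gD) -Hw pr_row_id.
by split; [exact: gr_row_mul gw|exists w].
Qed.

Lemma gr_mx_kill n c' c (dg' : 'I_c' -> nat) (dg : 'I_c -> nat)
    (D : 'M[{mpoly K[n.+1]}]_(c', c)) :
  gr_mx dg' dg D -> gr_mx dg' dg (map_mx (@kill_last K n) D).
Proof.
move=> gD k l m; rewrite !mxE kill_last_coef -mdeg_mnmwiden => ne.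
by apply: (gD k l); rewrite mxE.
Qed.

Lemma gr_row_kill n c (dg : 'I_c -> nat) d (v : 'rV[{mpoly K[n.+1]}]_c) :
  gr_row dg d v -> gr_row dg d (map_mx (@kill_last K n) v).
Proof.
move=> gv k m; rewrite !mxE kill_last_coef -mdeg_mnmwiden; exact: gv.
Qed.

Lemma pr_row_kill n c (dg : 'I_c -> nat) d (v : 'rV[{mpoly K[n.+1]}]_c) :
  map_mx (@kill_last K n) (pr_row dg d v) = pr_row dg d (map_mx (@kill_last K n) v).
Proof.
apply/rowP => k; apply/mpolyP => m; rewrite mxE kill_last_coef !coef_pr_row.
by rewrite mdeg_mnmwiden mxE kill_last_coef.
Qed.

(** On Hilbert series, the multiplication by 1 - t. *)
Definition delta (f : nat -> int) (d : nat) : int :=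
  f d - (if d is e.+1 then f e else 0).

(** Multiplication by the last variable identifies the degree d - 1 part of the
    image with the kernel of its reduction in degree d, because the cokernel is
    torsion free. *)
Lemma gr_im_kill n c' c (dg' : 'I_c' -> nat) (dg : 'I_c -> nat)
    (D : 'M[{mpoly K[n.+1]}]_(c', c)) (z z' : nat -> nat) :
  gr_mx dg' dg D -> torsion_free 'X_ord_max D ->
  (forall d, has_dim (gr_im dg D d) (z d)) ->
  (forall d, has_dim (gr_im dg (map_mx (@kill_last K n) D) d) (z' d)) ->
  forall d, delta (fun d => (z d)%:Z) d = (z' d)%:Z.
Proof.
move=> gD tf Hz Hz' d; have quo := kill_last_quotient K n.
have killlin (a : K) (u v : krow K n.+1 c) :
    (map_mx (@kill_last K n) (a *: u + v) : krow K n c) =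
    a *: (map_mx (@kill_last K n) u : krow K n c) + map_mx (@kill_last K n) v.
  by rewrite map_mxD !krowZE map_mxZ /= kill_lastC.
pose mulX (v : krow K n.+1 c) : krow K n.+1 c := 'X_ord_max *: (v : 'rV_c).
have mullin (a : K) (u v : krow K n.+1 c) :
    mulX (a *: u + v) = a *: mulX u + mulX v.
  by rewrite /mulX scalerDr !krowZE !scalerA mulrC.
have Hker : has_dim (fun v : krow K n.+1 c => gr_im dg D d v /\
    (map_mx (@kill_last K n) v : krow K n c) = 0) (if d is e.+1 then z e else 0%N).
  have kerX v : gr_im dg D d v -> map_mx (@kill_last K n) v = 0 ->
      exists u, [/\ v = 'X_ord_max *: (u : 'rV_c), exists w : 'rV_c', u = w *m D &
        forall k m, (u 0 k)@_m != 0 -> (mdeg m + dg k).+1 = d].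
    move=> [gv [w Hw]] /(quot_rV_ker quo) [u Hu].
    exists u; split=> //; first by apply: tf; exists w; rewrite -Hw -Hu.
    move=> k m ne; have := gv k (m + U_(ord_max))%MM; rewrite Hu mxE mulrC addmC.
    by rewrite mcoeffMX mdegD mdeg1 addSn; apply.
  case: d kerX => [|e] kerX.
    exists (fun _ => 0); split=> [i|v [imv kv]|c1 _ i]; try by case: i.
    exists (fun _ => 0); rewrite big_ord0.
    have [u [-> _ Hu]] := kerX _ imv kv; apply/rowP => k; apply/eqP.
    rewrite mxE mxE mulf_eq0; apply/orP; right; apply/eqP/mpolyP => m.
    by rewrite mcoeff0; apply/eqP/contraT => /Hu.
  apply: (dim_inj mullin (Hz e)).
  - move=> v _ Hv; apply: (lreg_rV quo); by rewrite scaler0; exact: Hv.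
  - exact: gr_im_subspace.
  - move=> v [gv [w Hw]]; split; last first.
      by rewrite map_mxZ /= kill_last_max scale0r.
    split; last by exists ('X_ord_max *: w); rewrite /mulX Hw scalemxAl.
    move=> k m; rewrite mxE => ne.
    have : m \in msupp (((v : 'rV_c) 0 k) * 'X_[U_(ord_max)]).
      by rewrite mcoeff_msupp mulrC.
    rewrite (perm_mem (msuppMX _ _)) => /mapP [m' m'_s ->].
    by rewrite mdegD mdeg1 add1n addSn (gv k) // -mcoeff_msupp.
  move=> v [imv kv]; have [u [-> Hw Hu]] := kerX _ imv kv; exists u => //.
  by split=> // k m /Hu [].
have := dim_ext killlin (gr_im_subspace dg D d) Hker (Hz' d) => Hext.
have {Hext} : has_dim (gr_im dg D d) ((if d is e.+1 then z e else 0%N) + z' d).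
  apply: Hext => [v [gv [w Hw]]|v [gv [w Hw]]].
    split; first exact: gr_row_kill.
    by exists (map_mx (@kill_last K n) w); rewrite Hw map_mxM.
  have [w1 Hw1] := quot_rV_surj quo w.
  exists (pr_row dg d (w1 *m D)).
    split; first exact: gr_pr_row.
    by exists (pr_row dg' d w1); rewrite (pr_row_mul _ _ gD).
  by rewrite pr_row_kill map_mxM Hw1 -Hw pr_row_id.
move/(dim_uniq (Hz d)); rewrite /delta => ->; case: (d) => [|e].
  by rewrite add0n subr0.
by rewrite PoszD addrC addKr.
Qed.

(** The variables, from the last to the first, form a regular sequence on the
    cokernel of D. *)
Fixpoint iter_torsion_free n c' c : 'M[{mpoly K[n]}]_(c', c) -> Prop :=
  match n return 'M[{mpoly K[n]}]_(c', c) -> Prop with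
  | 0 => fun _ => True
  | n'.+1 => fun D => torsion_free 'X_ord_max D /\
                      iter_torsion_free (map_mx (@kill_last K n') D)
  end.

Lemma eq_delta f g : f =1 g -> delta f =1 delta g.
Proof. by move=> E d; rewrite /delta E; case: d => // e; rewrite E. Qed.

Lemma eq_iter_delta n f g : f =1 g -> iter n delta f =1 iter n delta g.
Proof. by move=> E; elim: n => //= n IH; apply: eq_delta. Qed.

Lemma hilbert0 c' c (dg' : 'I_c' -> nat) (dg : 'I_c -> nat)
    (D : 'M[{mpoly K[0]}]_(c', c)) d :
  gr_mx dg' dg D ->
  has_dim (gr_im dg D d) (\rank (degp K dg' d *m map_mx (mcoeff 0%MM) D)).
Proof.
move=> gD; set M := degp K dg' d *m _.
have CK (a : nat) (w : 'rV[{mpoly K[0]}]_a) :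
    map_mx (@mpolyC 0 K) (map_mx (mcoeff 0%MM) w) = w.
  by apply/rowP => i; rewrite !mxE /= -nvar0_mpolyC.
have MC : M = map_mx (mcoeff 0%MM) D *m degp K dg d by exact: const_gr.
pose b (i : 'I_(\rank M)) : krow K 0 c := map_mx (@mpolyC 0 K) (row i (row_base M)).
have bsum (x : 'I_(\rank M) -> K) :
    \sum_i x i *: b i = map_mx (@mpolyC 0 K) ((\row_i x i) *m row_base M).
  apply/rowP => k; apply/mpolyP => m; rewrite krow_sum_coef.
  rewrite !mxE (raddf_sum (@mpolyC 0 K)) (raddf_sum (mcoeff m)).
  by apply: eq_bigr => i _; rewrite !mxE /= mpolyCM mcoeffCM.
exists b; split.
- move=> i; have /submxP [y Hy] : (row i (row_base M) <= M)%MS.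
    by rewrite (submx_trans (row_sub _ _)) // eq_row_base.
  split.
    move=> k m; rewrite mxE mcoeffC nvar0_mnmE eqxx mulr1 mdeg0 add0n Hy MC mulmxA.
    rewrite mulmx_degp; case: ifP => [/eqP //|_]; by rewrite eqxx.
  exists (map_mx (@mpolyC 0 K) (y *m degp K dg' d)).
  rewrite /b Hy /M mulmxA map_mxM; congr (_ *m _).
  by apply/matrixP => p q; rewrite !mxE /= -nvar0_mpolyC.
- move=> v [gv [w Hw]].
  have /submxP [y Hy] : (map_mx (mcoeff 0%MM) v <= row_base M)%MS.
    rewrite eq_row_base; apply/submxP; exists (map_mx (mcoeff 0%MM) w).
    rewrite MC mulmxA -map_mxM -Hw; apply/rowP => k; rewrite mulmx_degp mxE /=.
    have [->|/gv] := eqVneq (v 0 k)@_0 0; first by rewrite if_same.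
    by rewrite mdeg0 add0n => ->; rewrite eqxx.
  exists (y 0); rewrite bsum (_ : \row_i y 0 i = y).
    by rewrite -Hy CK.
  by apply/rowP => k; rewrite mxE.
move=> x; rewrite bsum => H i.
have : (\row_i x i) *m row_base M = 0.
  apply/rowP => k; move/rowP/(_ k): H; rewrite [LHS]mxE [RHS]mxE => /eqP.
  by rewrite mpolyC_eq0 => /eqP ->; rewrite mxE.
rewrite -[0](mul0mx 1 (row_base M)) => /(row_free_inj (row_base_free M)).
by move/rowP/(_ i); rewrite !mxE.
Qed.

(** Killing the variables one at a time multiplies the Hilbert series by 1 - t
    each time, and ends with a matrix of constants, whose image is counted by a
    rank. *)
Lemma hilbert_image n c' c (dg' : 'I_c' -> nat) (dg : 'I_c -> nat)
    (D : 'M[{mpoly K[n]}]_(c', c)) (z : nat -> nat) :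
  gr_mx dg' dg D -> iter_torsion_free D ->
  (forall d, has_dim (gr_im dg D d) (z d)) ->
  forall e, iter n delta (fun d => (z d)%:Z) e =
    (\rank (degp K dg' e *m map_mx (mcoeff 0%MM) D))%:Z.
Proof.
elim: n D z => [|n IH] D z gD tf Hz e.
  by rewrite /= (dim_uniq (Hz e) (hilbert0 e gD)).
case: tf => tf1 tf2.
have /choice [z' Hz'] := gr_im_dim dg (map_mx (@kill_last K n) D).
rewrite iterSr (eq_iter_delta n (gr_im_kill gD tf1 Hz Hz')).
rewrite (IH _ _ (gr_mx_kill gD) tf2 Hz'); congr (\rank (_ *m _))%:Z.
by apply/matrixP => i j; rewrite !mxE /= mcoeff0_kill_last.
Qed.

Lemma iter_torsion_free1 n c : iter_torsion_free (1%:M : 'M[{mpoly K[n]}]_c).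
Proof.
elim: n => //= n IH; split; last by rewrite map_mx1.
by move=> w _; exists w; rewrite mulmx1.
Qed.

Lemma iter_torsion_free_exact n c (D : forall p, 'M[{mpoly K[n]}]_(c p.+1, c p)) p0 p :
  is_complex D -> (forall q, p0 <= q -> exact_at D q)%N -> (p0 + n <= p)%N ->
  iter_torsion_free (D p).
Proof.
elim: n D p0 p => //= n IH D p0 p cD ex le_p; have quo := kill_last_quotient K n.
split; last first.
  apply: (IH (map_cpx (@kill_last K n) D) p0.+1 p); last by rewrite addSnnS.
    exact: map_complex.
  case=> // q le_q; apply: (reduce_exact quo); last by apply: ex; apply: leqW.
  by apply: (exact_torsion_free quo) => //; apply: ex.
case: p le_p => [|p] le_p; first by rewrite addnS in le_p.
by apply: (exact_torsion_free quo) => //; apply: ex; lia.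
Qed.

End GradedImage.

(** * Hilbert functions and Betti numbers *)

Definition propb (P : Prop) : bool :=
  if excluded_middle_informative P then true else false.

Lemma propbP (P : Prop) : reflect P (propb P).
Proof.
by rewrite /propb; case: excluded_middle_informative => H; constructor.
Qed.

Definition mono_count (n : nat) (A : 'X_{1..n} -> Prop) (d : nat) : nat :=
  #|[set m : 'X_{1..n < d.+1} | (mdeg m == d) && propb (A m)]|.

Lemma eq_mono_count n (A B : 'X_{1..n} -> Prop) d :
  (forall m, A m <-> B m) -> mono_count A d = mono_count B d.
Proof.
move=> E; rewrite /mono_count; congr #|pred_of_set _|; apply/setP => m.
by rewrite !inE; congr (_ && _); apply/propbP/propbP => /E.
Qed.

Section DeltaLinear.

Lemma deltaD f g d : delta (fun d => f d + g d) d = delta f d + delta g d.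
Proof. by rewrite /delta; case: d => [|d]; rewrite ?subr0 // opprD addrACA. Qed.

Lemma iter_deltaD n f g d :
  iter n delta (fun d => f d + g d) d = iter n delta f d + iter n delta g d.
Proof.
elim: n f g => [|n IH] f g //.
by rewrite !iterSr -IH; apply: eq_iter_delta => e; exact: deltaD.
Qed.

Lemma delta_inj f g : delta f =1 delta g -> f =1 g.
Proof.
move=> E; elim=> [|d IH]; first by have := E 0%N; rewrite /delta !subr0.
by have := E d.+1; rewrite /delta IH => /addIr.
Qed.

End DeltaLinear.

Lemma orth_rank_le (K : fieldType) n a b (P : 'M[K]_n) (A : 'M_(n, a)) (B : 'M_(b, n)) :
  P *m A = A -> B *m P = B -> B *m A = 0 -> (\rank A + \rank B <= \rank P)%N.
Proof.
move=> PA BP BA.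
have rZ : (\rank A + \rank (P :&: kermx A)%MS = \rank P)%N by rewrite -{1}PA mxrank_mul_ker.
rewrite -rZ leq_add2l mxrankS // sub_capmx; apply/andP; split.
  by apply/submxP; exists B.
exact/sub_kermxP.
Qed.

Section HilbertBetti.

Variables (K : fieldType) (n : nat) (F : free_complex K n) (J : {mpoly K[n]} -> Prop).
Hypothesis resF : is_free_resolution F J.

Let gF p := rD_gr p (res_graded resF).

Lemma res_hilbert_step p d a b r :
  has_dim (gr_im (rdg F p.+1) (rD F p.+1) d) a ->
  has_dim (gr_im (rdg F p) (rD F p) d) b ->
  has_dim (gr_im (rdg F p.+1) (1%:M : 'M[{mpoly K[n]}]_(rc F p.+1)) d) r ->
  (a + b = r)%N.
Proof.
move=> Ha Hb Hr; apply: dim_uniq Hr.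
pose phi (v : krow K n (rc F p.+1)) : krow K n (rc F p) := v *m rD F p.
have phi_lin (x : K) u v : phi (x *: u + v) = x *: phi u + phi v.
  by rewrite /phi !krowZE mulmxDl -scalemxAl.
apply: (dim_ext phi_lin _ _ Hb); first exact: gr_im_subspace.
- apply: eq_has_dim Ha => v; split=> [[gv [w Hw]]|[[gv _] Hv]].
    split; last by rewrite /phi Hw -mulmxA (res_complex resF) mulmx0.
    by split=> //; exists v; rewrite mulmx1.
  split=> //; exact: (res_exact resF).
- move=> v [gv _]; split; last by exists v.
  exact: (gr_row_mul (@gF p) gv).
move=> v /(gr_imP _ _ (@gF p)) [w gw ->]; exists w => //.
by split=> //; exists w; rewrite mulmx1.
Qed.

(** The ranks of the differentials cancel in the alternating sum, all but the
    last. *)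
Lemma tor_dim_sum N e :
  \sum_(i < N.+1) (-1) ^+ i * (tor_dim F i e)%:Z =
  \sum_(i < N.+1) (-1) ^+ i * (\rank (degp K (rdg F i.+1) e))%:Z
  + (-1) ^+ N.+1 * (\rank (rE F e N.+1))%:Z.
Proof.
have rk_le i : ((if i is 0 then 0 else \rank (rE F e i)) + \rank (rE F e i.+1)
    <= \rank (degp K (rdg F i.+1) e))%N.
  have BP : rE F e i.+1 *m degp K (rdg F i.+1) e = rE F e i.+1.
    by rewrite /rE -mulmxA -(const_gr e (@gF i.+1)) mulmxA degp_idem.
  case: i BP => [|i] BP.
    by have := @orth_rank_le K _ 0 _ _ 0 _ (mulmx0 _ _) BP (mulmx0 _ _); rewrite mxrank0.
  apply: orth_rank_le => //; first by rewrite /rE mulmxA degp_idem.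
  exact: rE_mul resF _ _.
have tE i : (tor_dim F i e)%:Z = (\rank (degp K (rdg F i.+1) e))%:Z
    - (if i is 0 then 0 else \rank (rE F e i))%:Z - (\rank (rE F e i.+1))%:Z.
  have := rk_le i; rewrite (tor_dimE _ _ (res_graded resF)); lia.
elim: N => [|N IH].
  by rewrite !big_ord_recr !big_ord0 /= tE !add0r !expr0 !mul1r subr0 expr1 mulN1r.
rewrite big_ord_recr IH [in RHS]big_ord_recr /= tE.
set r := (\rank (rE F e N.+1))%:Z; set r' := (\rank _)%:Z; set S := \sum_(i < _) _.
rewrite [(-1) ^+ N.+2]exprS; set s := (-1) ^+ N.+1; ring.
Qed.

(** The short exact sequences 0 -> im D_{p+1} -> F_p -> im D_p -> 0 make the
    alternating sum of the Hilbert functions of the free modules telescope;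
    multiplied by (1 - t)^n, each of these counts the basis vectors. *)
Lemma hilbert_betti (h : nat -> nat) N e :
  (forall d, has_dim (gr_im (rdg F 0) (rD F 0) d) (h d)) ->
  (n <= N)%N -> (0 < N)%N ->
  iter n delta (fun d => (h d)%:Z) e = \sum_(i < N) (-1) ^+ i * (tor_dim F i e)%:Z.
Proof.
move=> Hh le_nN; case: N le_nN => // N le_nN _; rewrite tor_dim_sum.
have /choice [z Hz] : forall p, exists z : nat -> nat,
    forall d, has_dim (gr_im (rdg F p) (rD F p) d) (z d).
  by move=> p; have /choice [z Hz] := gr_im_dim (rdg F p) (rD F p); exists z.
have /choice [b Hb] : forall p, exists b : nat -> nat,
    forall d, has_dim (gr_im (rdg F p) (1%:M : 'M[{mpoly K[n]}]_(rc F p)) d) (b d).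
  move=> p; have /choice [b Hb] := gr_im_dim (rdg F p)
    (1%:M : 'M[{mpoly K[n]}]_(rc F p)).
  by exists b.
(* (1 - t)^n times the Hilbert series of the image of D_p. *)
pose Z p := iter n delta (fun d => (z p d)%:Z) e.
have bE p : iter n delta (fun d => (b p d)%:Z) e = (\rank (degp K (rdg F p) e))%:Z.
  rewrite (hilbert_image (gr_mx1 _) (@iter_torsion_free1 _ _ _) (Hb p)).
  by rewrite map_mx1 mulmx1.
have step p : Z p = (\rank (degp K (rdg F p.+1) e))%:Z - Z p.+1.
  rewrite -bE (@eq_iter_delta _ _ (fun d => (z p.+1 d)%:Z + (z p d)%:Z)).
    by rewrite iter_deltaD -/(Z p) -/(Z p.+1) addrC addKr.
  by move=> d; rewrite -PoszD (res_hilbert_step (Hz p.+1 d) (Hz p d) (Hb p.+1 d)).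
have -> : iter n delta (fun d => (h d)%:Z) e = Z 0%N.
  by apply: eq_iter_delta => d; rewrite (dim_uniq (Hh d) (Hz 0%N d)).
have -> : (\rank (rE F e N.+1))%:Z = Z N.+1.
  have tf : iter_torsion_free (rD F N.+1).
    apply: (iter_torsion_free_exact (p0 := 0)) => //; first exact: (res_complex resF).
    by move=> q _; exact: (res_exact resF).
  by rewrite /Z (hilbert_image (@gF N.+1) tf (Hz N.+1)).
elim: N.+1 => [|M IH]; first by rewrite big_ord0 expr0 mul1r add0r.
by rewrite IH big_ord_recr /= step exprS; set s := (-1) ^+ M; ring.
Qed.

Lemma res_hilbert_monomial (A : 'X_{1..n} -> Prop) d :
  (forall f, J f <-> (forall m, m \in msupp f -> A m)) ->
  has_dim (gr_im (rdg F 0) (rD F 0) d) (mono_count A d).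
Proof.
move=> JA; rewrite /mono_count; set Q := [set m | _].
pose e (i : 'I_#|Q|) : 'X_{1..n < d.+1} := enum_val i.
have eQ i : mdeg (e i) = d /\ A (e i).
  by have := enum_valP i; rewrite inE => /andP [/eqP ? /propbP].
pose b (i : 'I_#|Q|) : krow K n 1 := const_mx 'X_[e i].
have imP (v : krow K n 1) : gr_im (rdg F 0) (rD F 0) d v <->
    forall m, ((v : 'rV_1) 0 0)@_m != 0 -> mdeg m = d /\ A m.
  split=> [[gv [w Hw]] m ne|H].
    split; first by have := gv 0 m ne; rewrite addn0.
    have /JA : J ((v : 'rV_1) 0 0) by apply/(res_im resF); exists w; rewrite Hw.
    by apply; rewrite mcoeff_msupp.
  split; first by move=> k m; rewrite ord1 addn0 => /H [].
  have /(res_im resF) [w Hw] : J ((v : 'rV_1) 0 0).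
    by apply/JA => m; rewrite mcoeff_msupp => /H [].
  by exists w; apply/rowP => i; rewrite ord1.
have sumE (c : 'I_#|Q| -> K) m :
    ((\sum_i c i *: b i : 'rV[{mpoly K[n]}]_1) 0 0)@_m =
    \sum_i c i * (bmnm (e i) == m)%:R.
  by rewrite krow_sum_coef; apply: eq_bigr => i _; rewrite mxE mcoeffX.
have sum_e (c : 'I_#|Q| -> K) i : \sum_k c k * (bmnm (e k) == e i)%:R = c i.
  rewrite (bigD1 i) //= eqxx mulr1 big1 ?addr0 // => k ne.
  case: eqP => [E|]; last by rewrite mulr0.
  by case/eqP: ne; apply: enum_val_inj; apply: val_inj.
exists b; split.
- move=> i; apply/imP => m; rewrite mxE mcoeffX.
  by case: (bmnm (e i) =P m) => [<- _|_]; [exact: eQ|rewrite eqxx].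
- move=> v /imP Hv; exists (fun i => ((v : 'rV_1) 0 0)@_(e i)).
  apply/rowP => k; rewrite ord1; apply/mpolyP => m; rewrite sumE.
  have [v0|/Hv [Hd Am]] := eqVneq ((v : 'rV_1) 0 0)@_m 0.
    rewrite v0 big1 // => i _; case: (bmnm (e i) =P m) => [->|_]; last by rewrite mulr0.
    by rewrite v0 mul0r.
  have lt_m : (mdeg m < d.+1)%N by rewrite Hd.
  have Qm : BMultinom lt_m \in Q by rewrite inE /= Hd eqxx; apply/propbP.
  have Em : m = e (enum_rank_in Qm (BMultinom lt_m)) by rewrite /e enum_rankK_in.
  by rewrite [in RHS]Em sum_e -Em.
move=> c H i; rewrite -(sum_e c i) -sumE H mxE mcoeff0 //.
Qed.

End HilbertBetti.

(** * Linear independence after a generic specialization *)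

(** A complex of finite-dimensional spaces is exact where the ranks of the two
    maps add up to the dimension, here in each degree. *)
Lemma tor_exact (K : fieldType) n (F : free_complex K n) J i :
  is_free_resolution F J -> (forall j, tor_dim F i.+1 j = 0%N) ->
  exact_at (const_cpx (rD F)) i.+1.
Proof.
move=> rF tor0 v Hv; have gF p := const_gr _ (rD_gr p (res_graded rF)).
suff /submxP : (v <= const_cpx (rD F) i.+2)%MS by [].
pose B := (\max_k rdg F i.+2 k).+1.
have -> : v = \sum_(j < B) v *m degp K (rdg F i.+2) j.
  apply/rowP => k; rewrite summxE.
  have lt_k : (rdg F i.+2 k < B)%N by rewrite ltnS; exact: leq_bigmax.
  rewrite (bigD1 (Ordinal lt_k)) //= mulmx_degp eqxx big1 ?addr0 // => j ne.
  by rewrite mulmx_degp; case: eqP => // E; case/eqP: ne; apply: val_inj.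
apply: summx_sub => j _; set P := degp K _ _.
have BP : rE F j i.+2 *m P = rE F j i.+2.
  by rewrite /rE -mulmxA -(gF j i.+2) mulmxA degp_idem.
have PA : P *m rE F j i.+1 = rE F j i.+1 by rewrite /rE mulmxA degp_idem.
have sub : (rE F j i.+2 <= P :&: kermx (rE F j i.+1))%MS.
  rewrite sub_capmx; apply/andP; split; first by apply/submxP; exists (rE F j i.+2).
  apply/sub_kermxP; exact: rE_mul rF _ _.
have rk_eq : (\rank (rE F j i.+1) + \rank (P :&: kermx (rE F j i.+1))%MS = \rank P)%N.
  by rewrite -{1}PA mxrank_mul_ker.
have le_rk : (\rank (P :&: kermx (rE F j i.+1))%MS <= \rank (rE F j i.+2))%N.
  by have := tor0 j; rewrite (tor_dimE _ _ (res_graded rF)) -/P; lia.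
have sub2 : (P :&: kermx (rE F j i.+1) <= rE F j i.+2)%MS.
  by rewrite -(geq_leqif (mxrank_leqif_sup sub)).
apply: (@submx_trans _ _ _ _ _ _ (rE F j i.+2)); last first.
  by apply/submxP; exists (degp K (rdg F i.+3) j).
apply: submx_trans sub2; rewrite sub_capmx; apply/andP; split.
  by apply/submxP; exists v.
apply/sub_kermxP; rewrite -mulmxA PA /rE gF mulmxA.
by rewrite Hv mul0mx.
Qed.

Lemma mcoeff0_subst (K T : idomainType) n m (iota : {rmorphism K -> T})
    (Xi : {rmorphism {mpoly K[n]} -> {mpoly T[m]}}) (G : 'M[T]_(n, m)) :
  (forall a, Xi a%:MP = (iota a)%:MP) ->
  (forall i, Xi 'X_i = \sum_(j < m) G i j *: 'X_j) ->
  forall p, (Xi p)@_0%MM = iota p@_0%MM.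
Proof.
move=> XiC XiX p; elim/mpoly_ring_ind: p => [c|i|p q Hp Hq|p q Hp Hq].
- by rewrite XiC !mcoeffC !eqxx !mulr1.
- rewrite XiX [in RHS]mcoeffX mnm1_eq0 rmorph0 (raddf_sum (mcoeff 0%MM)) big1 //.
  by move=> j _; rewrite /= mcoeffZ mcoeffX mnm1_eq0 mulr0.
- by rewrite rmorphD !mcoeffD Hp Hq rmorphD.
by rewrite rmorphM !(rmorphM (mcoeff 0%MM)) /= Hp Hq rmorphM.
Qed.

Section GenericIndependence.

Variables (K : fieldType) (n r j : nat) (F : free_complex K n).
Variables (J : {mpoly K[n]} -> Prop) (f : 'I_r -> {mpoly K[n]}).
Hypotheses (resF : is_free_resolution F J)
  (J_deg : forall g m, J g -> m \in msupp g -> (j <= mdeg m)%N)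
  (f_in : forall k, J (f k))
  (f_deg : forall k m, m \in msupp (f k) -> mdeg m = j)
  (f_free : forall c : 'I_r -> K, \sum_k c k *: f k = 0 -> forall k, c k = 0).

(** Nakayama's lemma in the lowest degree j: if a combination of lifts of the
    f_k were, modulo the variables, a syzygy, the same combination of the f_k
    would lie in the products of the variables with J, which start above degree
    j. So the constant terms of the lifts stay independent modulo those of the
    syzygies, and X is a retraction. *)
Lemma generators_mod_syzygies (e : 'I_r -> 'rV[{mpoly K[n]}]_(rk F 0)) :
  (forall k, f k = (e k *m rD F 0) 0 0) ->
  exists X : 'M[K]_(rk F 0, r),
    (\matrix_k map_mx (mcoeff 0%MM) (e k)) *m X = 1%:M /\
    const_cpx (rD F) 1 *m X = 0.
Proof.
move=> He; set E := \matrix_k _; set C := cokermx (const_cpx (rD F) 1).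
have fr : row_free (E *m C).
  rewrite -kermx_eq0; apply/eqP/row_matrixP => k; rewrite row0.
  have : row k (kermx (E *m C)) *m (E *m C) = 0 by rewrite -row_mul mulmx_ker row0.
  move: (row k _) => x xEC.
  have /submxP [y Hy] : (x *m E <= const_cpx (rD F) 1)%MS.
    by rewrite submxE -mulmxA xEC.
  suff fx : \sum_k x 0 k *: f k = 0 by apply/rowP => i; rewrite mxE; exact: f_free fx i.
  pose v := (\sum_k (x 0 k)%:MP *: e k) - map_mx (@mpolyC n K) y *m rD F 1.
  have v0 l : (v 0 l)@_0%MM = 0.
    have H : \sum_k x 0 k * E k l = \sum_i y 0 i * const_cpx (rD F) 1 i l.
      by have := congr1 (fun M : 'rV_ _ => M 0 l) Hy; rewrite !mxE.
    have -> : v 0 l = \sum_k ((x 0 k)%:MP *: e k) 0 l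
                      - \sum_i (y 0 i)%:MP * rD F 1 i l.
      rewrite /v mxE summxE; congr (_ + _); rewrite !mxE; congr (- _).
      by apply: eq_bigr => i _; rewrite !mxE.
    rewrite mcoeffB !(raddf_sum (mcoeff 0%MM)).
    apply/eqP; rewrite subr_eq0; apply/eqP; apply: etrans (etrans H _).
      by apply: eq_bigr => i _; rewrite /= !mxE mcoeffCM.
    by apply: eq_bigr => i _; rewrite /= !mxE mcoeffCM.
  have fv : \sum_k x 0 k *: f k = (v *m rD F 0) 0 0.
    rewrite mulmxBl -mulmxA (res_complex resF) mulmx0 subr0 mulmx_suml summxE.
    by apply: eq_bigr => i _; rewrite He -mul_mpolyC -scalemxAl [RHS]mxE.
  apply/mpolyP => m; rewrite mcoeff0.
  have [md|md] := eqVneq (mdeg m) j; last first.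
    rewrite (raddf_sum (mcoeff m)) big1 // => i _ /=; rewrite mcoeffZ.
    rewrite memN_msupp_eq0 ?mulr0 //; by apply: contra md => /f_deg ->.
  rewrite fv mxE (raddf_sum (mcoeff m)) big1 // => l _ /=.
  rewrite mcoeffM big1 // => h /eqP Em.
  have [->|ne] := eqVneq (rD F 0 l 0)@_h.2 0; first by rewrite mulr0.
  have le_j : (j <= mdeg h.2)%N.
    apply: (J_deg (g := rD F 0 l 0)); last by rewrite mcoeff_msupp.
    by apply/(res_im resF); exists (delta_mx 0 l); rewrite -rowE mxE.
  have : (mdeg h.1 == 0)%N.
    have EE := congr1 mdeg Em; rewrite mdegD in EE.
    move: EE md le_j; set a := mdeg m; set b := mdeg h.1; set c := mdeg h.2.
    by clearbody a b c; lia.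
  by rewrite mdeg_eq0 => /eqP ->; rewrite v0 mul0r.
exists (C *m pinvmx (E *m C)); split; first by rewrite mulmxA mulmxVp.
by rewrite mulmxA mulmx_coker mul0mx.
Qed.

(** A relation between the specialized f_k lifts, by the exactness of the
    specialized resolution, to the specialized syzygies. Linear substitutions
    do not change constant terms, so [generators_mod_syzygies] shows that the
    relation is trivial. *)
Lemma generic_independence m :
  (0 < m)%N -> (forall i e, (m <= i)%N -> tor_dim F i e = 0%N) ->
  exists (T : idomainType) (iota : {rmorphism K -> T})
         (Xi : {rmorphism {mpoly K[n]} -> {mpoly T[m]}}) (G : 'M[T]_(n, m)),
    [/\ forall a, Xi a%:MP = (iota a)%:MP,
        forall i, Xi 'X_i = \sum_(j < m) G i j *: 'X_j &
        forall c : 'I_r -> T, \sum_k (c k)%:MP * Xi (f k) = 0 -> forall k, c k = 0].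
Proof.
move=> m_gt0 tor0; have [le_mn|lt_nm] := leqP m n.
  have ex0 q : (m <= q)%N -> exact_at (const_cpx (rD F)) q.
    case: q => [|q] le_q; first by rewrite leqNgt m_gt0 in le_q.
    by apply: (tor_exact resF) => e; apply: tor0.
  have [T [iota [Xi [G [XiC XiX ex]]]]] :=
    generic_section le_mn (res_complex resF) (@res_exact _ _ _ _ resF) ex0.
  exists T, iota, Xi, G; split=> // c Hc.
  have /choice [e He] : forall k, exists e : 'rV_(rk F 0), f k = (e *m rD F 0) 0 0.
    by move=> k; apply/(res_im resF).
  have [X [EX DX]] := generators_mod_syzygies He.
  pose v := \sum_k (c k)%:MP *: map_mx Xi (e k).
  have [w Hw] : exists w, v = w *m map_cpx Xi (rD F) 1.
    apply: ex; apply/rowP => l; rewrite ord1 [RHS]mxE -[RHS]Hc mulmx_suml summxE.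
    by apply: eq_bigr => k _; rewrite -scalemxAl mxE /map_cpx -map_mxM mxE He.
  have cX := mcoeff0_subst XiC XiX.
  have E1 : map_mx (mcoeff 0%MM) v =
      (\row_k c k) *m map_mx iota (\matrix_k map_mx (mcoeff 0%MM) (e k)).
    apply/rowP => l; rewrite !mxE summxE (raddf_sum (mcoeff 0%MM)).
    by apply: eq_bigr => k _; rewrite /= !mxE mcoeffCM cX.
  have E2 : map_mx (mcoeff 0%MM) v =
      map_mx (mcoeff 0%MM) w *m map_mx iota (const_cpx (rD F) 1).
    rewrite Hw map_mxM; congr (_ *m _); apply/matrixP => a b.
    by rewrite !mxE /= cX.
  have : \row_k c k = 0.
    rewrite -[LHS]mulmx1 -(map_mx1 iota) -EX map_mxM mulmxA -E1 E2 -mulmxA.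
    by rewrite -map_mxM DX map_mx0 mulmx0.
  by move/rowP => H k; have := H k; rewrite !mxE.
(* With fewer than m variables, the inclusion of the polynomial rings will do. *)
pose h (i : 'I_n) : {mpoly K[m]} := 'X_(widen_ord (ltnW lt_nm) i).
pose Xi : {rmorphism {mpoly K[n]} -> {mpoly K[m]}} := mmap (@mpolyC m K) h.
pose h' (i : 'I_m) : {mpoly K[n]} := if insub (i : nat) is Some o then 'X_o else 0.
pose Xi' : {rmorphism {mpoly K[m]} -> {mpoly K[n]}} := mmap (@mpolyC n K) h'.
have XiK p : Xi' (Xi p) = p.
  elim/mpoly_ring_ind: p => [a|i|p q Hp Hq|p q Hp Hq].
  - by rewrite /Xi /= mmapC /Xi' /= mmapC.
  - rewrite /Xi /= mmapX mmap1U /h /Xi' /= mmapX mmap1U /h' /=.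
    by rewrite valK.
  - by rewrite !rmorphD Hp Hq.
  by rewrite !rmorphM Hp Hq.
exists K, idfun, Xi, (\matrix_(i, k) ((i : nat) == k)%:R); split.
- by move=> a; rewrite /Xi /= mmapC.
- move=> i; rewrite /Xi /= mmapX mmap1U /h.
  rewrite (bigD1 (widen_ord (ltnW lt_nm) i)) //= mxE eqxx scale1r big1 ?addr0 //.
  move=> k ne; rewrite mxE; case: eqP => [E|]; last by rewrite scale0r.
  by case/eqP: ne; apply: val_inj.
move=> c Hc; apply: f_free; have := congr1 Xi' Hc; rewrite rmorph0; apply: etrans.
rewrite rmorph_sum; apply: eq_bigr => k _; rewrite rmorphM XiK.
by rewrite /Xi' /= mmapC mul_mpolyC.
Qed.

End GenericIndependence.

(** * Exponents and the order on monomials *)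

Section Exponents.

Lemma minfP (u v : Minf) : (forall i, u i = v i) -> u = v.
Proof. by move=> H; apply/eqP/cmP. Qed.

(** A monomial in n variables as a monomial in infinitely many, and conversely
    the truncation to the first n variables. *)
Definition emb (n : nat) (m : 'X_{1..n}) : Minf :=
  cmonom_of_fsfun (cmonom_key) [fsfun k in [fset x | x in iota 0 n]%fset =>
    (if insub k is Some o then m o else 0)%N | 0%N].

Lemma embE n (m : 'X_{1..n}) k :
  emb m k = (if insub k is Some o then m o else 0)%N.
Proof.
rewrite cmE fsfun_fun; case: ifP => // /negP; rewrite inE /= mem_iota add0n /=.
by case: insubP => // o lt_k _ [].
Qed.

Lemma emb_ord n (m : 'X_{1..n}) (i : 'I_n) : emb m i = m i.
Proof. by rewrite embE valK. Qed.

Lemma emb_ge n (m : 'X_{1..n}) k : (n <= k)%N -> emb m k = 0%N.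
Proof. by move=> le; rewrite embE insubN // -leqNgt. Qed.

Definition proj (n : nat) (u : Minf) : 'X_{1..n} := [multinom u (i : nat) | i < n].

Lemma projE n (u : Minf) (i : 'I_n) : proj n u i = u i.
Proof. by rewrite mnmE. Qed.

Lemma proj_emb n (m : 'X_{1..n}) : proj n (emb m) = m.
Proof. by apply/mnmP => i; rewrite projE emb_ord. Qed.

Lemma emb_projE n (u : Minf) k : emb (proj n u) k = if (k < n)%N then u k else 0%N.
Proof.
case: ltnP => [lt_k|/emb_ge //].
by have := emb_ord (proj n u) (Ordinal lt_k); rewrite projE.
Qed.

Lemma emb_proj n (u : Minf) : (forall k, (n <= k)%N -> u k = 0%N) -> emb (proj n u) = u.
Proof.
by move=> H; apply: minfP => k; rewrite emb_projE; case: ltnP => // /H.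
Qed.

Lemma emb_inj n : injective (@emb n).
Proof. exact: can_inj (@proj_emb n). Qed.

Lemma mmulE (u v : Minf) i : mmul u v i = (u i + v i)%N.
Proof. exact: cmM. Qed.

Lemma embD n (m1 m2 : 'X_{1..n}) : emb (m1 + m2)%MM = mmul (emb m1) (emb m2).
Proof.
apply: minfP => k; rewrite mmulE; have [lt_k|le_k] := ltnP k n.
  by rewrite -[k]/(nat_of_ord (Ordinal lt_k)) !emb_ord mnmDE.
by rewrite !emb_ge.
Qed.

Lemma mdividesP (v u : Minf) : mdivides v u <-> forall i, (v i <= u i)%N.
Proof.
split=> [[w ->] i|H]; first by rewrite mmulE leq_addr.
by exists (divcm u v); apply: minfP => i; rewrite mmulE divcmE subnKC.
Qed.

Lemma mdivides_refl u : mdivides u u.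
Proof. by apply/mdividesP. Qed.

Lemma mdivides_trans u v w : mdivides u v -> mdivides v w -> mdivides u w.
Proof.
by move=> /mdividesP H1 /mdividesP H2; apply/mdividesP => i; exact: leq_trans (H1 i) (H2 i).
Qed.

Lemma mdivides_trunc n u : mdivides (emb (proj n u)) u.
Proof. by apply/mdividesP => i; rewrite emb_projE; case: ltnP. Qed.

Lemma max_var_leP (u : Minf) n :
  (max_var u <= n)%N <-> forall k, (n <= k)%N -> u k = 0%N.
Proof.
split=> [le k le_k|H].
  case: (mdomP u k) => // k_u; move: le; rewrite leqNgt.
  suff : (k < max_var u)%N by move=> lt1 /negP []; exact: leq_ltn_trans le_k lt1.
  by rewrite /max_var (big_fsetD1 k) //= leq_max leqnn.
rewrite /max_var big_seq; elim/big_ind: _ => // [x y|k k_u]; first by rewrite geq_max => -> ->.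
rewrite ltnNge; apply/negP => /H uk; move: k_u; by rewrite -cmE_neq0 uk.
Qed.

Lemma emb_proj_max u n : (max_var u <= n)%N -> emb (proj n u) = u.
Proof. by move=> /max_var_leP; exact: emb_proj. Qed.

Lemma max_var_emb n (m : 'X_{1..n}) : (max_var (emb m) <= n)%N.
Proof. by apply/max_var_leP => k; exact: emb_ge. Qed.

(** Partial sums of exponents describe the order: in equal degrees, u precedes v
    when each partial sum of u is at least that of v. *)
Definition psum (k : nat) (u : Minf) : nat := \sum_(i < k) u i.

Lemma psumS k u : psum k.+1 u = (psum k u + u k)%N.
Proof. by rewrite /psum big_ord_recr. Qed.

Lemma psum_mono k l u : (k <= l)%N -> (psum k u <= psum l u)%N.
Proof.
elim: l => [|l IH]; first by rewrite leqn0 => /eqP ->.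
rewrite leq_eqVlt => /orP [/eqP -> //|]; rewrite ltnS => /IH le.
by rewrite psumS (leq_trans le) // leq_addr.
Qed.

Lemma psum_div k u v : mdivides u v -> (psum k u <= psum k v)%N.
Proof. by move/mdividesP => H; apply: leq_sum => i _. Qed.

Lemma psumM k u v : psum k (mmul u v) = (psum k u + psum k v)%N.
Proof. by rewrite /psum -big_split; apply: eq_bigr => i _; rewrite mmulE. Qed.

Lemma psum_ge n k u : (max_var u <= n)%N -> (n <= k)%N -> psum k u = psum n u.
Proof.
move=> /max_var_leP H; elim: k => [|k IH]; first by rewrite leqn0 => /eqP ->.
rewrite leq_eqVlt => /orP [/eqP -> //|]; rewrite ltnS => le.
by rewrite psumS IH // H // addn0.
Qed.

Lemma psum_emb n (m : 'X_{1..n}) k : (n <= k)%N -> psum k (emb m) = mdeg m.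
Proof.
move=> le; rewrite (psum_ge (max_var_emb m) le) mdegE /psum.
by apply: eq_bigr => i _; rewrite emb_ord.
Qed.

(** The product of the first d variables of w, in increasing order, those of
    index beyond n left out. *)
Lemma psum_trunc_deg n (d : nat) w : exists v, [/\ mdivides v w, (max_var v <= n)%N &
  forall k, (k <= n)%N -> psum k v = minn (psum k w) d].
Proof.
pose f k := (minn (psum k.+1 w) d - minn (psum k w) d)%N.
exists (emb [multinom f i | i < n]).
have fE k : (k < n)%N -> emb [multinom f i | i < n] k = f k.
  by move=> lt; rewrite -[k in LHS]/(nat_of_ord (Ordinal lt)) emb_ord mnmE.
split; last 1 first.
- elim=> [|k IH] lt_k; first by rewrite /psum !big_ord0 min0n.
  rewrite psumS IH ?(ltnW lt_k) // fE // /f psumS; lia.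
- apply/mdividesP => k; have [lt|le] := ltnP k n; last by rewrite emb_ge.
  rewrite fE // /f psumS; lia.
exact: max_var_emb.
Qed.

End Exponents.

Section VarSeq.

Lemma count_var_seq n (m : 'X_{1..n}) k :
  count (fun i => i < k)%N (var_seq m) = psum k (emb m).
Proof.
rewrite /var_seq count_flatten -map_comp sumnE big_map big_enum /=.
rewrite (eq_bigr (fun i : 'I_n => (m i * (i < k))%N)); last first.
  by move=> i _; rewrite count_nseq mulnC.
rewrite (eq_bigr (fun i : 'I_n => if (i < k)%N then emb m i else 0%N)); last first.
  by move=> i _; rewrite emb_ord; case: ifP; rewrite ?muln1 ?muln0.
rewrite (big_ord_widen _ (fun i => if (i < k)%N then emb m i else 0%N) (leq_addr k n)).
rewrite /psum (big_ord_widen _ (fun i => emb m i) (leq_addl n k)).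
rewrite big_mkcond [RHS]big_mkcond; apply: eq_bigr => i _.
by case: ltnP => // /emb_ge ->; rewrite if_same.
Qed.

Lemma size_var_seq n (m : 'X_{1..n}) : size (var_seq m) = mdeg m.
Proof.
rewrite /var_seq size_flatten /shape -map_comp sumnE big_map big_enum /= mdegE.
by apply: eq_bigr => i _; rewrite size_nseq.
Qed.

Lemma all2_leq_count (s t : seq nat) k :
  all2 leq s t -> (count (fun i => i < k) t <= count (fun i => i < k) s)%N.
Proof.
elim: s t => [|a s IH] [|b t] //= /andP [le_ab /IH le]; apply: leq_add => //.
by case: (ltnP b k) => // lt; rewrite (leq_ltn_trans le_ab lt).
Qed.

Lemma count_all2_leq (s t : seq nat) :
  pairwise leq s -> pairwise leq t -> size s = size t ->
  (forall k, count (fun i => i < k) t <= count (fun i => i < k) s)%N ->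
  all2 leq s t.
Proof.
have count0 (a k : nat) (s' : seq nat) : all (leq a) s' -> (k <= a)%N ->
    count (fun i => i < k)%N s' = 0%N.
  move=> /allP H le; apply/eqP; rewrite -leqn0 leqNgt -has_count; apply/hasP.
  by case=> x /H le_ax; rewrite ltnNge (leq_trans le le_ax).
elim: s t => [|a s IH] [|b t] //= /andP [as_ ps] /andP [bt pt] [sz] H.
have le_ab : (a <= b)%N.
  rewrite leqNgt; apply/negP => lt_ba; have := H b.+1.
  rewrite (count0 _ _ _ as_ lt_ba) addn0 ltnS leqnn [(a < b.+1)%N]ltnS.
  by rewrite [(a <= b)%N]leqNgt lt_ba.
rewrite le_ab; apply: IH => // k; have := H k.
case: (ltnP b k) => [lt_bk|le_kb]; first by rewrite (leq_ltn_trans le_ab lt_bk) leq_add2l.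
by rewrite (count0 _ _ _ bt).
Qed.

Lemma pairwise_var_seq n (m : 'X_{1..n}) : pairwise leq (var_seq m).
Proof.
pose f k := nseq (emb m k) k.
have -> : var_seq m = flatten [seq f k | k <- iota 0 n].
  rewrite /var_seq -val_enum_ord -[in RHS]map_comp; congr flatten.
  by apply: eq_map => i; rewrite /f /= emb_ord.
have : exists g : nat -> nat, f = fun k => nseq (g k) k by exists (emb m).
case=> g ->; clear; pose f' k := nseq (g k) k; rewrite -[fun k => _]/f'.
have ge a l : all (leq a) (flatten [seq f' k | k <- iota a l]).
  apply/allP => x /flattenP [y /mapP [k]]; rewrite mem_iota => /andP [le _] ->.
  by rewrite mem_nseq => /andP [_ /eqP ->].
elim: n 0%N => [|n IH] a //=.
rewrite pairwise_cat IH andbT; apply/andP; split.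
  apply/allrelP => x y; rewrite mem_nseq => /andP [_ /eqP ->] /(allP (ge a.+1 n)).
  exact: ltnW.
by rewrite /f'; elim: (g a) => //= l ->; rewrite andbT all_nseq leqnn orbT.
Qed.

Lemma preceq_psum n (u v : 'X_{1..n}) k :
  preceq u v -> (psum k (emb v) <= psum k (emb u))%N.
Proof. by rewrite -!count_var_seq; exact: all2_leq_count. Qed.

(** For weakly increasing sequences of equal length, the entrywise comparison
    amounts to the comparison of the numbers of entries below each k. *)
Lemma psum_preceq n (u v : 'X_{1..n}) :
  mdeg u = mdeg v -> (forall k, psum k (emb v) <= psum k (emb u))%N -> preceq u v.
Proof.
move=> md H; apply: count_all2_leq; try exact: pairwise_var_seq.
  by rewrite !size_var_seq.
by move=> k; rewrite !count_var_seq.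
Qed.

End VarSeq.

(** * Monomial ideals in infinitely many variables *)

Section MonomialIdeals.

Variable K : fieldType.

Lemma ideal_gen_mem (R : comNzRingType) (A : R -> Prop) x : A x -> ideal_gen A x.
Proof.
move=> Ax; exists [:: (1, x)]; split; last by rewrite big_seq1 mul1r.
by move=> c; rewrite inE => /eqP ->.
Qed.

Lemma ideal_genD (R : comNzRingType) (A : R -> Prop) x y :
  ideal_gen A x -> ideal_gen A y -> ideal_gen A (x + y).
Proof.
move=> [s [Hs ->]] [t [Ht ->]]; exists (s ++ t); split; last by rewrite big_cat.
by move=> c; rewrite mem_cat => /orP [/Hs|/Ht].
Qed.

Lemma ideal_genM (R : comNzRingType) (A : R -> Prop) x y :
  ideal_gen A x -> ideal_gen A (y * x).
Proof.
move=> [s [Hs ->]]; exists [seq (y * c.1, c.2) | c <- s]; split.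
  by move=> c /mapP [d /Hs ? ->].
by rewrite mulr_sumr big_map; apply: eq_bigr => c _; rewrite mulrA.
Qed.

Lemma ideal_gen0 (R : comNzRingType) (A : R -> Prop) : ideal_gen A 0.
Proof. by exists [::]; split=> //; rewrite big_nil. Qed.

Lemma ideal_gen_sum (R : comNzRingType) (A : R -> Prop) (I : eqType) (s : seq I)
    (F : I -> R) :
  (forall i, i \in s -> ideal_gen A (F i)) -> ideal_gen A (\sum_(i <- s) F i).
Proof.
elim: s => [|i s IH] H; first by rewrite big_nil; exact: ideal_gen0.
rewrite big_cons; apply: ideal_genD; first by apply: H; rewrite inE eqxx.
by apply: IH => k k_s; apply: H; rewrite inE k_s orbT.
Qed.

Lemma monom_infM (u v : Minf) :
  monom_inf K (mmul u v) = monom_inf K u * monom_inf K v.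
Proof. by rewrite /monom_inf [RHS]fgmulUU mul1r. Qed.

Lemma monom_inf1 : monom_inf K (mone : cmonom nat) = 1.
Proof. by []. Qed.

Lemma msupp_monom u : monalg.msupp (monom_inf K u) = [fset u]%fset.
Proof. by rewrite /monom_inf msuppU oner_eq0. Qed.

Lemma monalg_decomp (f : Rinf K) :
  f = \sum_(u <- monalg.msupp f) mkmalgU (mone : cmonom nat) (monalg.mcoeff u f) * monom_inf K u.
Proof.
rewrite {1}(monalgE f); apply: eq_bigr => u _.
by rewrite /monom_inf [RHS]fgmulUU mulr1 mul1m.
Qed.

(** A monomial ideal is studied through the set of its monomials, which is
    closed under multiplication. *)
Definition up (I : Rinf K -> Prop) (u : Minf) : Prop := I (monom_inf K u).

Definition monomial_set (I : Rinf K -> Prop) : Prop :=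
  forall f, I f <-> (forall u, u \in monalg.msupp f -> up I u).

Lemma gen_monomialP (S : Minf -> Prop) (f : Rinf K) :
  ideal_gen (fun g => exists2 u, S u & g = monom_inf K u) f <->
  (forall u, u \in monalg.msupp f -> exists2 v, S v & mdivides v u).
Proof.
split=> [[s [Hs ->]] u|H].
  elim: s Hs => [|c s IH] Hs; first by rewrite big_nil monalg.msupp0 in_fset0.
  rewrite big_cons => /(fsubsetP (monalg.msuppD_le _ _)); rewrite in_fsetU => /orP [].
    have [v Sv ->] := Hs c (mem_head _ _).
    case/monalg.msuppM_le => k1 [k2 [_]]; rewrite msupp_monom in_fset1 => /eqP -> ->.
    by exists v => //; exists k1; rewrite mulmC.
  by apply: IH => d d_s; apply: Hs; rewrite inE d_s orbT.
rewrite (monalg_decomp f); apply: ideal_gen_sum => u /H [v Sv [w ->]].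
rewrite mulmC monom_infM mulrA; apply: ideal_genM; apply: ideal_gen_mem.
by exists v.
Qed.

Lemma gen_up (S : Minf -> Prop) u :
  up (ideal_gen (fun g => exists2 u, S u & g = monom_inf K u)) u <->
  exists2 v, S v & mdivides v u.
Proof.
rewrite /up gen_monomialP msupp_monom; split=> [|H v]; first by apply; rewrite in_fset1.
by rewrite in_fset1 => /eqP ->.
Qed.

Lemma gen_monomial_set (I : Rinf K -> Prop) (S : Minf -> Prop) :
  (forall f, I f <-> ideal_gen (fun g => exists2 u, S u & g = monom_inf K u) f) ->
  monomial_set I /\ forall u, up I u <-> exists2 v, S v & mdivides v u.
Proof.
move=> IS; have upI u : up I u <-> exists2 v, S v & mdivides v u.
  by rewrite /up IS -gen_up.
split=> // f; rewrite IS gen_monomialP.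
by split=> H u /H; rewrite upI.
Qed.

Definition upset (A : Minf -> Prop) : Prop :=
  forall u v, A u -> mdivides u v -> A v.

Lemma gen_upset (S : Minf -> Prop) (A : Minf -> Prop) :
  (forall u, A u <-> exists2 v, S v & mdivides v u) -> upset A.
Proof.
move=> H u v /H [w Sw wu] uv; apply/H; exists w => //; exact: mdivides_trans uv.
Qed.

Section FinitelyGenerated.

Variable I : Rinf K -> Prop.
Hypothesis fgI : fg_monomial_ideal I.

Lemma fg_monomial_set : monomial_set I.
Proof. by have [s Hs] := fgI; have [] := gen_monomial_set Hs. Qed.

Lemma fg_upset : upset (up I).
Proof. by have [s Hs] := fgI; have [_ H] := gen_monomial_set Hs; exact: gen_upset H. Qed.

Lemma min_gen_div u : up I u -> exists2 v, min_gen I v & mdivides v u.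
Proof.
pose n := max_var u; have [d] : exists d, (psum n u < d)%N by exists (psum n u).+1.
have : (max_var u <= n)%N by [].
elim: d u n => // d IH u n le_n; rewrite ltnS => le_d Iu.
case: (classic (forall v, mdivides v u -> up I v -> v = u)) => [H|H].
  by exists u => //; exact: mdivides_refl.
have [v [vu Iv ne]] : exists v, [/\ mdivides v u, up I v & v <> u].
  apply: NNPP => H'; apply: H => v vu Iv; apply: NNPP => ne; apply: H'; by exists v.
have le_v : (max_var v <= n)%N.
  apply/max_var_leP => k le_k; have uk := proj1 (max_var_leP u n) le_n k le_k.
  by move/mdividesP: vu => /(_ k); rewrite uk leqn0 => /eqP.
have lt_v : (psum n v < psum n u)%N.
  rewrite ltn_neqAle psum_div // andbT; apply/eqP => E; case: ne.
  have [w Hw] := vu; apply: minfP => k; rewrite Hw mmulE.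
  move: E; rewrite Hw psumM => /esym /eqP; rewrite -[X in _ == X]addn0 eqn_add2l => w0.
  have [lt_k|le_k] := ltnP k n; last first.
    have := proj1 (max_var_leP u n) le_n k le_k; rewrite Hw mmulE; lia.
  move: w0; rewrite /psum sum_nat_eq0 => /forallP /(_ (Ordinal lt_k)) /= /eqP ->.
  by rewrite addn0.
have [g mg gv] := IH v n le_v (leq_trans lt_v le_d) Iv.
by exists g => //; exact: mdivides_trans vu.
Qed.

Lemma min_gen_bounded : exists B, forall u, min_gen I u -> (max_var u <= B)%N.
Proof.
have [s Hs] := fgI; have [_ upI] := gen_monomial_set Hs.
exists (\max_(u <- s) max_var u) => u [Iu Hu].
have [v v_s vu] := proj1 (upI u) Iu.
have <- : v = u.
  apply: (Hu v vu); apply: (proj2 (upI v)); exists v; first exact: v_s.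
  exact: mdivides_refl.
by rewrite (big_rem v) //= leq_max leqnn.
Qed.

Lemma max_var_idealP : is_max_var_ideal I (max_var_ideal I).
Proof.
apply: (epsilon_spec (inhabits 0%N) (is_max_var_ideal I)).
have [B HB] := min_gen_bounded.
pose P n := propb (forall u, min_gen I u -> (max_var u <= n)%N).
have exP : exists n, P n by exists B; apply/propbP.
exists (ex_minn exP); case: ex_minnP => n Pn min; have /propbP Hn := Pn; split=> // n' Hn'.
by apply: min; apply/propbP.
Qed.

(** Variables of index beyond n do not matter for membership: the ideal is
    generated in the first n variables. *)
Definition truncated (n : nat) (A : Minf -> Prop) : Prop :=
  forall u, A u -> A (emb (proj n u)).

Lemma fg_truncated n : (max_var_ideal I <= n)%N -> truncated n (up I).
Proof.
move=> le_n u /min_gen_div [v mv vu]; have [H _] := max_var_idealP.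
apply: (fg_upset (u := v)); first by case: mv.
apply/mdividesP => k; rewrite emb_projE; case: ltnP => [_|le_k].
  by move/mdividesP: vu.
by have -> : v k = 0%N by apply: (proj1 (max_var_leP v n)); rewrite ?(leq_trans (H v mv)).
Qed.

End FinitelyGenerated.

Lemma incl_mmap1 n (m : 'X_{1..n}) :
  mmap1 (fun i : 'I_n => monom_inf K (ucm (i : nat))) m = monom_inf K (emb m).
Proof.
rewrite /mmap1.
suff [w -> Hw] : exists2 w : Minf, \prod_(i < n) monom_inf K (ucm (i : nat)) ^+ m i
    = monom_inf K w & forall k, w k = (\sum_(i < n) (i == k :> nat) * m i)%N.
  congr (monom_inf K _); apply: minfP => k; rewrite Hw embE.
  case: insubP => [o _ <-|ge_k].
    rewrite (bigD1 o) //= eqxx mul1n big1 ?addn0 // => i /negPf ne.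
    by rewrite (inj_eq val_inj) ne.
  rewrite big1 // => i _; case: eqP => // E; by rewrite -E ltn_ord in ge_k.
elim: (index_enum _) => [|i s [w Ew Hw]].
  rewrite big_nil; exists mone; first by rewrite monom_inf1.
  by move=> k; rewrite big_nil cm1.
have [v Ev Hv] : exists2 v : Minf, monom_inf K (ucm (i : nat)) ^+ m i = monom_inf K v
    & forall k, v k = ((i == k :> nat) * m i)%N.
  elim: (m i) => [|l [v Ev Hv]].
    exists (mone : cmonom nat).
      by rewrite expr0; exact: esym monom_inf1.
    by move=> k; rewrite cm1 muln0.
  exists (mmul (ucm (i : nat)) v); first by rewrite exprS Ev monom_infM.
  by move=> k; rewrite mmulE Hv ucmE mulnS.
exists (mmul v w).
  rewrite big_cons (monom_infM v w); congr (_ * _); [exact: Ev|exact: Ew].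
by move=> k; rewrite big_cons mmulE Hv Hw.
Qed.

Lemma coef_incl n (p : {mpoly K[n]}) u :
  monalg.mcoeff u (incl p) = if propb (u = emb (proj n u)) then p@_(proj n u) else 0.
Proof.
rewrite /incl /mmap (raddf_sum (monalg.mcoeff u)) /=.
under eq_bigr => m _ do rewrite incl_mmap1 /monom_inf [X in monalg.mcoeff _ X]fgmulUU
  mulr1 mul1m monalg.mcoeffU.
case: propbP => [E|ne]; last first.
  rewrite big1 // => m _; case: eqP => // E; case: ne.
  by rewrite -E proj_emb.
have [m_p|m_p] := boolP (proj n u \in msupp p).
  rewrite (bigD1_seq (proj n u)) ?msupp_uniq //= -E eqxx mulr1n big1 ?addr0 //.
  move=> m ne; case: eqP => // E'; case/eqP: ne; by rewrite -E' proj_emb.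
rewrite memN_msupp_eq0 // big_seq big1 // => m m_s; case: eqP => // E'.
by rewrite -E' proj_emb m_s in m_p.
Qed.

Lemma msupp_incl n (p : {mpoly K[n]}) u :
  u \in monalg.msupp (incl p) <-> exists2 m, m \in msupp p & u = emb m.
Proof.
rewrite -monalg.mcoeff_neq0 coef_incl; case: propbP => [E|ne].
  split=> [ne|[m m_p ->]]; last by rewrite proj_emb -mcoeff_msupp.
  by exists (proj n u) => //; rewrite mcoeff_msupp.
rewrite eqxx; split=> // -[m _ E]; case: ne; by rewrite E proj_emb.
Qed.

Lemma incl_X n (m : 'X_{1..n}) : incl ('X_[m] : {mpoly K[n]}) = monom_inf K (emb m).
Proof.
apply/monalg.malgP => u; rewrite coef_incl mcoeffX monalg.mcoeffU.
case: propbP => [E|ne]; last by case: eqP => // E; case: ne; rewrite -E proj_emb.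
case: eqP => [->|ne]; first by rewrite -E eqxx.
by case: eqP => // E'; case: ne; rewrite -E' proj_emb.
Qed.

Lemma restrictP (I : Rinf K -> Prop) n : monomial_set I ->
  forall p : {mpoly K[n]}, restrict I p <-> forall m, m \in msupp p -> up I (emb m).
Proof.
move=> mI p; rewrite /restrict mI; split=> H => [m m_p|u /msupp_incl [m /H ? ->] //].
by apply: H; apply/msupp_incl; exists m.
Qed.

Lemma restrict_X (I : Rinf K -> Prop) n (m : 'X_{1..n}) :
  restrict I ('X_[m] : {mpoly K[n]}) <-> up I (emb m).
Proof. by rewrite /restrict incl_X. Qed.

End MonomialIdeals.

(** * Powers of (x_1, ..., x_m) and principal strongly stable ideals *)

Section Counting.

Definition hcount (A : Minf -> Prop) (n d : nat) : nat :=
  mono_count (fun m : 'X_{1..n} => A (emb m)) d.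

Lemma eq_hcount (A B : Minf -> Prop) n d :
  (forall m : 'X_{1..n}, A (emb m) <-> B (emb m)) -> hcount A n d = hcount B n d.
Proof. exact: eq_mono_count. Qed.

Lemma emb_mnmwiden n (m : 'X_{1..n}) : emb (mnmwiden m) = emb m.
Proof.
apply: minfP => k; have [lt_k|le_k] := ltnP k n.
  rewrite -[k in RHS]/(nat_of_ord (Ordinal lt_k)) emb_ord -mnmwiden_widen.
  by rewrite -[k]/(nat_of_ord (widen_ord (leqnSn n) (Ordinal lt_k))) emb_ord.
rewrite (emb_ge m) //; have [lt_k|le_k'] := ltnP k n.+1; last by rewrite emb_ge.
have -> : k = nat_of_ord (ord_max : 'I_n.+1) by apply/eqP; rewrite /= eqn_leq le_k -ltnS lt_k.
by rewrite emb_ord mnmwiden_ordmax.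
Qed.

Lemma truncated_leq (A : Minf -> Prop) n n' :
  upset A -> truncated n A -> (n <= n')%N -> truncated n' A.
Proof.
move=> upA tA le u /tA Au; apply: upA Au _; apply/mdividesP => k.
by rewrite !emb_projE; case: ltnP => // lt_k; rewrite (leq_trans lt_k le).
Qed.

(** Among the monomials of degree d in n + 1 variables, those divisible by the
    last variable are its multiples of the monomials of degree d - 1, and the
    others involve n variables. *)
Lemma hcount_ext (A : Minf -> Prop) n : upset A -> truncated n A ->
  delta (fun d => (hcount A n.+1 d)%:Z) =1 (fun d => (hcount A n d)%:Z).
Proof.
move=> upA tA d.
pose Q n d := [set m : 'X_{1..n < d.+1} | (mdeg m == d) && propb (A (emb m))].
pose T : {set 'X_{1..n.+1 < d.+1}} :=
  [set m : 'X_{1..n.+1 < d.+1} | bmnm m ord_max == 0%N].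
have wid_proof (m : 'X_{1..n < d.+1}) : (mdeg (mnmwiden m) < d.+1)%N.
  by rewrite mdeg_mnmwiden bmdeg.
pose wid (m : 'X_{1..n < d.+1}) := BMultinom (wid_proof m).
have QT : Q n.+1 d :&: T = wid @: Q n d.
  apply/setP => m; rewrite !inE; apply/andP/imsetP => [[/andP [/eqP md /propbP Am] /eqP m0]|].
    pose m1 := [multinom bmnm m (widen_ord (leqnSn n) i) | i < n].
    have Em : mnmwiden m1 = m.
      apply/mnmP => i; case: (unliftP ord_max i) => [j ->|->].
        by rewrite lift_max_widen mnmwiden_widen mnmE.
      by rewrite mnmwiden_ordmax m0.
    have lt1 : (mdeg m1 < d.+1)%N by rewrite -mdeg_mnmwiden Em bmdeg.
    exists (BMultinom lt1); last by apply: val_inj; rewrite /= Em.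
    by rewrite inE /= -mdeg_mnmwiden -emb_mnmwiden Em md eqxx; apply/propbP.
  case=> m1; rewrite inE => /andP [md Am] ->; rewrite /= mdeg_mnmwiden md.
  by rewrite emb_mnmwiden mnmwiden_ordmax.
have -> : hcount A n d = #|Q n.+1 d :&: T|.
  rewrite QT card_imset // => m1 m2 /(congr1 (@bmnm _ _)) /=.
  by move/inj_mnmwiden => E; apply: val_inj.
rewrite /delta; have -> : hcount A n.+1 d = #|Q n.+1 d| by [].
rewrite -(cardsID T (Q n.+1 d)) PoszD.
suff -> : (#|Q n.+1 d :\: T|)%:Z = (if d is e.+1 then (hcount A n.+1 e)%:Z else 0).
  by rewrite addrK.
case: d @T {wid wid_proof QT} => [|e] T.
  rewrite (_ : Q _ _ :\: T = set0) ?cards0 //; apply/setP => m; rewrite !inE.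
  apply/negP => /and3P [ne md _]; case/negP: ne.
  have : bmnm m == 0%MM by rewrite -mdeg_eq0.
  by move/eqP => ->; rewrite mnm0E.
congr Posz; have add_proof (m : 'X_{1..n.+1 < e.+1}) : (mdeg (m + U_(ord_max))%MM < e.+2)%N.
  by rewrite mdegD mdeg1 addn1 ltnS bmdeg.
pose add (m : 'X_{1..n.+1 < e.+1}) := BMultinom (add_proof m).
rewrite -[RHS](card_imset (f := add)); last first.
  by move=> m1 m2 /(congr1 (@bmnm _ _)) /= /addIm E; apply: val_inj.
congr #|pred_of_set _|; apply/setP => m; rewrite !inE.
apply/and3P/imsetP => [[ne /eqP md /propbP Am]|[m1]].
  have le1 : (U_(ord_max) <= m)%MM by rewrite lep1mP.
  have Em : (m - U_(ord_max) + U_(ord_max))%MM = m by rewrite submK.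
  have md1 : mdeg (m - U_(ord_max))%MM = e.
    by have := congr1 mdeg Em; rewrite mdegD mdeg1 md addn1 => -[].
  have lt1 : (mdeg (m - U_(ord_max))%MM < e.+1)%N by rewrite md1.
  exists (BMultinom lt1); last by apply: val_inj; rewrite /= Em.
  rewrite inE /= md1 eqxx /=; apply/propbP; apply: upA (tA _ Am) _.
  apply/mdividesP => k; rewrite emb_projE; case: ltnP => // lt_k.
  rewrite -{1}Em embD mmulE -{2}[k]/(nat_of_ord (widen_ord (leqnSn n) (Ordinal lt_k))).
  rewrite emb_ord mnm1E (_ : _ == _ = false) ?addn0 //.
  by apply/negP => /eqP /(congr1 val) /= E; rewrite -E ltnn in lt_k.
rewrite inE => /andP [/eqP md /propbP Am] ->; rewrite /= mnmDE mnm1E eqxx addn1.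
split=> //; first by rewrite mdegD mdeg1 addn1 md.
by apply/propbP; apply: upA Am _; rewrite embD; eexists.
Qed.

Lemma iter_hcount (A : Minf -> Prop) n k : upset A -> truncated n A ->
  iter k delta (fun d => (hcount A (n + k) d)%:Z) =1 (fun d => (hcount A n d)%:Z).
Proof.
move=> upA tA; elim: k => [|k IH] d; first by rewrite addn0.
rewrite iterSr -IH; apply: eq_iter_delta; rewrite addnS; apply: hcount_ext => //.
by apply: truncated_leq tA _ => //; rewrite leq_addr.
Qed.

Lemma iter_delta_inj k f g : iter k delta f =1 iter k delta g -> f =1 g.
Proof.
elim: k f g => [|k IH] f g //; rewrite !iterSr => /IH; exact: delta_inj.
Qed.

End Counting.

Section StableIdeals.

Variable K : fieldType.

Lemma eq_ideal_gen (R : comNzRingType) (A B : R -> Prop) f :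
  (forall g, A g <-> B g) -> ideal_gen A f <-> ideal_gen B f.
Proof.
by move=> E; split=> -[s [Hs ->]]; exists s; split=> // c /Hs /E.
Qed.

Lemma sigma_idealE sigma (I : Rinf K -> Prop) f : sigma_ideal sigma I f <->
  ideal_gen (fun g => exists2 w, (exists2 u, min_gen I u & w = sigma u)
    & g = monom_inf K w) f.
Proof.
apply: eq_ideal_gen => g; split=> [[u mu ->]|[w [u mu ->] ->]]; last by exists u.
by exists (sigma u) => //; exists u.
Qed.

Lemma sigma_up sigma (I : Rinf K -> Prop) w : up (sigma_ideal sigma I) w <->
  exists2 u, min_gen I u & mdivides (sigma u) w.
Proof.
rewrite /up sigma_idealE -/(up _ _) gen_up; split=> [[_ [u mu ->]]|[u mu uw]].
  by exists u.
by exists (sigma u) => //; exists u.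
Qed.

Lemma sigma_fg sigma (I : Rinf K -> Prop) :
  fg_monomial_ideal I -> fg_monomial_ideal (sigma_ideal sigma I).
Proof.
move=> fgI; have [s Hs] := fgI; have [_ upI] := gen_monomial_set Hs.
have gs u : min_gen I u -> u \in s.
  case=> Iu Hu; have [v v_s vu] := proj1 (upI u) Iu.
  have <- // : v = u.
  apply: (Hu v vu); apply: (proj2 (upI v)); exists v; first exact: v_s.
  exact: mdivides_refl.
exists [seq sigma u | u <- s & propb (min_gen I u)] => f; rewrite sigma_idealE.
apply: eq_ideal_gen => g; split=> [[w [u mu ->] ->]|[w]].
  exists (sigma u) => //; apply/mapP; exists u => //.
  by rewrite mem_filter gs // andbT; apply/propbP.
case/mapP => u; rewrite mem_filter => /andP [/propbP mu _] -> ->.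
by exists (sigma u) => //; exists u.
Qed.

Definition set_ideal (A : Minf -> Prop) : Rinf K -> Prop :=
  fun f => forall u, u \in monalg.msupp f -> A u.

Lemma set_ideal_up A u : up (set_ideal A) u <-> A u.
Proof.
rewrite /up /set_ideal msupp_monom; split=> [|Au v]; first by apply; rewrite in_fset1.
by rewrite in_fset1 => /eqP ->.
Qed.

Lemma set_ideal_fg A (s : seq Minf) :
  (forall u, A u <-> exists2 v, v \in s & mdivides v u) ->
  fg_monomial_ideal (set_ideal A).
Proof.
move=> H; exists s => f; rewrite gen_monomialP.
by split=> Hf u /Hf /H.
Qed.

Lemma set_ideal_stable A (s : seq Minf) :
  (forall u, A u <-> exists2 v, v \in s & mdivides v u) ->
  (forall u v, (forall k, psum k u <= psum k v)%N -> A u -> A v) ->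
  fg_strongly_stable (set_ideal A).
Proof.
move=> H mono; split; first exact: set_ideal_fg H.
move=> u v /restrict_X /set_ideal_up Av uv; apply/restrict_X/set_ideal_up.
by apply: mono Av => k; exact: preceq_psum.
Qed.

(** The ideal (x_1, ..., x_m)^j. *)
Definition pow_set (m j : nat) (u : Minf) : Prop := (j <= psum m u)%N.

Definition pow_gens (m j : nat) : seq Minf :=
  [seq emb (bmnm v) | v <- [seq v <- enum {: 'X_{1..m < j.+1}} | mdeg (bmnm v) == j]].

Lemma pow_gensP m j u : u \in pow_gens m j <->
  exists2 v : 'X_{1..m}, mdeg v = j & u = emb v.
Proof.
split=> [/mapP [v]|[v dv ->]].
  by rewrite mem_filter => /andP [/eqP dv _] ->; exists (bmnm v).
have lt_v : (mdeg v < j.+1)%N by rewrite dv.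
apply/mapP; exists (BMultinom lt_v) => //.
by rewrite mem_filter /= dv eqxx mem_enum.
Qed.

Lemma pow_setP m j u : pow_set m j u <-> exists2 v, v \in pow_gens m j & mdivides v u.
Proof.
split=> [le_j|[_ /pow_gensP [v dv ->] vu]]; last first.
  by rewrite /pow_set -dv -(psum_emb v (leqnn m)) psum_div.
have [v [vu mv Hv]] := psum_trunc_deg m j u.
exists v => //; apply/pow_gensP; exists (proj m v); last by rewrite emb_proj_max.
rewrite -(psum_emb _ (leqnn m)) emb_proj_max // Hv //; exact/minn_idPr.
Qed.

Lemma pow_mono m j u v : (forall k, psum k u <= psum k v)%N -> pow_set m j u -> pow_set m j v.
Proof. by move=> H; rewrite /pow_set => le; exact: leq_trans le (H m). Qed.

Lemma pow_stable m j : fg_strongly_stable (set_ideal (pow_set m j)).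
Proof. by apply: (set_ideal_stable (pow_setP m j)) => u v; exact: pow_mono. Qed.

Lemma pow_min_gen m j u : min_gen (set_ideal (pow_set m j)) u <-> u \in pow_gens m j.
Proof.
split=> [[/set_ideal_up /pow_setP [v v_g vu] H]|u_g].
  have <- // : v = u.
  apply: (H v vu); apply/set_ideal_up/pow_setP; exists v; first exact: v_g.
  exact: mdivides_refl.
split; first by apply/set_ideal_up/pow_setP; exists u => //; exact: mdivides_refl.
have [b db Eu] := proj1 (pow_gensP m j u) u_g.
move=> v vu /set_ideal_up le_j; have [w Hw] := vu; apply: minfP => k.
rewrite Hw mmulE; suff -> : w k = 0%N by rewrite addn0.
have := psum_emb b (leqnn m); rewrite -Eu Hw psumM db => E.
have w0 : psum m w = 0%N by move: le_j; rewrite /pow_set; lia.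
have [lt_k|le_k] := ltnP k m.
  by move/eqP: w0; rewrite /psum sum_nat_eq0 => /forallP /(_ (Ordinal lt_k)) /= /eqP.
by have := emb_ge b le_k; rewrite -Eu Hw mmulE; lia.
Qed.

Lemma pow_max_var m j : (max_var_ideal (set_ideal (pow_set m j)) <= m)%N.
Proof.
have [_] := max_var_idealP (proj1 (pow_stable m j)); apply.
by move=> u /pow_min_gen /pow_gensP [v _ ->]; exact: max_var_emb.
Qed.

(** The smallest strongly stable ideal containing u. *)
Definition borel_set (u w : Minf) : Prop := forall k, (psum k u <= psum k w)%N.

Definition borel_gens (u : Minf) : seq Minf :=
  let n := max_var u in let d := psum n u in
  [seq emb (bmnm v) | v <- [seq v <- enum {: 'X_{1..n < d.+1}} |
     (mdeg (bmnm v) == d) && propb (borel_set u (emb (bmnm v)))]].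

Lemma borel_gen_below u w : borel_set u w -> exists v,
  [/\ mdivides v w, (max_var v <= max_var u)%N,
      psum (max_var u) v = psum (max_var u) u & borel_set u v].
Proof.
set n := max_var u; move=> uw.
have [v [vw mv Hv]] := psum_trunc_deg n (psum n u) w; exists v.
have En : psum n v = psum n u by rewrite Hv //; apply/minn_idPr; exact: uw.
split=> // k; have [le_k|/ltnW le_k] := leqP k n.
  by rewrite Hv // leq_min uw psum_mono.
by rewrite (psum_ge (leqnn _) le_k) (psum_ge mv le_k) En.
Qed.

Lemma borel_setP u w : borel_set u w <-> exists2 v, v \in borel_gens u & mdivides v w.
Proof.
rewrite /borel_gens; set n := max_var u; set d := psum n u.
split=> [/borel_gen_below [v [vw mv dv uv]]|[x /mapP [v]]]; last first.
  rewrite mem_filter => /andP [/andP [_ /propbP uv] _] -> vw k.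
  by apply: leq_trans (uv k) _; exact: psum_div.
exists v => //; have dv' : mdeg (proj n v) = d.
  by rewrite -(psum_emb _ (leqnn n)) emb_proj_max.
have lt_v : (mdeg (proj n v) < d.+1)%N by rewrite dv'.
apply/mapP; exists (BMultinom lt_v); last by rewrite /= emb_proj_max.
rewrite mem_filter mem_enum /= dv' eqxx andbT; apply/propbP.
by rewrite emb_proj_max.
Qed.

Lemma borel_stable u : fg_strongly_stable (set_ideal (borel_set u)).
Proof.
apply: (set_ideal_stable (borel_setP u)) => v w vw uv k.
exact: leq_trans (uv k) (vw k).
Qed.

(** Truncated to the degree of u, a monomial of [borel_set u] precedes u. *)
Lemma borel_sub (I : Rinf K -> Prop) u w :
  fg_strongly_stable I -> min_gen I u -> borel_set u w -> up I w.
Proof.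
move=> [fgI ssI] mu; have [Hmax _] := max_var_idealP fgI.
move=> /borel_gen_below [v [vw mv dv uv]].
have le_u := Hmax u mu; set n := max_var_ideal I in ssI le_u.
apply: (fg_upset fgI _ vw); rewrite -(emb_proj_max (leq_trans mv le_u)).
apply/restrict_X; apply: (ssI _ (proj n u)).
  by apply/restrict_X; rewrite emb_proj_max //; case: mu.
apply: psum_preceq => [|k].
  rewrite -!(psum_emb _ (leqnn n)) !emb_proj_max ?(leq_trans mv) //.
  by rewrite (psum_ge mv le_u) (psum_ge (leqnn _) le_u).
by rewrite !emb_proj_max ?(leq_trans mv) //; exact: uv.
Qed.

Lemma borel_sub_pow u k w : borel_set u w -> pow_set k (psum k u) w.
Proof. exact. Qed.

End StableIdeals.

Section HilbertSigma.

Variables (K : fieldType) (sigma : Minf -> Minf).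
Hypothesis stable : stable_operator K sigma.

(** Each Betti number is given with a resolution of its own; they agree by
    [tor_dim_unique]. *)
Lemma stable_resolutions (I : Rinf K -> Prop) : fg_strongly_stable I ->
  exists F F', [/\ is_free_resolution F (restrict (n := max_var_ideal I) I),
    is_free_resolution F'
      (restrict (n := max_var_ideal (sigma_ideal sigma I)) (sigma_ideal sigma I)) &
    forall i j, tor_dim F i j = tor_dim F' i j].
Proof.
move=> sI; have H := proj1 stable I sI.
have [b [F rF _] [F' rF' _]] := H 0%N 0%N.
exists F, F'; split=> // i j; have [b' [E rE <-] [E' rE' EE']] := H i j.
by rewrite (tor_dim_unique _ _ rF rE) -EE' (tor_dim_unique _ _ rE' rF').
Qed.

(** Both Hilbert functions are determined by the same Betti numbers. *)
Lemma hilbert_sigma (I : Rinf K -> Prop) N d : fg_strongly_stable I ->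
  (max_var_ideal I <= N)%N -> (max_var_ideal (sigma_ideal sigma I) <= N)%N ->
  hcount (up (sigma_ideal sigma I)) N d = hcount (up I) N d.
Proof.
move=> sI; have fgI := proj1 sI; have fgS := sigma_fg sigma fgI.
have [F [F' [rF rF' tE]]] := stable_resolutions sI.
set n := max_var_ideal I in F rF tE *; set n' := max_var_ideal _ in F' rF' tE *.
move=> le_n le_n'; apply/eqP; rewrite -eqz_nat; apply/eqP.
have HF (L : Rinf K -> Prop) l (E : free_complex K l) e : fg_monomial_ideal L ->
    is_free_resolution E (restrict L) -> (l <= N)%N ->
    iter l delta (fun d => (hcount (up L) l d)%:Z) e =
    \sum_(i < N.+1) (-1) ^+ i * (tor_dim E i e)%:Z.
  move=> fgL rE le_l; apply: (hilbert_betti rE) => //; last exact: leqW.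
  move=> d'; apply: (res_hilbert_monomial rE) => f.
  exact: restrictP (fg_monomial_set fgL) f.
have IN (L : Rinf K -> Prop) e : fg_monomial_ideal L -> (max_var_ideal L <= N)%N ->
    iter N delta (fun d => (hcount (up L) N d)%:Z) e =
    iter (max_var_ideal L) delta (fun d => (hcount (up L) (max_var_ideal L) d)%:Z) e.
  move=> fgL le_l; rewrite -{1 2}(subnKC le_l) iterD.
  apply: eq_iter_delta; apply: iter_hcount; first exact: fg_upset.
  exact: fg_truncated.
apply: (@iter_delta_inj N (fun d => (hcount (up (sigma_ideal sigma I)) N d)%:Z)
  (fun d => (hcount (up I) N d)%:Z)) => e.
rewrite !IN // (HF _ _ _ _ fgS rF') // (HF _ _ _ _ fgI rF) //.
by apply: eq_bigr => i _; rewrite tE.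
Qed.

End HilbertSigma.

(** * Initial monomials for the reverse lexicographic order *)

Section Revlex.

Variable n : nat.
Implicit Types u v w : 'X_{1..n}.

Lemma revlexP u v : mdeg u = mdeg v ->
  revlex_lt u v <-> exists2 i : 'I_n, (v i < u i)%N &
    forall j : 'I_n, (i < j)%N -> u j = v j.
Proof.
move=> E; rewrite /revlex_lt E ltnn eqxx /=.
split=> [/existsP [i /andP [lt /forallP H]]|[i lt H]].
  by exists i => // j; have /implyP := H j => H' /H' /eqP.
apply/existsP; exists i; rewrite lt /=; apply/forallP => j.
by apply/implyP => /H ->.
Qed.

Lemma revlex_asym u v : mdeg u = mdeg v -> revlex_lt u v -> ~~ revlex_lt v u.
Proof.
move=> E /(revlexP E) [i lt_i Hi]; apply/negP => /(revlexP (esym E)) [k lt_k Hk].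
case: (ltngtP i k) => [lt|lt|/val_inj E'].
- by move: lt_k; rewrite Hi // ltnn.
- by move: lt_i; rewrite Hk // ltnn.
by move: lt_i; rewrite E' ltnNge ltnW.
Qed.

Lemma revlex_trans u v w : mdeg u = mdeg v -> mdeg v = mdeg w ->
  revlex_lt u v -> revlex_lt v w -> revlex_lt u w.
Proof.
move=> E1 E2 /(revlexP E1) [i lt_i Hi] /(revlexP E2) [k lt_k Hk].
apply/(revlexP (etrans E1 E2)).
case: (ltngtP i k) => [lt|lt|/val_inj E'].
- exists k; first by rewrite Hi.
  by move=> j lt_j; rewrite Hi ?Hk // (ltn_trans lt lt_j).
- exists i; first by rewrite -Hk.
  by move=> j lt_j; rewrite Hi ?Hk // (ltn_trans lt lt_j).
exists i; first by rewrite (ltn_trans _ lt_i) // E'.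
by move=> j lt_j; rewrite Hi ?Hk // -E'.
Qed.

Lemma revlex_total u v : mdeg u = mdeg v -> u != v -> revlex_lt u v || revlex_lt v u.
Proof.
move=> E ne.
have [i0 ne0] : exists i, u i != v i.
  apply/existsP; move: ne; apply: contraR; rewrite negb_exists => /forallP H.
  by apply/eqP/mnmP => i; apply/eqP; move: (H i); rewrite negbK.
pose i := [arg max_(i > i0 | u i != v i) (i : nat)].
have [nei Hi] : u i != v i /\ forall j : 'I_n, (i < j)%N -> u j = v j.
  rewrite /i; case: arg_maxnP => // k nek maxk; split=> // j lt_j.
  apply/eqP/contraT => nej; by have := maxk j nej; rewrite /= leqNgt lt_j.
case: (ltngtP (u i) (v i)) => [lt|lt|/eqP]; last by rewrite (negPf nei).
  apply/orP; right; apply/(revlexP (esym E)); exists i => // j /Hi //.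
by apply/orP; left; apply/(revlexP E); exists i.
Qed.

Lemma revlex_add u v w : revlex_lt u v -> revlex_lt (u + w)%MM (v + w)%MM.
Proof.
rewrite /revlex_lt !mdegD ltn_add2r eqn_add2r.
case/orP => [-> //|/andP [-> /existsP [i /andP [lt /forallP H]]]]; rewrite orbC /=.
apply/orP; left; apply/existsP; exists i; rewrite !mnmDE ltn_add2r lt /=.
apply/forallP => j; apply/implyP => lt_j; rewrite !mnmDE.
by have /implyP/(_ lt_j)/eqP -> := H j.
Qed.

End Revlex.

Definition initials (K : fieldType) n (W : {mpoly K[n]} -> Prop) (m : 'X_{1..n}) :=
  exists2 f, W f & is_initial f m.

Definition hom_deg (R : nzRingType) n (d : nat) (p : {mpoly R[n]}) : Prop :=
  forall m, m \in msupp p -> mdeg m = d.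

Section InitialCount.

Variables (K : fieldType) (n d : nat) (W : {mpoly K[n]} -> Prop).
Hypotheses (subW : subspace W) (homW : forall f, W f -> hom_deg d f).

Lemma sorted_monomials : exists s : seq 'X_{1..n},
  (forall m, mdeg m = d -> m \in s) /\ pairwise (@revlex_lt n) s /\ uniq s /\
  (forall m, m \in s -> mdeg m = d).
Proof.
pose s0 := [seq bmnm m | m <- [seq m <- enum {: 'X_{1..n < d.+1}} | mdeg (bmnm m) == d]].
have s0P m : m \in s0 -> mdeg m = d.
  by case/mapP => m'; rewrite mem_filter => /andP [/eqP dm _] ->.
have us0 : uniq s0.
  by rewrite map_inj_uniq; [rewrite filter_uniq // enum_uniq|exact: val_inj].
pose r u v := (u == v) || @revlex_lt n u v.
have sub_s0 s : perm_eq s s0 -> {in s, forall m, mdeg m = d}.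
  by move=> /perm_mem E m; rewrite E => /s0P.
pose s := sort r s0; have ps : perm_eq s s0 by rewrite perm_sort.
have us : uniq s by rewrite (perm_uniq ps).
exists s; split; last split; last split => //.
- move=> m dm; rewrite (perm_mem ps); apply/mapP.
  have lt_m : (mdeg m < d.+1)%N by rewrite dm.
  by exists (BMultinom lt_m) => //; rewrite mem_filter mem_enum /= dm eqxx.
- have tr : {in s & &, transitive r}.
    move=> v u w /(sub_s0 _ ps) dv /(sub_s0 _ ps) du /(sub_s0 _ ps) dw.
    case/orP => [/eqP -> //|H1] /orP [/eqP <-|H2]; apply/orP; right => //.
    by apply: revlex_trans H1 H2; rewrite ?du ?dv ?dw.
  have so : sorted r s.
    apply: (@sort_sorted_in _ (mem s0)); last by apply/allP.
    move=> u v /s0P du /s0P dv; rewrite /r.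
    have [->|ne] := eqVneq u v; first by [].
    by rewrite /=; apply: revlex_total => //; rewrite du dv.
  have all_s : all (mem s) s by apply/allP.
  have := so; rewrite (sorted_pairwise_in tr all_s).
  move: us; elim: (s) => //= a t IH /andP [a_t ut] /andP [Ha Hp].
  rewrite IH // andbT; apply/allP => b b_t; have := allP Ha b b_t.
  by case/orP => [/eqP E|//]; rewrite E b_t in a_t.
by move=> m; rewrite (perm_mem ps) => /s0P.
Qed.

Lemma dim_scalars : has_dim (fun _ : K^o => True) 1.
Proof.
exists (fun _ => 1); split=> // [v _|c].
  by exists (fun _ => v); rewrite big_ord1 /GRing.scale /= mulr1.
by rewrite big_ord1 /GRing.scale /= mulr1 => c0 i; rewrite ord1.
Qed.

(** When the monomials are removed from the allowed supports one at a time, the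
    largest first, the dimension of W drops by one exactly at the initial
    monomials. *)
Lemma initials_count : has_dim W (mono_count (initials W) d).
Proof.
have [s [mem_s [pw [us s_d]]]] := sorted_monomials.
pose Wt (t : seq 'X_{1..n}) f := W f /\ {subset msupp f <= t}.
have sWt t : subspace (Wt t).
  split; first by split; [exact: subspace0|move=> m; rewrite msupp0].
  move=> a u v [Wu su] [Wv sv]; split; first exact: (proj2 subW).
  move=> m /msuppD_le; rewrite mem_cat => /orP [/msuppZ_le/su|/sv] //.
have key t t' : s = t ++ t' -> has_dim (Wt t) (count (fun m => propb (initials W m)) t).
  elim/last_ind: t t' => [|t m IH] t' Es.
    exists (fun _ => 0); split=> [i|v [_ sv]|c _ i]; try by case: i.
    exists (fun _ => 0); rewrite big_ord0; apply: msuppnil0.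
    by case: (msupp v) sv => // a l /(_ a (mem_head _ _)).
  rewrite cat_rcons in Es; have dt := IH _ Es.
  move: pw; rewrite Es pairwise_cat pairwise_cons => /and4P [/allrelP lt_tm _ /allP m_lt _].
  have m_t : m \notin t.
    by move: us; rewrite Es cat_uniq => /and3P [_ /norP [H _] _].
  have md : mdeg m = d by apply: s_d; rewrite Es mem_cat mem_head orbT.
  have kerE f : Wt (rcons t m) f /\ f@_m = 0 <-> Wt t f.
    split=> [[[Wf sf] f0]|[Wf sf]].
      split=> // m' m'_f; have := sf _ m'_f; rewrite mem_rcons inE => /orP [/eqP E|//].
      by move: m'_f; rewrite E mcoeff_msupp f0 eqxx.
    split; last by apply: memN_msupp_eq0; apply: contra m_t => /sf.
    by split=> // m' /sf m'_t; rewrite mem_rcons inE m'_t orbT.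
  rewrite -cats1 count_cat /= addn0.
  case: propbP => [[f Wf inf]|nin]; last first.
    rewrite addn0; apply: eq_has_dim dt => f; rewrite -kerE cats1.
    split=> [[] //|Wf]; split=> //; apply/eqP; rewrite mcoeff_eq0; apply/negP => m_f.
    apply: nin; exists f; first by case: Wf.
    split=> // m' m'_f ne; have [_ sf] := Wf; have := sf _ m'_f.
    rewrite mem_rcons inE (negPf ne) /= => m'_t.
    by apply: lt_tm => //; rewrite mem_head.
  rewrite cats1; have lin (a : K) (u v : {mpoly K[n]}) :
      (mcoeff m (a *: u + v) : K^o) = a *: (mcoeff m u : K^o) + mcoeff m v.
    by rewrite mcoeffD mcoeffZ.
  apply: (dim_ext lin (sWt _) _ dim_scalars) => //.
    by apply: eq_has_dim dt => f'; rewrite kerE.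
  move=> x _; have [m_f Hf] := inf.
  have ne0 : f@_m != 0 by rewrite -mcoeff_msupp.
  exists ((x / f@_m) *: f); last by rewrite /= mcoeffZ divfK.
  apply: (subspaceZ (sWt _)); split=> // m' m'_f; rewrite mem_rcons inE.
  case: eqP => //= /eqP ne; have lt' := Hf _ m'_f ne.
  have md' : mdeg m' = d by exact: homW Wf _ m'_f.
  have := mem_s _ md'; rewrite Es mem_cat inE (negPf ne) /= => /orP [//|m'_t'].
  have := revlex_asym _ (m_lt _ m'_t'); by rewrite md md' lt' => /(_ erefl).
have Es : s = s ++ [::] by rewrite cats0.
have := key s [::] Es; rewrite /mono_count => H.
have -> : #|[set m : 'X_{1..n < d.+1} | (mdeg m == d) & propb (initials W m)]| =
    count (fun m => propb (initials W m)) s.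
  rewrite -size_filter cardE -(size_map (@bmnm n d.+1)); apply: perm_size.
  apply: uniq_perm.
  - rewrite map_inj_uniq ?enum_uniq //; exact: val_inj.
  - by rewrite filter_uniq.
  move=> m; rewrite mem_filter; apply/mapP/andP => [[m']|[inm m_s]].
    by rewrite mem_enum inE => /andP [/eqP dm inm] ->; split=> //; exact: mem_s.
  have lt_m : (mdeg m < d.+1)%N by rewrite s_d.
  by exists (BMultinom lt_m) => //; rewrite mem_enum inE /= s_d // eqxx.
apply: eq_has_dim H => f; split=> [[] //|Wf]; split=> // m m_f.
by apply: mem_s; exact: homW Wf _ m_f.
Qed.

End InitialCount.

(** * Initial ideals after a linear change of variables *)

Section HomDegree.

Lemma hom_deg0 (R : nzRingType) n d : hom_deg d (0 : {mpoly R[n]}).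
Proof. by move=> m; rewrite msupp0. Qed.

Lemma hom_degD (R : nzRingType) n d (p q : {mpoly R[n]}) :
  hom_deg d p -> hom_deg d q -> hom_deg d (p + q).
Proof. by move=> hp hq m /msuppD_le; rewrite mem_cat => /orP [/hp|/hq]. Qed.

Lemma hom_degM (R : nzRingType) n d e (p q : {mpoly R[n]}) :
  hom_deg d p -> hom_deg e q -> hom_deg (d + e) (p * q).
Proof.
move=> hp hq m /msuppM_le /allpairsP [[a b] /= [/hp Ha /hq Hb ->]].
by rewrite mdegD Ha Hb.
Qed.

Lemma hom_deg_sum (R : nzRingType) n d (I : Type) (s : seq I) (P : pred I)
    (F : I -> {mpoly R[n]}) :
  (forall i, P i -> hom_deg d (F i)) -> hom_deg d (\sum_(i <- s | P i) F i).
Proof. by move=> H; apply: (big_ind (hom_deg d)) => //; [exact: hom_deg0|exact: hom_degD]. Qed.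

Lemma hom_degZ (R : nzRingType) n d c (p : {mpoly R[n]}) : hom_deg d p -> hom_deg d (c *: p).
Proof. by move=> hp m /msuppZ_le /hp. Qed.

Lemma hom_degX (R : nzRingType) n (m : 'X_{1..n}) : hom_deg (mdeg m) ('X_[m] : {mpoly R[n]}).
Proof. by move=> m'; rewrite msuppX inE => /eqP ->. Qed.

Lemma hom_degC (R : nzRingType) n (c : R) : hom_deg 0 (c%:MP : {mpoly R[n]}).
Proof. by move=> m; rewrite msuppC; case: eqP => // _; rewrite inE => /eqP ->; rewrite mdeg0. Qed.

Definition hom_part (R : nzRingType) n d (p : {mpoly R[n]}) : {mpoly R[n]} :=
  \sum_(m <- msupp p | mdeg m == d) p@_m *: 'X_[m].

Lemma coef_hom_part (R : nzRingType) n d (p : {mpoly R[n]}) m :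
  (hom_part d p)@_m = if mdeg m == d then p@_m else 0.
Proof. exact: (mcoeff_filter (fun m => mdeg m == d)). Qed.

Lemma hom_part_hom (R : nzRingType) n d (p : {mpoly R[n]}) : hom_deg d (hom_part d p).
Proof.
by move=> m; rewrite mcoeff_msupp coef_hom_part; case: ifP => [/eqP //|_]; rewrite eqxx.
Qed.

Lemma hom_part_sum (R : nzRingType) n (p : {mpoly R[n]}) :
  p = \sum_(d < msize p) hom_part d p.
Proof.
apply/mpolyP => m; rewrite (raddf_sum (mcoeff m)) /=.
under eq_bigr do rewrite coef_hom_part.
have [m_p|m_p] := boolP (m \in msupp p).
  rewrite (bigD1 (Ordinal (msize_mdeg_lt m_p))) //= eqxx big1 ?addr0 // => i ne.
  by case: eqP => // E; case/eqP: ne; apply: val_inj.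
by rewrite memN_msupp_eq0 // big1 // => i _; rewrite if_same.
Qed.

Lemma hom_deg_coef (R : nzRingType) n d (p : {mpoly R[n]}) m :
  hom_deg d p -> mdeg m != d -> p@_m = 0.
Proof. by move=> hp ne; apply: memN_msupp_eq0; apply: contra ne => /hp ->. Qed.

End HomDegree.

(** A relation rather than a function: the morphisms at hand are built in several
    ways, and each is determined by iota and G. *)
Definition linear_subst (R T : nzRingType) n m (Xi : {mpoly R[n]} -> {mpoly T[m]})
    (iota : R -> T) (G : 'M[T]_(n, m)) : Prop :=
  (forall a, Xi a%:MP = (iota a)%:MP) /\
  (forall i, Xi 'X_i = \sum_(j < m) G i j *: 'X_j).

Lemma linear_subst_hom (R T : comNzRingType) n m
    (Xi : {rmorphism {mpoly R[n]} -> {mpoly T[m]}}) iota G d p :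
  linear_subst Xi iota G -> hom_deg d p -> hom_deg d (Xi p).
Proof.
move=> [XiC XiX] hp; rewrite (mpolyE p) rmorph_sum /= big_seq.
apply: hom_deg_sum => a a_p; rewrite -mul_mpolyC rmorphM /= XiC -[d]add0n.
apply: hom_degM; first exact: hom_degC.
rewrite mpolyXE_id rmorph_prod -(hp _ a_p) mdegE.
apply: (big_ind2 (fun q e => hom_deg e q)) => [|q1 d1 q2 d2 h1 h2|i _].
- by move: (@hom_degC T m 1); rewrite mpolyC1.
- exact: hom_degM.
rewrite rmorphXn XiX; elim: (a i) => [|k IH].
  by rewrite expr0; move: (@hom_degC T m 1); rewrite mpolyC1.
rewrite exprS -add1n; apply: hom_degM => //; apply: hom_deg_sum => j _.
by apply: hom_degZ; have := @hom_degX T m U_(j)%MM; rewrite mdeg1.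
Qed.

Lemma linear_subst_eq (R T : comNzRingType) n m
    (X1 X2 : {rmorphism {mpoly R[n]} -> {mpoly T[m]}}) iota G :
  linear_subst X1 iota G -> linear_subst X2 iota G -> X1 =1 X2.
Proof.
move=> [C1 E1] [C2 E2]; apply: mpoly_hom_eq => [c|i]; first by rewrite C1 C2.
by rewrite E1 E2.
Qed.

Section LinearChange.

Variables (K : fieldType) (n : nat).

HB.instance Definition _ (g : 'M[K]_n) :=
  GRing.RMorphism.copy (@linear_change K n g)
    (comp_mpoly [tuple \sum_(j < n) g i j *: 'X_j | i < n]).

Lemma linear_changeP (g : 'M[K]_n) : linear_subst (linear_change g) idfun g.
Proof.
split=> [a|i]; first exact: comp_mpolyC.
by rewrite /linear_change comp_mpolyXU -tnth_nth tnth_mktuple.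
Qed.

Lemma linear_changeC (g : 'M[K]_n) c : linear_change g c%:MP = c%:MP.
Proof. exact: (proj1 (linear_changeP g)). Qed.

Lemma linear_change_mul (g h : 'M[K]_n) p :
  linear_change g (linear_change h p) = linear_change (h *m g) p.
Proof.
have C := linear_changeC; have X g' i := proj2 (linear_changeP g') i.
apply: (mpoly_hom_eq (f := linear_change g \o linear_change h)) => [c|i] /=.
  by rewrite !C.
rewrite !X rmorph_sum /=.
under [RHS]eq_bigr => j _ do rewrite mxE scaler_suml.
rewrite [RHS]exchange_big; apply: eq_bigr => k _.
rewrite -mul_mpolyC rmorphM /= C X mul_mpolyC scaler_sumr.
by apply: eq_bigr => j _; rewrite scalerA.
Qed.

Lemma linear_change1 p : linear_change (1%:M : 'M[K]_n) p = p.
Proof.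
apply: (mpoly_hom_eq (f := linear_change 1%:M) (g := idfun)) => [c|i] /=.
  exact: linear_changeC.
rewrite (proj2 (linear_changeP _)) (bigD1 i) //= mxE eqxx scale1r big1 ?addr0 //.
by move=> j ne; rewrite mxE eq_sym (negPf ne) scale0r.
Qed.

Lemma linear_changeK (g : 'M[K]_n) p : g \in unitmx ->
  linear_change (invmx g) (linear_change g p) = p.
Proof. by move=> ug; rewrite linear_change_mul mulmxV // linear_change1. Qed.

Lemma linear_changeVK (g : 'M[K]_n) p : g \in unitmx ->
  linear_change g (linear_change (invmx g) p) = p.
Proof. by move=> ug; rewrite linear_change_mul mulVmx // linear_change1. Qed.

End LinearChange.

Section InitialOfImage.

Variables (K : fieldType) (n : nat) (A : 'X_{1..n} -> Prop) (g : 'M[K]_n).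
Variable J : {mpoly K[n]} -> Prop.
Hypotheses (JA : forall f, J f <-> (forall m, m \in msupp f -> A m))
  (A_up : forall m a, A m -> A (m + a)%MM) (g_unit : g \in unitmx).

Let hsub d p := linear_subst_hom (d := d) (p := p) (linear_changeP g).

Definition image_part d (f : {mpoly K[n]}) : Prop :=
  exists p, [/\ J p, hom_deg d p & f = linear_change g p].

Lemma J_subspace d : subspace (fun p => J p /\ hom_deg d p).
Proof.
split; first by split; [apply/JA => m; rewrite msupp0|exact: hom_deg0].
move=> a u v [/JA Ju hu] [/JA Jv hv]; split; last by apply: hom_degD => //; exact: hom_degZ.
by apply/JA => m /msuppD_le; rewrite mem_cat => /orP [/msuppZ_le/Ju|/Jv].
Qed.

Lemma image_part_subspace d : subspace (image_part d).
Proof.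
have [[J0 h0] lin] := J_subspace d.
split; first by exists 0; split=> //; rewrite rmorph0.
move=> a u v [p [Jp hp ->]] [q [Jq hq ->]]; exists (a *: p + q).
have [] := lin a p q (conj Jp hp) (conj Jq hq); split=> //.
by rewrite -!mul_mpolyC rmorphD rmorphM /= linear_changeC.
Qed.

Lemma image_part_hom d f : image_part d f -> hom_deg d f.
Proof. by move=> [p [_ hp ->]]; exact: hsub. Qed.

(** A linear change of variables respects degrees, so the homogeneous component
    of the preimage already has the given initial monomial. *)
Lemma initials_image m :
  initials (linear_image g J) m <-> initials (image_part (mdeg m)) m.
Proof.
split=> [[f [p Jp ->] [m_f Hf]]|[f [p [Jp _ ->]] H]]; last first.
  by exists (linear_change g p) => //; exists p.
set d := mdeg m; pose pd := hom_part d p.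
have cE m' : mdeg m' = d -> (linear_change g pd)@_m' = (linear_change g p)@_m'.
  move=> dm'.
  have -> : (linear_change g p)@_m' = \sum_(i < msize p) (linear_change g (hom_part i p))@_m'.
    rewrite -[LHS](congr1 (fun q => (linear_change g q)@_m') (esym (hom_part_sum p))).
    by rewrite (rmorph_sum (linear_change g)) (raddf_sum (mcoeff m')).
  have [lt_d|le_d] := ltnP d (msize p).
    rewrite (bigD1 (Ordinal lt_d)) //= -/pd big1 ?addr0 // => i ne.
    apply: (hom_deg_coef (d := i)); first by apply: hsub; exact: hom_part_hom.
    by rewrite dm'; apply: contraNneq ne => E; apply/eqP/val_inj.
  rewrite big1 => [|i _]; last first.
    apply: (hom_deg_coef (d := i)); first by apply: hsub; exact: hom_part_hom.
    by rewrite dm' gtn_eqF // (leq_trans _ le_d).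
  have -> : pd = 0; last by rewrite rmorph0 mcoeff0.
  apply/mpolyP => a; rewrite coef_hom_part mcoeff0; case: eqP => // da.
  by apply: memN_msupp_eq0; apply: msize_mdeg_ge; rewrite da.
exists (linear_change g pd).
  exists pd; split=> //; last exact: hom_part_hom.
  apply/JA => a; rewrite mcoeff_msupp coef_hom_part; case: ifP => [_|_]; last by rewrite eqxx.
  by rewrite -mcoeff_msupp; exact: (proj1 (JA p) Jp).
split; first by rewrite mcoeff_msupp cE // -mcoeff_msupp.
move=> m' m'_pd ne; apply: Hf => //.
have dm' : mdeg m' = d by exact: (linear_subst_hom (linear_changeP g) (@hom_part_hom _ _ d p)) m'_pd.
by rewrite mcoeff_msupp -cE // -mcoeff_msupp.
Qed.

Lemma J_dim d : has_dim (fun p => J p /\ hom_deg d p) (mono_count A d).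
Proof.
rewrite /mono_count; set Q := [set m | _].
pose e (i : 'I_#|Q|) : 'X_{1..n < d.+1} := enum_val i.
have eQ i : mdeg (e i) = d /\ A (e i).
  by have := enum_valP i; rewrite inE => /andP [/eqP ? /propbP].
have sumE (c : 'I_#|Q| -> K) m :
    (\sum_i c i *: 'X_[e i])@_m = \sum_i c i * (bmnm (e i) == m)%:R.
  by rewrite (raddf_sum (mcoeff m)); apply: eq_bigr => i _; rewrite /= mcoeffZ mcoeffX.
have sum_e (c : 'I_#|Q| -> K) i : \sum_k c k * (bmnm (e k) == e i)%:R = c i.
  rewrite (bigD1 i) //= eqxx mulr1 big1 ?addr0 // => k ne.
  case: eqP => [E|]; last by rewrite mulr0.
  by case/eqP: ne; apply: enum_val_inj; apply: val_inj.
exists (fun i => 'X_[e i]); split.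
- move=> i; have [de Ae] := eQ i; split; last by have := @hom_degX K n (e i); rewrite de.
  by apply/JA => m; rewrite msuppX inE => /eqP ->.
- move=> p [/JA Hp hp]; exists (fun i => p@_(e i)).
  apply/mpolyP => m; rewrite sumE.
  have [m_p|m_p] := boolP (m \in msupp p); last first.
    rewrite memN_msupp_eq0 // big1 // => i _.
    case: (bmnm (e i) =P m) => [->|_]; last by rewrite mulr0.
    by rewrite memN_msupp_eq0 // mul0r.
  have lt_m : (mdeg m < d.+1)%N by rewrite hp.
  have Qm : BMultinom lt_m \in Q by rewrite inE /= hp // eqxx; apply/propbP; exact: Hp.
  have Em : m = e (enum_rank_in Qm (BMultinom lt_m)) by rewrite /e enum_rankK_in.
  by rewrite [in RHS]Em sum_e -Em.
by move=> c H i; rewrite -(sum_e c i) -sumE H mcoeff0.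
Qed.

Lemma initials_image_count d :
  mono_count (initials (linear_image g J)) d = mono_count A d.
Proof.
have dJ : has_dim (image_part d) (mono_count A d).
  have lin (a : K) (u v : {mpoly K[n]}) : linear_change g (a *: u + v) =
      a *: linear_change g u + linear_change g v.
    by rewrite -!mul_mpolyC rmorphD rmorphM /= linear_changeC.
  apply: (dim_inj lin (J_dim d)).
  - by move=> v _ H; rewrite -(linear_changeK v g_unit) H rmorph0.
  - exact: J_subspace.
  - by move=> v [Jv hv]; exists v.
  by move=> f [p [Jp hp ->]]; exists p.
rewrite -(dim_uniq (initials_count (image_part_subspace d) (@image_part_hom d)) dJ).
rewrite /mono_count; congr #|pred_of_set _|; apply/setP => m; rewrite !inE.
case: eqP => //= dm; apply/propbP/propbP; rewrite initials_image dm //.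
Qed.

Lemma initials_image_up m a : initials (linear_image g J) m ->
  initials (linear_image g J) (m + a)%MM.
Proof.
move=> [f [p Jp ->] [m_f Hf]]; exists (linear_change g p * 'X_[a]).
  exists (p * linear_change (invmx g) 'X_[a]); last by rewrite rmorphM /= linear_changeVK.
  apply/JA => b /msuppM_le /allpairsP [[c e] /= [c_p _ ->]].
  by apply: A_up; exact: (proj1 (JA p) Jp).
split; first by rewrite mcoeff_msupp addmC mcoeffMX -mcoeff_msupp.
move=> m'; rewrite (perm_mem (msuppMX _ _)) => /mapP [b b_f ->] ne.
rewrite addmC; apply: revlex_add; apply: Hf => //.
by apply: contraNneq ne => ->; rewrite addmC.
Qed.

Lemma initial_ideal_image f : initial_ideal (linear_image g J) f <->
  (forall m, m \in msupp f -> initials (linear_image g J) m).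
Proof.
split=> [[s [Hs ->]] m|H].
  elim: s Hs => [|c s IH] Hs; first by rewrite big_nil msupp0.
  rewrite big_cons => /msuppD_le; rewrite mem_cat => /orP [|m_s]; last first.
    by apply: IH => // d d_s; apply: Hs; rewrite inE d_s orbT.
  have [h [m0 [Jh ih ->]]] := Hs c (mem_head _ _).
  case/msuppM_le/allpairsP => [[a b] /= [_]]; rewrite msuppX inE => /eqP -> ->.
  by rewrite addmC; apply: initials_image_up; exists h.
rewrite (mpolyE f); apply: ideal_gen_sum => m /H [h Jh ih].
rewrite -mul_mpolyC; apply: ideal_genM; apply: ideal_gen_mem.
by exists h, m.
Qed.

End InitialOfImage.

(** * Setting the last variables to zero *)

Section DropVariables.

Variables (n N : nat).
Hypothesis le_nN : (n <= N)%N.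

Definition wid (b : 'X_{1..n}) : 'X_{1..N} := proj N (emb b).

Lemma emb_wid b : emb (wid b) = emb b.
Proof. by apply: emb_proj => k le_k; rewrite emb_ge // (leq_trans le_nN). Qed.

Lemma wid_inj : injective wid.
Proof. by move=> b c E; apply: emb_inj; rewrite -!emb_wid E. Qed.

Lemma mdeg_wid b : mdeg (wid b) = mdeg b.
Proof. by rewrite -(psum_emb _ (leqnn N)) emb_wid psum_emb. Qed.

Lemma wid_ge b (i : 'I_N) : (n <= i)%N -> wid b i = 0%N.
Proof. by move=> le_i; rewrite projE emb_ge. Qed.

Lemma wid_proj (m : 'X_{1..N}) : (forall i : 'I_N, (n <= i)%N -> m i = 0%N) ->
  wid (proj n (emb m)) = m.
Proof.
move=> H; apply: emb_inj; rewrite emb_wid emb_proj // => k le_k.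
by have [lt_k|] := ltnP k N; [rewrite -[k]/(val (Ordinal lt_k)) emb_ord H|exact: emb_ge].
Qed.

Lemma wid_lt b b' : revlex_lt b b' -> revlex_lt (wid b) (wid b').
Proof.
rewrite /revlex_lt !mdeg_wid => /orP [-> //|/andP [-> /existsP [i /andP [lt /forallP H]]]].
apply/orP; right; apply/existsP; exists (widen_ord le_nN i).
rewrite !projE /= !emb_ord lt; apply/forallP => j; apply/implyP => lt_j.
rewrite !projE; have [lt_jn|le_j] := ltnP j n; last by rewrite !emb_ge.
by rewrite -[nat_of_ord j]/(val (Ordinal lt_jn)) !emb_ord; apply: (implyP (H _)).
Qed.

Definition drop_var (R : comNzRingType) (i : 'I_N) : {mpoly R[n]} :=
  if insub (i : nat) is Some o then 'X_o else 0.

Definition drop_vars (R : comNzRingType) : {mpoly R[N]} -> {mpoly R[n]} :=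
  mmap (@mpolyC n R) (@drop_var R).

HB.instance Definition _ (R : comNzRingType) :=
  GRing.RMorphism.copy (@drop_vars R) (mmap (@mpolyC n R) (@drop_var R)).

Lemma drop_varsC (R : comNzRingType) (a : R) : drop_vars a%:MP = a%:MP.
Proof. exact: mmapC. Qed.

Lemma drop_varsX (R : comNzRingType) (i : 'I_N) : drop_vars ('X_i : {mpoly R[N]}) = drop_var R i.
Proof. by rewrite /drop_vars mmapX mmap1U. Qed.

Lemma drop_vars_subst (R : comNzRingType) :
  linear_subst (@drop_vars R) idfun (\matrix_(i, j) (i == j :> nat)%:R).
Proof.
split=> [a|i]; first exact: drop_varsC.
rewrite drop_varsX /drop_var; case: insubP => [o lt_i /= Eo|ge_i].
  rewrite (bigD1 o) //= mxE Eo eqxx scale1r big1 ?addr0 // => j ne.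
  by rewrite mxE -Eo (inj_eq val_inj) eq_sym (negPf ne) scale0r.
rewrite big1 // => j _; rewrite mxE; case: eqP => [E|]; last by rewrite scale0r.
by case/negP: ge_i; rewrite E.
Qed.

Lemma drop_monomial (R : comNzRingType) (m : 'X_{1..N}) b :
  (mmap1 (@drop_var R) m)@_b = (m == wid b)%:R.
Proof.
have [/forallP H|] := boolP [forall i : 'I_N, (n <= i)%N ==> (m i == 0%N)].
  have H0 (i : 'I_N) : (n <= i)%N -> m i = 0%N by move=> le_i; apply/eqP/(implyP (H i)).
  have -> : mmap1 (@drop_var R) m = 'X_[proj n (emb m)].
    pose F k := (if insub k is Some o then 'X_o : {mpoly R[n]} else 0) ^+ emb m k.
    transitivity (\prod_(i < N) F i).
      by apply: eq_bigr => i _; rewrite /F emb_ord.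
    transitivity (\prod_(i < n) F i); last first.
      rewrite mpolyXE_id; apply: eq_bigr => i _; rewrite /F projE.
      by case: insubP => [o _ /val_inj -> //|]; rewrite ltn_ord.
    rewrite (big_ord_widen _ F le_nN) (bigID (fun i : 'I_N => (i < n)%N)) /=.
    rewrite [X in _ * X]big1 ?mulr1 // => i; rewrite -leqNgt => le_i.
    by rewrite /F emb_ord H0 // expr0.
  rewrite mcoeffX; congr (_%:R : R); congr nat_of_bool.
  by apply/eqP/eqP => [<-|->]; rewrite ?wid_proj // emb_wid proj_emb.
rewrite negb_forall => /existsP [i]; rewrite negb_imply => /andP [le_i nz].
have -> : mmap1 (@drop_var R) m = 0.
  rewrite /mmap1 (bigD1 i) //= /drop_var insubF; last by apply/negbTE; rewrite -leqNgt.
  by rewrite expr0n (negPf nz) mul0r.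
rewrite mcoeff0; case: eqP => // E; move: nz; rewrite E wid_ge //.
Qed.

Lemma coef_drop_vars (R : comNzRingType) (p : {mpoly R[N]}) b :
  (drop_vars p)@_b = p@_(wid b).
Proof.
rewrite [in RHS](mpolyE p) /drop_vars /mmap !(raddf_sum (mcoeff _)) /=.
apply: eq_bigr => m _; rewrite mcoeffZ mcoeffX -drop_monomial.
by rewrite mcoeffCM.
Qed.

(** In the reverse lexicographic order a monomial divisible by one of the last
    variables is smaller than every monomial in the first n variables of the same
    degree, so it cannot be the initial one as soon as the polynomial has a term
    in the first n variables. *)
Lemma drop_vars_initial (K : fieldType) d (f : {mpoly K[N]}) b :
  hom_deg d f -> is_initial (drop_vars f) b -> is_initial f (wid b).
Proof.
move=> hf [b_f Hb].
have w_f : wid b \in msupp f by rewrite mcoeff_msupp -coef_drop_vars -mcoeff_msupp.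
split=> // m m_f ne.
have Ed : mdeg m = mdeg (wid b) by rewrite (hf _ m_f) (hf _ w_f).
have [/forallP H|] := boolP [forall i : 'I_N, (n <= i)%N ==> (m i == 0%N)].
  have Em : wid (proj n (emb m)) = m.
    by apply: wid_proj => i le_i; apply/eqP/(implyP (H i)).
  rewrite -Em; apply: wid_lt; apply: Hb; last by apply: contraNneq ne => <-; rewrite Em.
  by rewrite mcoeff_msupp coef_drop_vars Em -mcoeff_msupp.
rewrite negb_forall => /existsP [i0]; rewrite negb_imply => nz0.
have := @arg_maxnP _ i0 (fun i : 'I_N => (n <= i)%N && (m i != 0%N)) val nz0.
case=> i /andP [le_i nz] max_i; apply/(revlexP Ed); exists i.
  by rewrite wid_ge // lt0n.
move=> j lt_j; have le_j : (n <= j)%N by rewrite (leq_trans le_i) // ltnW.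
rewrite wid_ge //; apply/eqP/contraT => nzj.
by have := max_i j; rewrite le_j nzj => /(_ isT) /= H; move: lt_j; rewrite ltnNge H.
Qed.

End DropVariables.

(** * The image of a power of (x_1, ..., x_m) *)

(** Tensored with the residue field, a resolution over n variables is exact from
    position n on: Hilbert's bound on the projective dimension. *)
Lemma tor_vanish (K : fieldType) n (F : free_complex K n) J i e :
  is_free_resolution F J -> (n <= i)%N -> (0 < i)%N -> tor_dim F i e = 0%N.
Proof.
move=> rF; case: i => // i le_i _.
have ex := const_exact (p0 := 0) (res_complex rF) (fun p _ => @res_exact _ _ _ _ rF p) le_i.
rewrite (tor_dimE _ _ (res_graded rF)); set P := degp _ _ _.
have PE : P *m rE F e i.+1 = rE F e i.+1 by rewrite /rE mulmxA degp_idem.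
have rk_eq : (\rank (rE F e i.+1) + \rank (P :&: kermx (rE F e i.+1))%MS = \rank P)%N.
  by rewrite -{1}PE mxrank_mul_ker.
suff /mxrankS : (P :&: kermx (rE F e i.+1) <= rE F e i.+2)%MS by lia.
apply/rV_subP => v; rewrite sub_capmx => /andP [/submxP [w Ew] /sub_kermxP kv].
have vP : v *m P = v by rewrite Ew -mulmxA degp_idem.
have /ex [x Ex] : v *m const_cpx (rD F) i.+1 = 0.
  by rewrite -vP -mulmxA.
apply/submxP; exists x.
rewrite -vP Ex /rE /const_cpx /map_cpx (const_gr e (rD_gr i.+2 (res_graded rF))).
by rewrite mulmxA.
Qed.

Lemma mdivides_deg N (u v : Minf) : (max_var v <= N)%N -> mdivides u v ->
  (psum N v <= psum N u)%N -> u = v.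
Proof.
move=> /max_var_leP v0 /mdividesP uv le_vu; apply: minfP => k.
have [lt_k|le_k] := ltnP k N; last first.
  by have := uv k; rewrite v0 //; lia.
apply/eqP; rewrite eqn_leq uv; apply: contraLR le_vu; rewrite -!ltnNge => lt_uv.
rewrite /psum [X in (X < _)%N](bigD1 (Ordinal lt_k)) //= [X in (_ < X)%N](bigD1 (Ordinal lt_k)) //=.
by rewrite -addSn; apply: leq_add => //; apply: leq_sum => i _.
Qed.

Section SigmaOfPower.

Variables (K : fieldType) (sigma : Minf -> Minf) (m j : nat).
Hypothesis stable : stable_operator K sigma.

Let P := set_ideal (K := K) (pow_set m j).
Let sP := sigma_ideal sigma P.

Lemma hcount_gt0 (A : Minf -> Prop) N d (w : 'X_{1..N}) : A (emb w) -> mdeg w = d ->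
  (0 < hcount A N d)%N.
Proof.
move=> Aw dw; have lt_w : (mdeg w < d.+1)%N by rewrite dw.
apply/card_gt0P; exists (BMultinom lt_w); rewrite inE /= dw eqxx.
by apply/propbP.
Qed.

(** The power vanishes in degrees below j, hence so does its image, which has
    the same Hilbert function. *)
Lemma sigma_pow_deg N w : (max_var w <= N)%N -> up sP w -> (j <= psum N w)%N.
Proof.
move=> mw sw; pose N' := maxn N (maxn m (max_var_ideal sP)).
have le_N : (N <= N')%N by rewrite leq_maxl.
have mw' : (max_var w <= N')%N by exact: leq_trans le_N.
rewrite -(psum_ge mw le_N) -(emb_proj_max mw') psum_emb // leqNgt; apply/negP => lt_j.
have := @hcount_gt0 (up sP) N' _ (proj N' w) _ erefl; rewrite emb_proj_max // => /(_ sw).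
have le_m : (m <= N')%N by rewrite !leq_max leqnn orbT.
have le_s : (max_var_ideal sP <= N')%N by rewrite !leq_max leqnn !orbT.
rewrite (hilbert_sigma stable _ (pow_stable K m j) (leq_trans (pow_max_var K m j) le_m) le_s).
case/card_gt0P => v; rewrite inE => /andP [/eqP dv /propbP].
rewrite set_ideal_up /pow_set => le_jv.
have : (psum m (emb (bmnm v)) <= mdeg (bmnm v))%N.
  rewrite -(psum_emb v (leqnn N')); apply: psum_mono.
  by rewrite !leq_max leqnn orbT.
by rewrite dv => /(leq_trans le_jv); rewrite leqNgt lt_j.
Qed.

(** By the Hilbert function in degree j the generators of the power of
    (x_1, ..., x_m) are sent bijectively to the monomials of degree j of the
    image. *)
Lemma sigma_pow_gen N : (m <= N)%N -> (max_var_ideal sP <= N)%N ->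
  exists s : 'X_{1..m} -> 'X_{1..N},
    (forall b, mdeg b = j -> sigma (emb b) = emb (s b) /\ mdeg (s b) = j) /\
    (forall b c, mdeg b = j -> mdeg c = j -> s b = s c -> b = c).
Proof.
move=> le_m le_s.
pose T := [set b : 'X_{1..m < j.+1} | mdeg (bmnm b) == j].
pose S := [set w : 'X_{1..N < j.+1} | (mdeg (bmnm w) == j) && propb (up sP (emb (bmnm w)))].
have hS : (#|T| <= #|S|)%N.
  rewrite -[#|S|]/(hcount (up sP) N j).
  rewrite (hilbert_sigma stable _ (pow_stable K m j) (leq_trans (pow_max_var K m j) le_m) le_s).
  have lt_w (b : 'X_{1..m < j.+1}) : (mdeg (wid N (bmnm b)) < j.+1)%N.
    by rewrite mdeg_wid // bmdeg.
  have inj_w : injective (fun b => BMultinom (lt_w b)).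
    by move=> b c /(congr1 (@bmnm _ _)) /= /(wid_inj le_m) E; apply: val_inj.
  rewrite -(card_imset _ inj_w); apply: subset_leq_card; apply/subsetP => w.
  case/imsetP => b b_T E; have db : mdeg (bmnm b) = j by move: b_T; rewrite inE => /eqP. subst w; rewrite in_set /= mdeg_wid // db eqxx.
  by apply/propbP; rewrite set_ideal_up emb_wid // /pow_set psum_emb // db.
have key (w : 'X_{1..N < j.+1}) : exists b : 'X_{1..m < j.+1},
    w \in S -> b \in T /\ sigma (emb (bmnm b)) = emb (bmnm w).
  have [wS|/negP nS] := boolP (w \in S); last first.
    have lt_0 : (mdeg (0%MM : 'X_{1..m}) < j.+1)%N by rewrite mdeg0.
    by exists (BMultinom lt_0).
  move: (wS); rewrite inE => /andP [/eqP dw /propbP sw].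
  have /sigma_up [u Pu uw] := sw.
  move: (Pu) => /pow_min_gen/pow_gensP [b db Eu].
  have lt_b : (mdeg b < j.+1)%N by rewrite db.
  exists (BMultinom lt_b) => _; rewrite inE /= db eqxx -Eu; split=> //.
  apply: (@mdivides_deg N) => //; first exact: max_var_emb.
  rewrite psum_emb // dw; apply: sigma_pow_deg.
    apply/max_var_leP => k le_k; have /mdividesP/(_ k) := uw.
    by rewrite emb_ge // leqn0 => /eqP.
  by apply/sigma_up; exists u => //; exact: mdivides_refl.
pose h w := proj1_sig (constructive_indefinite_description _ (key w)).
have hP w : w \in S -> h w \in T /\ sigma (emb (bmnm (h w))) = emb (bmnm w).
  by rewrite /h; case: constructive_indefinite_description.
(* The choice h of a generator over each monomial of S is injective, hence
   onto T by counting. *)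
have inj_h : {in S &, injective h}.
  move=> v w /hP [_ Ev] /hP [_ Ew] E; apply: val_inj; apply: emb_inj.
  by rewrite -[emb _]Ev E.
have im_h : h @: S = T.
  apply/eqP; rewrite eqEcard card_in_imset // hS andbT.
  by apply/subsetP => _ /imsetP [w /hP [? _] ->].
have sE b : mdeg b = j -> exists2 w, w \in S & bmnm (h w) = b /\ sigma (emb b) = emb (bmnm w).
  move=> db; have lt_b : (mdeg b < j.+1)%N by rewrite db.
  have : BMultinom lt_b \in h @: S by rewrite im_h inE /= db.
  case/imsetP => w wS E; exists w => //; have [_] := hP _ wS; rewrite -E /=.
  by split.
exists (fun b => proj N (sigma (emb b))); split=> [b /sE [w wS [_ ->]]|b c].
  by rewrite proj_emb; split=> //; move: wS; rewrite inE => /andP [/eqP].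
move=> /sE [w _ [<- ->]] /sE [v _ [<- ->]]; rewrite !proj_emb => E.
by congr (bmnm (h _)); apply: val_inj.
Qed.

End SigmaOfPower.

(** * Composition of linear substitutions *)

(** The inclusion of the first a coordinates among b, or, when b < a, the
    projection onto the first b. *)
Definition inc_mx (R : pzRingType) (a b : nat) : 'M[R]_(a, b) :=
  \matrix_(i, j) (i == j :> nat)%:R.

Lemma inc_mxK (R : pzRingType) a b : (a <= b)%N -> inc_mx R a b *m inc_mx R b a = 1%:M.
Proof.
move=> le_ab; apply/matrixP => i k; rewrite !mxE (bigD1 (widen_ord le_ab i)) //=.
rewrite !mxE /= eqxx mul1r big1 ?addr0 // => l ne; rewrite !mxE.
case: eqP => [E|]; last by rewrite mul0r.
by case/eqP: ne; apply: val_inj.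
Qed.

Lemma map_inc_mx (R S : pzRingType) (f : {rmorphism R -> S}) a b :
  map_mx f (inc_mx R a b) = inc_mx S a b.
Proof. by apply/matrixP => i j; rewrite !mxE rmorph_nat. Qed.

Lemma linear_subst_ext (R T : nzRingType) n m (Xi : {mpoly R[n]} -> {mpoly T[m]})
    iota iota' G G' :
  linear_subst Xi iota G -> iota =1 iota' -> G = G' -> linear_subst Xi iota' G'.
Proof. by move=> [C X] Ei <-; split=> // a; rewrite C Ei. Qed.

Lemma linear_subst_comp (R S T : comNzRingType) n m l
    (X1 : {mpoly R[n]} -> {mpoly S[m]}) (X2 : {rmorphism {mpoly S[m]} -> {mpoly T[l]}})
    i1 (i2 : {rmorphism S -> T}) G1 G2 :
  linear_subst X1 i1 G1 -> linear_subst X2 i2 G2 ->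
  linear_subst (X2 \o X1) (i2 \o i1) (map_mx i2 G1 *m G2).
Proof.
move=> [C1 E1] [C2 E2]; split=> [a|i] /=; first by rewrite C1 C2.
rewrite E1 rmorph_sum /=.
under [RHS]eq_bigr => j _ do rewrite mxE scaler_suml.
rewrite [RHS]exchange_big; apply: eq_bigr => k _.
rewrite -mul_mpolyC rmorphM /= C2 E2 mul_mpolyC scaler_sumr.
by apply: eq_bigr => j _; rewrite scalerA mxE.
Qed.

Lemma map_mpoly_subst (S T : comNzRingType) m (f : {rmorphism S -> T}) :
  linear_subst (map_mpoly (n := m) f) f 1%:M.
Proof.
split=> [a|i]; first by rewrite map_mpolyC.
rewrite map_mpolyX (bigD1 i) //= mxE eqxx scale1r big1 ?addr0 // => j ne.
by rewrite mxE eq_sym (negPf ne) scale0r.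
Qed.

Section Substitution.

Variables (R T : comNzRingType) (n m : nat) (iota : {rmorphism R -> T}) (G : 'M[T]_(n, m)).

Definition subst_hom : {mpoly R[n]} -> {mpoly T[m]} :=
  mmap (@mpolyC m T \o iota) (fun i => \sum_(j < m) G i j *: 'X_j).

HB.instance Definition _ :=
  GRing.RMorphism.copy subst_hom
    (mmap (@mpolyC m T \o iota) (fun i => \sum_(j < m) G i j *: 'X_j)).

Lemma subst_homP : linear_subst subst_hom iota G.
Proof. by split=> [a|i]; rewrite /subst_hom ?mmapC // mmapX mmap1U. Qed.

End Substitution.

Lemma wid_subst (R : comNzRingType) n N (le_nN : (n <= N)%N) (W : {rmorphism {mpoly R[n]} -> {mpoly R[N]}})
   (b : 'X_{1..n}) :
  linear_subst W idfun (inc_mx R n N) -> W 'X_[b] = 'X_[wid N b].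
Proof.
move=> [_ WX].
pose F k := (if insub k is Some o then 'X_o : {mpoly R[N]} else 0) ^+ emb b k.
transitivity (\prod_(i < n) F i).
  rewrite mpolyXE_id rmorph_prod; apply: eq_bigr => i _; rewrite rmorphXn /F emb_ord WX.
  have -> : (insub (i : nat) : option 'I_N) = Some (widen_ord le_nN i).
    by rewrite -(valK (widen_ord le_nN i)).
  congr (_ ^+ _); rewrite (bigD1 (widen_ord le_nN i)) //= mxE /= eqxx scale1r.
  rewrite big1 ?addr0 // => j ne; rewrite mxE; case: eqP => [E|]; last by rewrite scale0r.
  by case/eqP: ne; apply: val_inj.
transitivity (\prod_(i < N) F i); last first.
  by rewrite mpolyXE_id; apply: eq_bigr => i _; rewrite /F projE valK.
rewrite (big_ord_widen _ F le_nN) [RHS](bigID (fun i : 'I_N => (i < n)%N)) /=.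
rewrite [X in _ * X]big1 ?mulr1 // => i; rewrite -leqNgt => le_i.
by rewrite /F emb_ge // expr0.
Qed.

(** * Generic coordinates for the image of a power *)

Section GenericDeterminant.

Variables (K : fieldType) (sigma : Minf -> Minf) (N m j : nat).
Hypotheses (stable : stable_operator K sigma) (m_gt0 : (0 < m)%N) (le_m : (m <= N)%N).

Let P := set_ideal (K := K) (pow_set m j).
Let sP := sigma_ideal sigma P.
Hypothesis le_s : (max_var_ideal sP <= N)%N.

Let fgS : fg_monomial_ideal sP.
Proof. by apply: sigma_fg; case: (pow_stable K m j). Qed.

Let T := [set b : 'X_{1..m < j.+1} | mdeg (bmnm b) == j].
Let mon (k : 'I_#|T|) : 'X_{1..m} := bmnm (enum_val k).

Let mon_deg k : mdeg (mon k) = j.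
Proof. by have := enum_valP k; rewrite inE => /eqP. Qed.

Let mon_inj : injective mon.
Proof. by move=> k l E; apply: enum_val_inj; apply: val_inj. Qed.

Let mon_surj b : mdeg b = j -> exists k, mon k = b.
Proof.
move=> db; have lt_b : (mdeg b < j.+1)%N by rewrite db.
have b_T : BMultinom lt_b \in T by rewrite inE /= db.
by exists (enum_rank_in b_T (BMultinom lt_b)); rewrite /mon enum_rankK_in.
Qed.

Local Notation Q := {mpoly K[N * N]}.

(** The matrix of independent variables: the polynomials in the n * n variables
    are the polynomial functions of a matrix g, evaluated at [mxvec g 0]. *)
Definition generic_mx : 'M[Q]_N := \matrix_(i, l) 'X_(mxvec_index i l).

Lemma eval_generic (S : comNzRingType) (iota : {rmorphism K -> S}) (G : 'M[S]_N) :
  map_mx (mmap iota (fun k => mxvec G 0 k)) generic_mx = G.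
Proof. by apply/matrixP => i l; rewrite !mxE mmapX mmap1U mxvecE. Qed.

(** The generic linear change of variables, restricted to x_{m+1} = ... = x_N =
    0. *)
Definition generic_hom : {mpoly K[N]} -> {mpoly Q[m]} :=
  subst_hom (@mpolyC (N * N) K) (generic_mx *m inc_mx _ N m).

HB.instance Definition _ := GRing.RMorphism.copy generic_hom
  (subst_hom (@mpolyC (N * N) K) (generic_mx *m inc_mx _ N m)).

Lemma generic_homP :
  linear_subst generic_hom (@mpolyC (N * N) K) (generic_mx *m inc_mx _ N m).
Proof. exact: subst_homP. Qed.

Lemma coef_combination (S : comNzRingType) (F : 'I_#|T| -> {mpoly S[m]}) c b :
  (\sum_k (c k)%:MP * F k)@_b = \sum_k c k * (F k)@_b.
Proof. by rewrite (raddf_sum (mcoeff b)); apply: eq_bigr => k _; rewrite /= mcoeffCM. Qed.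

Section Matrix.

Variable s : 'X_{1..m} -> 'X_{1..N}.
Hypotheses
  (sE : forall b, mdeg b = j -> sigma (emb b) = emb (s b) /\ mdeg (s b) = j)
  (s_inj : forall b c, mdeg b = j -> mdeg c = j -> s b = s c -> b = c).

Definition generic_coefs : 'M[Q]_#|T| :=
  \matrix_(k, l) (generic_hom 'X_[s (mon k)])@_(mon l).

Lemma s_up b : mdeg b = j -> up sP (emb (s b)).
Proof.
move=> db; rewrite -(proj1 (sE db)); apply/sigma_up; exists (emb b); last exact: mdivides_refl.
by apply/pow_min_gen/pow_gensP; exists b.
Qed.

(** [generic_independence] produces linear forms over some domain for which the
    rows of this matrix become independent; the generic matrix specializes to
    them. *)
Lemma generic_coefs_det : \det generic_coefs != 0.
Proof.
pose n' := max_var_ideal sP; have le_n : (n' <= N)%N by exact: le_s.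
pose t b := proj n' (emb (s b)).
have tE b : mdeg b = j -> emb (t b) = emb (s b).
  move=> db; apply: (@mdivides_deg N); [exact: max_var_emb|exact: mdivides_trunc|].
  rewrite psum_emb // (proj2 (sE db)); apply: (sigma_pow_deg stable).
    exact: leq_trans (max_var_emb _) le_s.
  by apply: (fg_truncated fgS (leqnn _)); exact: s_up.
have tdeg b : mdeg b = j -> mdeg (t b) = j.
  by move=> db; rewrite -(psum_emb _ le_s) tE // psum_emb //; case: (sE db).
have wid_t b : mdeg b = j -> wid N (t b) = s b.
  by move=> db; rewrite /wid tE // proj_emb.
have [F [F' [rF rF' tor_eq]]] := stable_resolutions stable (pow_stable K m j).
have tor0 i e : (m <= i)%N -> tor_dim F' i e = 0%N.
  move=> le_i; rewrite -tor_eq; apply: (tor_vanish _ rF); last exact: leq_trans le_i.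
  exact: leq_trans (pow_max_var K m j) le_i.
have sPP := restrictP (n := n') (fg_monomial_set fgS).
pose f k : {mpoly K[n']} := 'X_[t (mon k)].
have [] := @generic_independence K n' _ j F' (restrict sP) f rF' _ _ _ _ m m_gt0 tor0.
- move=> g a /sPP Hg /Hg sa; rewrite -(psum_emb a (leqnn n')).
  by apply: (sigma_pow_deg stable); [exact: max_var_emb|exact: sa].
- move=> k; apply/sPP => a; rewrite msuppX inE => /eqP ->.
  by rewrite tE //; exact: s_up.
- by move=> k a; rewrite msuppX inE => /eqP ->; exact: tdeg (mon_deg _).
- move=> c H k; have := congr1 (mcoeff (t (mon k))) H.
  rewrite mcoeff0 (raddf_sum (mcoeff _)) (bigD1 k) //= mcoeffZ mcoeffX eqxx mulr1.
  rewrite big1 ?addr0 // => l ne; rewrite mcoeffZ mcoeffX; case: eqP => [E|]; last by rewrite mulr0.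
  case/eqP: ne; apply: mon_inj; apply: s_inj => //.
  by rewrite -!wid_t // E.
move=> T' [iota [Xi [G [XiC XiX indep]]]].
(* The specialization is padded by zeros to an N x N matrix. *)
pose G' := inc_mx T' N n' *m G *m inc_mx T' m N.
pose ev : {rmorphism Q -> T'} := mmap iota (fun k => mxvec G' 0 k).
pose W : {rmorphism {mpoly K[n']} -> {mpoly K[N]}} := subst_hom idfun (inc_mx K n' N).
have WP : linear_subst W idfun (inc_mx K n' N) by exact: subst_homP.
have XiP : linear_subst Xi iota G by [].
have evXi : map_mpoly ev \o (generic_hom \o W) =1 Xi.
  have sub := linear_subst_comp (linear_subst_comp WP generic_homP) (map_mpoly_subst m ev).
  apply: (@linear_subst_eq _ _ _ _ _ Xi iota G _ XiP).
  apply: linear_subst_ext sub _ _ => [a|] /=; first by rewrite /ev /= mmapC.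
  rewrite mulmx1 !map_mxM !map_inc_mx eval_generic /G'.
  rewrite !mulmxA inc_mxK // mul1mx -!mulmxA inc_mxK // mulmx1.
  by [].
apply/negP => /eqP det0; have : \det (map_mx ev generic_coefs) = 0.
  by rewrite det_map_mx det0 rmorph0.
move/eqP/det0P => [c c_nz c_ker]; case/eqP: c_nz; apply/rowP => k; rewrite mxE.
apply: (indep (fun k => c 0 k)); apply/mpolyP => b; rewrite coef_combination mcoeff0.
have hXi k' : hom_deg j (Xi (f k')).
  apply: (linear_subst_hom XiP) => a; rewrite msuppX inE => /eqP ->; exact: tdeg.
have [db|nb] := eqVneq (mdeg b) j; last first.
  by rewrite big1 // => k' _; rewrite (hom_deg_coef (hXi k')) // mulr0.
have [l <-] := mon_surj db; transitivity ((c *m map_mx ev generic_coefs) 0 l); last by rewrite c_ker mxE.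
rewrite mxE; apply: eq_bigr => k' _; congr (_ * _).
have -> : Xi (f k') = map_mpoly ev (generic_hom 'X_[s (mon k')]).
  by rewrite -(wid_t _ (mon_deg k')) -(wid_subst le_n _ WP); exact: (esym (evXi _)).
by rewrite mcoeff_map_mpoly mxE [in RHS]mxE.
Qed.

End Matrix.

(** For a matrix at which the generic determinant does not vanish, suitable
    combinations of the generators of the image have prescribed restrictions to the
    first m variables, hence prescribed initial monomials. *)
Lemma generic_det : exists2 p : Q, p != 0 &
  forall g : 'M[K]_N, p.@[fun k => mxvec g 0 k] != 0 ->
    forall b : 'X_{1..m}, mdeg b = j ->
      initials (linear_image g (restrict (n := N) sP)) (wid N b).
Proof.
have [s [sE s_inj]] := sigma_pow_gen stable le_m le_s.
exists (\det (generic_coefs s)); first exact: generic_coefs_det.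
move=> g nz b db; have [l El] := mon_surj db.
pose ev : {rmorphism Q -> K} := meval (fun k => mxvec g 0 k).
pose M := map_mx ev (generic_coefs s).
have uM : M \in unitmx by rewrite unitmxE det_map_mx unitfE.
(* The combination that restricts to the monomial b. *)
pose c := row l (invmx M).
have cM : c *m M = delta_mx 0 l by rewrite /c -row_mul mulVmx // row1.
pose f : {mpoly K[N]} := \sum_k (c 0 k)%:MP * 'X_[s (mon k)].
have fj : hom_deg j f.
  apply: hom_deg_sum => k _; rewrite mul_mpolyC; apply: hom_degZ.
  by have := @hom_degX K N (s (mon k)); rewrite (proj2 (sE _ (mon_deg k))).
have sf : restrict sP f.
  apply/(restrictP (fg_monomial_set fgS)) => a a_f.
  have [k Ek] : exists k, a = s (mon k).
    have [] := classic (exists k, a = s (mon k)) => // no; move: a_f.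
    rewrite mcoeff_msupp /f (raddf_sum (mcoeff a)) big1 ?eqxx // => k _.
    rewrite /= mcoeffCM mcoeffX; case: eqP => [E|]; last by rewrite mulr0.
    by case: no; exists k.
  by rewrite Ek; apply: (s_up sE).
exists (linear_change g f); first by exists f.
apply: (drop_vars_initial le_m (linear_subst_hom (linear_changeP g) fj)).
have dropE : drop_vars m (R := K) \o linear_change g =1 map_mpoly ev \o generic_hom.
  apply: (linear_subst_eq (iota := idfun) (G := g *m inc_mx K N m)).
    apply: linear_subst_ext (linear_subst_comp (linear_changeP g) (drop_vars_subst _ _ _)) _ _ => //.
    by congr (_ *m _); apply/matrixP => i k; rewrite !mxE.
  apply: linear_subst_ext (linear_subst_comp generic_homP (map_mpoly_subst m ev)) _ _ => [a|].
    by rewrite /ev /= mevalC.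
  by rewrite mulmx1 map_mxM map_inc_mx; congr (_ *m _); exact: (eval_generic idfun g).
have -> : drop_vars m (linear_change g f) = 'X_[b].
  apply/mpolyP => a; rewrite [drop_vars _ _]dropE /= mcoeff_map_mpoly.
  have [da|na] := eqVneq (mdeg a) j; last first.
    rewrite (hom_deg_coef (d := j)) //; last exact: linear_subst_hom generic_homP fj.
    suff /negPf ne : b != a by rewrite mcoeffX ne; exact: (rmorph0 ev).
    by apply: contraNneq na => <-; rewrite db.
  have [l' <-] := mon_surj da; rewrite mcoeffX -El (inj_eq mon_inj).
  transitivity ((c *m M) 0 l'); last by rewrite cM mxE eqxx eq_sym.
  rewrite mxE.
  rewrite /f (rmorph_sum generic_hom) (raddf_sum (mcoeff (mon l'))).
  transitivity (\sum_k ev ((generic_hom ((c 0 k)%:MP * 'X_[s (mon k)]))@_(mon l'))).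
    exact: (rmorph_sum ev).
  apply: eq_bigr => k _.
  have -> : generic_hom ((c 0 k)%:MP * 'X_[s (mon k)]) =
      ((c 0 k)%:MP)%:MP * generic_hom 'X_[s (mon k)].
    rewrite -(proj1 generic_homP); exact: (rmorphM generic_hom).
  rewrite mcoeffCM; transitivity (ev (c 0 k)%:MP * M k l').
    by rewrite [M k l']mxE [generic_coefs _ _ _]mxE; exact: (rmorphM ev).
  by congr (_ * _); exact: mevalC.
split; first by rewrite msuppX inE.
by move=> a; rewrite msuppX inE => /eqP ->; rewrite eqxx.
Qed.

End GenericDeterminant.

(** * Generic coordinates in a large polynomial ring *)

Lemma mono_count_eq n (A B : 'X_{1..n} -> Prop) d :
  (forall m, mdeg m = d -> A m -> B m) -> mono_count A d = mono_count B d ->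
  forall m, mdeg m = d -> B m -> A m.
Proof.
move=> sub E m dm Bm.
pose S (C : 'X_{1..n} -> Prop) :=
  [set m : 'X_{1..n < d.+1} | (mdeg (bmnm m) == d) && propb (C (bmnm m))].
have sS : S A \subset S B.
  apply/subsetP => x; rewrite !inE => /andP [/eqP dx /propbP Ax].
  by rewrite dx eqxx; apply/propbP; exact: sub.
have eS : S A = S B by apply/eqP; rewrite eqEcard sS -[#|S B|]/(mono_count B d) -E leqnn.
have lt_m : (mdeg m < d.+1)%N by rewrite dm.
have : BMultinom lt_m \in S A by rewrite eS inE /= dm eqxx; apply/propbP.
by rewrite inE => /andP [_ /propbP].
Qed.

Section MonomialImage.

Variables (K : fieldType) (N : nat) (g : 'M[K]_N) (L : Rinf K -> Prop).
Hypotheses (ug : g \in unitmx) (fgL : fg_monomial_ideal L).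

Let LA := restrictP (n := N) (fg_monomial_set fgL).

Let L_up (m a : 'X_{1..N}) : up L (emb m) -> up L (emb (m + a)%MM).
Proof. by move=> Lm; apply: (fg_upset fgL) Lm _; exists (emb a); exact: embD. Qed.

Lemma image_count d :
  mono_count (initials (linear_image g (restrict (n := N) L))) d = hcount (up L) N d.
Proof. exact: (initials_image_count LA ug). Qed.

Lemma image_divisible (v : Minf) (w : 'X_{1..N}) : mdivides v (emb w) ->
  initials (linear_image g (restrict (n := N) L)) (proj N v) ->
  initials (linear_image g (restrict (n := N) L)) w.
Proof.
move=> /mdividesP vw; have le_vw : (proj N v <= w)%MM.
  by apply/mnm_lepP => i; rewrite projE (leq_trans (vw i)) // emb_ord.
by rewrite -(submK le_vw) addmC => /(initials_image_up LA L_up ug); apply.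
Qed.

End MonomialImage.

Lemma initials_mono (K : fieldType) n (V W : {mpoly K[n]} -> Prop) m :
  (forall f, V f -> W f) -> initials V m -> initials W m.
Proof. by move=> sub [f Vf fm]; exists f; [exact: sub|]. Qed.

Lemma image_mono (K : fieldType) n (g : 'M[K]_n) (V W : {mpoly K[n]} -> Prop) f :
  (forall f, V f -> W f) -> linear_image g V f -> linear_image g W f.
Proof. by move=> sub [p Vp fp]; exists p; [exact: sub|]. Qed.

(** Finitely many such conditions combine, through the product of the
    polynomials. *)
Lemma generic_all (K : fieldType) N (X : eqType) (s : seq X) (R : X -> 'M[K]_N -> Prop) :
  (forall x, x \in s -> exists2 p : {mpoly K[N * N]}, p != 0 &
     forall g : 'M[K]_N, p.@[fun k => mxvec g 0 k] != 0 -> R x g) ->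
  exists2 p : {mpoly K[N * N]}, p != 0 &
    forall g : 'M[K]_N, p.@[fun k => mxvec g 0 k] != 0 -> forall x, x \in s -> R x g.
Proof.
elim: s => [|x s IH] H; first by exists 1; rewrite ?oner_eq0.
have [y ys|p p0 Hp] := IH; first by apply: H; rewrite inE ys orbT.
have [q q0 Hq] := H x (mem_head _ _).
exists (q * p); first by rewrite mulf_neq0.
move=> g; rewrite mevalM mulf_eq0 negb_or => /andP [gq gp] y.
by rewrite inE => /predU1P [->|]; [exact: Hq|exact: Hp].
Qed.

Section Assembly.

Variables (K : fieldType) (sigma : Minf -> Minf) (N : nat).
Hypothesis stable : stable_operator K sigma.

Local Notation sig L := (sigma_ideal sigma L).
Local Notation pow m j := (set_ideal (K := K) (pow_set m j)).
Local Notation borel u := (set_ideal (K := K) (borel_set u)).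
Local Notation im g L := (linear_image g (restrict (n := N) L)).

Let fg_sig (L : Rinf K -> Prop) : fg_strongly_stable L -> fg_monomial_ideal (sig L).
Proof. by case=> /(sigma_fg sigma). Qed.

(** The monomials of degree j in the first m variables generate the power, so
    the power consists of initial monomials; by the Hilbert function there are
    no others. *)
Lemma initials_pow (g : 'M[K]_N) m j (w : 'X_{1..N}) :
  g \in unitmx -> (m <= N)%N -> (max_var_ideal (sig (pow m j)) <= N)%N ->
  (forall b : 'X_{1..m}, mdeg b = j -> initials (im g (sig (pow m j))) (wid N b)) ->
  initials (im g (sig (pow m j))) w -> pow_set m j (emb w).
Proof.
move=> ug le_m le_s H; have fgs := fg_sig (pow_stable K m j).
apply: (mono_count_eq (A := fun m' => pow_set m j (emb m')) _ _ (erefl (mdeg w))).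
  move=> m' _ /pow_setP [v /pow_gensP [b db ->] vw].
  by apply: (image_divisible ug fgs vw); exact: H.
rewrite (image_count ug fgs) (hilbert_sigma stable _ (pow_stable K m j)) //; last first.
  exact: leq_trans (pow_max_var K m j) le_m.
by apply: eq_hcount => b; rewrite set_ideal_up.
Qed.

Variable I : Rinf K -> Prop.
Hypothesis sI : fg_strongly_stable I.

(** The smallest strongly stable ideal containing u lies in each power
    (x_1, ..., x_k)^(psum k u), and is their intersection.  As sigma preserves
    inclusions, the initial monomials of its image lie in that intersection, and
    by the Hilbert function they fill it; so u is one of them. *)
Lemma initials_min_gen (g : 'M[K]_N) u :
  g \in unitmx -> min_gen I u -> (max_var_ideal I <= N)%N ->
  (max_var_ideal (borel u) <= N)%N -> (max_var_ideal (sig (borel u)) <= N)%N ->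
  (forall k, (0 < k <= max_var_ideal I)%N ->
     (max_var_ideal (sig (pow k (psum k u))) <= N)%N /\
     forall b : 'X_{1..k}, mdeg b = psum k u ->
       initials (im g (sig (pow k (psum k u)))) (wid N b)) ->
  initials (im g (sig I)) (proj N u).
Proof.
move=> ug gu le_I le_b le_sb H; set n := max_var_ideal I in le_I H.
have mu : (max_var u <= n)%N by exact: (proj1 (max_var_idealP (proj1 sI))).
have bs := borel_stable K u; have fgs := fg_sig bs.
have sub w : initials (im g (sig (borel u))) w -> borel_set u (emb w).
  move=> iw; have Hk k : (0 < k <= n)%N -> (psum k u <= psum k (emb w))%N.
    move=> k_n; have [le_s Hb] := H k k_n; have /andP [_ le_k] := k_n.
    apply: (initials_pow ug _ le_s Hb); first exact: leq_trans le_k _.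
    apply: initials_mono iw => f; apply: image_mono => p.
    apply: (proj2 stable) => //; first exact: pow_stable.
    by move=> f' Hf' v /Hf'; exact: borel_sub_pow.
  have Hn : (psum n u <= psum n (emb w))%N.
    by have [->|n0] := posnP n; [rewrite /psum !big_ord0|apply: Hk; rewrite n0 leqnn].
  move=> k; have [->|k0] := posnP k; first by rewrite /psum !big_ord0.
  have [le_k|lt_k] := leqP k n; first by apply: Hk; rewrite k0.
  by rewrite (psum_ge mu (ltnW lt_k)) (leq_trans Hn) // psum_mono // ltnW.
have uN : (max_var u <= N)%N by exact: leq_trans mu le_I.
have : initials (im g (sig (borel u))) (proj N u).
  apply: (mono_count_eq (fun m _ => sub m) _ (erefl (mdeg (proj N u)))).
    rewrite (image_count ug fgs) (hilbert_sigma stable _ bs) //.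
    by apply: eq_hcount => b; rewrite set_ideal_up.
  by rewrite emb_proj_max // => k.
apply: initials_mono => f; apply: image_mono => p.
apply: (proj2 stable) => // f' Hf'; apply/(fg_monomial_set (proj1 sI)) => v /Hf'.
exact: borel_sub.
Qed.

End Assembly.

Lemma min_gen_finite (K : fieldType) (I : Rinf K -> Prop) : fg_monomial_ideal I ->
  exists s : seq Minf, forall u, min_gen I u -> u \in s.
Proof.
move=> [s Hs]; exists s => u [Iu Hu].
have [_ U] := gen_monomial_set Hs; have [v v_s vu] := proj1 (U u) Iu.
have Iv : up I v by apply: (proj2 (U v)); exists v; [exact: v_s|exact: mdivides_refl].
by rewrite -(Hu v vu Iv); exact: v_s.
Qed.

Section LargeRing.

Variables (K : fieldType) (sigma : Minf -> Minf).
Hypothesis stable : stable_operator K sigma.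
Variable I : Rinf K -> Prop.
Hypothesis sI : fg_strongly_stable I.

(** The ring is taken large enough for the finitely many powers and principal
    strongly stable ideals attached to the minimal generators of I. *)
Lemma initials_large : exists N, [/\ (max_var_ideal I <= N)%N,
  (max_var_ideal (sigma_ideal sigma I) <= N)%N &
  exists2 p : {mpoly K[N * N]}, p != 0 &
    forall g : 'M[K]_N, g \in unitmx -> p.@[fun k => mxvec g 0 k] != 0 ->
      forall w, initials (linear_image g (restrict (n := N) (sigma_ideal sigma I))) w
        <-> up I (emb w)].
Proof.
have fgI := proj1 sI; have fgS := sigma_fg sigma fgI.
have [s0 Hs0] := min_gen_finite fgI; set n := max_var_ideal I.
pose s := [seq u <- s0 | propb (min_gen I u)].
have Hs u : min_gen I u <-> u \in s.
  rewrite mem_filter; split=> [gu|/andP [/propbP //]].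
  by rewrite Hs0 // andbT; apply/propbP.
pose mp k u := max_var_ideal (sigma_ideal sigma (set_ideal (K := K) (pow_set k (psum k u)))).
pose mb u := max_var_ideal (set_ideal (K := K) (borel_set u)).
pose ms u := max_var_ideal (sigma_ideal sigma (set_ideal (K := K) (borel_set u))).
pose B u := maxn (maxn (mb u) (ms u)) (\max_(k < n.+1) mp k u).
pose N := maxn (maxn n (max_var_ideal (sigma_ideal sigma I))) (\max_(u <- s) B u).
have le_n : (n <= N)%N by rewrite !leq_max leqnn.
have le_S : (max_var_ideal (sigma_ideal sigma I) <= N)%N by rewrite !leq_max leqnn orbT.
have le_B u : u \in s -> (B u <= N)%N.
  move=> u_s; have le_u : (B u <= \max_(u <- s) B u)%N by exact: leq_bigmax_seq.
  by rewrite leq_max le_u orbT.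
have le_mp u k : u \in s -> (k <= n)%N -> (mp k u <= N)%N.
  move=> /le_B le_u le_k; apply: leq_trans le_u; rewrite leq_max.
  rewrite -ltnS in le_k.
  by rewrite (leq_bigmax (F := fun k : 'I_n.+1 => mp k u) (Ordinal le_k)) orbT.
exists N; split=> //.
pose X := [seq (u, k) | u <- s, k <- iota 1 n].
have [|p p0 Hp] := @generic_all K N _ X (fun x g => forall b : 'X_{1..x.2},
    mdeg b = psum x.2 x.1 -> initials (linear_image g (restrict (n := N)
    (sigma_ideal sigma (set_ideal (pow_set x.2 (psum x.2 x.1)))))) (wid N b)).
  move=> x /allpairsP [[u k] /= [u_s]]; rewrite mem_iota => /andP [k0 k_n] -> /=.
  apply: generic_det => //; first by rewrite (leq_trans _ le_n).
  exact: le_mp.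
exists p => // g ug gp w.
have sub m : up I (emb m) -> initials (linear_image g (restrict (n := N) (sigma_ideal sigma I))) m.
  move=> Im; have [u gu um] := min_gen_div Im; have u_s := proj1 (Hs u) gu.
  apply: (image_divisible ug fgS um); apply: initials_min_gen => //.
  - by apply: leq_trans (le_B u u_s); rewrite !leq_max leqnn.
  - by apply: leq_trans (le_B u u_s); rewrite !leq_max leqnn orbT.
  move=> k /andP [k0 le_k]; split; first exact: le_mp.
  apply: (Hp g gp (u, k)); apply/allpairsP; exists (u, k); split=> //=.
  by rewrite mem_iota k0 add1n ltnS.
split; last exact: sub.
apply: (mono_count_eq (A := fun m => up I (emb m)) _ _ (erefl (mdeg w))) => [m _|].
  exact: sub.
by rewrite (image_count ug fgS) (hilbert_sigma stable _ sI).
Qed.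

End LargeRing.

(** * Points where a polynomial does not vanish *)

Section InfiniteField.

Variable K : fieldType.
Hypothesis infK : infinite_field K.

Lemma poly_nonroot (p : {poly K}) : p != 0 -> exists x, p.[x] != 0.
Proof.
move=> p0; apply: NNPP => no.
have roots x : root p x.
  by apply: contraT => nr; case: no; exists x.
have long k : exists s : seq K, uniq s /\ size s = k.
  elim: k => [|k [s [us ss]]]; first by exists [::].
  by have [x xs] := infK s; exists (x :: s); rewrite /= xs us ss.
have [s [us ss]] := long (size p).
have := max_poly_roots p0 _ us; rewrite ss ltnn => H.
by have : false by apply: H; apply/allP => x _; exact: roots.
Qed.

Section LastVariable.

Variables (n : nat) (v : 'I_n -> K).

Definition last_root (i : 'I_n.+1) : {poly K} :=
  if unlift ord_max i is Some j then (v j)%:P else 'X.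

(** The evaluation of all the variables but the last, which becomes the
    variable of a polynomial ring in one variable. *)
Definition eval_init : {mpoly K[n.+1]} -> {poly K} := mmap (@polyC K) last_root.

HB.instance Definition _ := GRing.RMorphism.copy eval_init (mmap (@polyC K) last_root).

Definition extend_pt (x : K) (i : 'I_n.+1) : K :=
  if unlift ord_max i is Some j then v j else x.

Lemma horner_eval_init p x : (eval_init p).[x] = p.@[extend_pt x].
Proof.
apply: (mpoly_hom_eq (f := horner_eval x \o eval_init) (g := meval (extend_pt x))) => [c|i] /=.
  by rewrite /eval_init mmapC mevalC horner_evalE hornerC.
rewrite /eval_init mmapX mmap1U mevalXU horner_evalE /last_root /extend_pt.
by case: unlift => [j|]; rewrite ?hornerC ?hornerX.
Qed.

Definition init_mnm (m : 'X_{1..n.+1}) : 'X_{1..n} := [multinom m (lift ord_max i) | i < n].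

(** The coefficient of the power e of the last variable. *)
Definition last_coef (e : nat) (p : {mpoly K[n.+1]}) : {mpoly K[n]} :=
  \sum_(m <- msupp p | m ord_max == e) p@_m *: 'X_[init_mnm m].

Lemma coef_eval_init p e : (eval_init p)`_e = (last_coef e p).@[v].
Proof.
rewrite /eval_init /mmap coef_sum /last_coef rmorph_sum [RHS]big_mkcond; apply: eq_bigr => m _.
rewrite /= coefCM /mmap1 big_ord_recr /= /last_root unlift_none.
under eq_bigr => i _ do rewrite -lift_max_widen liftK -polyC_exp.
rewrite -rmorph_prod /= coefCM coefXn [m ord_max == e]eq_sym.
case: (e =P _) => _; last by rewrite ?mulr0.
rewrite mulr1 mevalZ; congr (_ * _); rewrite mevalX; apply: eq_bigr => i _.
by rewrite mnmE.
Qed.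

Lemma coef_last_coef p m : (last_coef (m ord_max) p)@_(init_mnm m) = p@_m.
Proof.
rewrite [in RHS](mpolyE p) /last_coef !(raddf_sum (mcoeff _)) [LHS]big_mkcond /=.
apply: eq_bigr => a _; rewrite [in RHS]mcoeffZ [in RHS]mcoeffX.
case: (a ord_max =P m ord_max) => [E|ne].
  rewrite mcoeffZ mcoeffX; congr (_ * (nat_of_bool _)%:R); apply/eqP/eqP => [H|-> //].
  apply/mnmP => i; case: (unliftP ord_max i) => [j ->|-> //].
  by have := congr1 (fun b : 'X_{1..n} => b j) H; rewrite !mnmE.
by case: (a =P m) => [E|_]; [rewrite E in ne|rewrite mulr0].
Qed.

End LastVariable.

Lemma mpoly_nonroot n (p : {mpoly K[n]}) : p != 0 -> exists v, p.@[v] != 0.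
Proof.
elim: n p => [|n IH] p p0.
  exists (fun _ => 0); apply: contraNneq p0 => H.
  by move: H; rewrite [p]nvar0_mpolyC mevalC => ->.
have [m m_p] : exists m, p@_m != 0.
  apply: NNPP => no; case/eqP: p0; apply/mpolyP => m; rewrite mcoeff0.
  by apply/eqP; apply: contraT => nz; case: no; exists m.
have [v Hv] : exists v, (last_coef (m ord_max) p).@[v] != 0.
  apply: IH; apply: contraNneq m_p => H; by rewrite -coef_last_coef H mcoeff0.
have [x Hx] : exists x, (eval_init v p).[x] != 0.
  apply: poly_nonroot; apply: contraNneq Hv => H.
  by rewrite -coef_eval_init H coef0.
by exists (extend_pt v x); rewrite -horner_eval_init.
Qed.

End InfiniteField.

(** * Descent to fewer variables *)

Section Descent.

Variables (K : fieldType) (n N : nat) (L I : Rinf K -> Prop).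
Hypotheses (le_nN : (n <= N)%N) (fgL : fg_monomial_ideal L) (fgI : fg_monomial_ideal I).
Hypotheses (truncL : truncated n (up L)) (truncI : truncated N (up I)).

(** The upper left n x n block. *)
Definition corner (R : pzRingType) (g : 'M[R]_N) : 'M[R]_n :=
  inc_mx R n N *m g *m inc_mx R N n.

Variable g : 'M[K]_N.
Hypotheses (ug : g \in unitmx) (ubg : corner g \in unitmx).
Hypothesis good : forall w : 'X_{1..N},
  initials (linear_image g (restrict (n := N) L)) w <-> up I (emb w).

Local Notation init := (initials (linear_image (corner g) (restrict (n := n) L))).

Let Ln := restrictP (n := n) (fg_monomial_set fgL).
Let LN := restrictP (n := N) (fg_monomial_set fgL).

(** The change of variables by the block is the change by g followed by x_{n+1}
    = ... = x_N = 0, and this restriction reflects initial monomials. *)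
Lemma corner_init_sub (b : 'X_{1..n}) : init b -> up I (emb b).
Proof.
move=> /(initials_image _ Ln) [_ [p [Lp hp ->]] ib].
pose W : {rmorphism {mpoly K[n]} -> {mpoly K[N]}} := subst_hom idfun (inc_mx K n N).
have WP : linear_subst W idfun (inc_mx K n N) by exact: subst_homP.
rewrite -(emb_wid le_nN) -good; exists (linear_change g (W p)).
  exists (W p) => //; apply/LN => m.
  rewrite (mpolyE p) (rmorph_sum W) mcoeff_msupp (raddf_sum (mcoeff m)) => nz.
  have [a a_p Ea] : exists2 a, a \in msupp p & m = wid N a.
    apply: NNPP => no; case/eqP: nz; rewrite big_seq big1 // => a a_p.
    rewrite -mul_mpolyC (rmorphM W) (proj1 WP) (wid_subst le_nN _ WP) /= mcoeffCM mcoeffX.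
    case: (wid N a =P m) => [E|_]; last by rewrite mulr0.
    by case: no; exists a.
  by rewrite Ea emb_wid //; exact: (proj1 (Ln p) Lp).
apply: (drop_vars_initial le_nN
  (linear_subst_hom (linear_changeP g) (linear_subst_hom WP hp))).
suff -> : drop_vars n (linear_change g (W p)) = linear_change (corner g) p by [].
have sub := linear_subst_comp (linear_subst_comp WP (linear_changeP g))
  (drop_vars_subst n N K).
apply: (linear_subst_eq (X1 := drop_vars n (R := K) \o (linear_change g \o W)) _ (linear_changeP (corner g))).
apply: linear_subst_ext sub _ _ => //.
by rewrite /corner; congr (_ *m _); apply/matrixP => i j; rewrite !mxE //;
  apply: eq_bigr => k _; rewrite !mxE.
Qed.

(** The initial monomials for the block lie in I and have, extended to N
    variables, the Hilbert function of I; hence they are the monomials of I. *)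
Lemma corner_init (u : Minf) : up I u <-> init (proj n u).
Proof.
have Lup (m a : 'X_{1..n}) : up L (emb m) -> up L (emb (m + a)%MM).
  by move=> Lm; apply: (fg_upset fgL) Lm _; exists (emb a); exact: embD.
(* The initial monomials for the block, extended to all variables. *)
pose B u := init (proj n u).
have projD (v w : Minf) : mdivides v w -> (proj n v <= proj n w)%MM.
  by move=> /mdividesP vw; apply/mnm_lepP => i; rewrite !projE.
have B_up : upset B.
  move=> v w Bv /projD le_vw; rewrite /B -(submK le_vw) addmC.
  exact: (initials_image_up Ln Lup ubg).
have B_trunc : truncated n B.
  by move=> v Bv; rewrite /B proj_emb.
have upI := fg_upset fgI.
have B_sub w : B w -> up I w.
  by move=> /corner_init_sub Iw; apply: upI Iw _; exact: mdivides_trunc.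
have cB d : hcount B N d = hcount (up L) N d.
  have E e : iter (N - n) delta (fun d => (hcount B N d)%:Z) e =
             iter (N - n) delta (fun d => (hcount (up L) N d)%:Z) e.
    have := iter_hcount (N - n) B_up B_trunc e.
    have := iter_hcount (N - n) (fg_upset fgL) truncL e.
    rewrite (subnKC le_nN) => -> ->.
    rewrite -[hcount (up L) n e](image_count ubg fgL); congr (Posz _).
    by apply: eq_mono_count => b; rewrite /B proj_emb.
  by have [] := iter_delta_inj E d.
have cI d : hcount (up L) N d = hcount (up I) N d.
  by rewrite -(image_count ug fgL); apply: eq_mono_count => w; rewrite good.
have eqN (w : 'X_{1..N}) : up I (emb w) -> B (emb w).
  apply: (mono_count_eq (A := fun m => B (emb m)) (B := fun m => up I (emb m)) _ _ (erefl (mdeg w))).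
    by move=> m _; exact: B_sub.
  exact: etrans (cB _) (cI _).
split=> [Iu|Bu]; last exact: B_sub.
by apply: (B_up _ _ (eqN _ (truncI Iu))); exact: mdivides_trunc.
Qed.

End Descent.

(** A product of nonzero polynomials has a nonzero value over an infinite field, so
    two non-empty open subsets of the general linear group meet. *)
Lemma gin_unique (K : fieldType) n (J L1 L2 : {mpoly K[n]} -> Prop) :
  infinite_field K -> is_gin J L1 -> is_gin J L2 -> forall f, L1 f <-> L2 f.
Proof.
move=> infK [U1 [[S1 HS1] [g1 /HS1 [_ [p1 Sp1 nz1]]] HU1]]
  [U2 [[S2 HS2] [g2 /HS2 [_ [p2 Sp2 nz2]]] HU2]] f.
have nz (p : {mpoly K[n * n]}) (g : 'M[K]_n) : p.@[mxvec g 0] != 0 -> p != 0.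
  by apply: contraNneq => ->; rewrite meval0.
have det_nz : \det (generic_mx K n) != 0.
  apply: (nz _ 1%:M); rewrite -[_.@[_]](det_map_mx (meval (mxvec (1%:M : 'M[K]_n) 0))).
  by rewrite (eval_generic idfun) det1 oner_eq0.
have [v] : exists v, (p1 * p2 * \det (generic_mx K n)).@[v] != 0.
  apply: (mpoly_nonroot infK); rewrite !mulf_neq0 //.
    exact: nz nz1.
  exact: nz nz2.
pose g : 'M[K]_n := vec_mx (\row_k v k).
have Ev : mxvec g 0 =1 v by move=> k; rewrite /g vec_mxK mxE.
rewrite -(meval_eq _ Ev) !mevalM !mulf_eq0 !negb_or => /andP [/andP [nzg1 nzg2] nzd].
have ug : g \in unitmx.
  move: nzd; rewrite -[_.@[_]](det_map_mx (meval (mxvec g 0))) (eval_generic idfun).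
  by rewrite unitmxE unitfE.
rewrite -(HU1 g); last by apply/HS1; split=> //; exists p1.
by apply: HU2; apply/HS2; split=> //; exists p2.
Qed.

(** * The generic initial ideal *)

Section Glue.

Variables (K : fieldType) (n N : nat).
Hypothesis le_nN : (n <= N)%N.

(** The matrix g0 with its upper left block replaced by h. *)
Definition glue (S : pzRingType) (g0 : 'M[S]_N) (h : 'M[S]_n) : 'M[S]_N :=
  g0 - inc_mx S N n *m corner n g0 *m inc_mx S n N + inc_mx S N n *m h *m inc_mx S n N.

Lemma glue_corner (S : pzRingType) (g0 : 'M[S]_N) : glue g0 (corner n g0) = g0.
Proof. exact: subrK. Qed.

Lemma corner_glue (S : pzRingType) (g0 : 'M[S]_N) h : corner n (glue g0 h) = h.
Proof.
have E (k : 'M[S]_n) : corner n (inc_mx S N n *m k *m inc_mx S n N) = k.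
  by rewrite /corner !mulmxA inc_mxK // mul1mx -mulmxA inc_mxK // mulmx1.
rewrite /glue {1}/corner !mulmxDr !mulmxDl mulmxN mulNmx.
by rewrite -/(corner n _) -/(corner n (_ *m corner n g0 *m _)) -/(corner n (_ *m h *m _)) !E subrr add0r.
Qed.

Lemma map_glue (S T : pzRingType) (f : {rmorphism S -> T}) g0 h :
  map_mx f (glue g0 h) = glue (map_mx f g0) (map_mx f h).
Proof. by rewrite /glue /corner !map_mxD map_mxN !map_mxM !map_inc_mx. Qed.

Lemma eval_glue (g0 : 'M[K]_N) (p : {mpoly K[N * N]}) : exists q : {mpoly K[n * n]},
  forall h : 'M[K]_n, q.@[mxvec h 0] = p.@[mxvec (glue g0 h) 0].
Proof.
pose M := glue (map_mx (@mpolyC (n * n) K) g0) (generic_mx K n).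
exists (mmap (@mpolyC (n * n) K) (fun k => mxvec M 0 k) p) => h.
apply: (mpoly_hom_eq (f := meval (mxvec h 0) \o mmap (@mpolyC (n * n) K) (fun k => mxvec M 0 k))
  (g := meval (mxvec (glue g0 h) 0))) => [c|k] /=.
  by rewrite mmapC !mevalC.
rewrite mmapX mmap1U mevalXU; case/mxvec_indexP: k => i j; rewrite !mxvecE.
have : map_mx (meval (mxvec h 0)) M = glue g0 h.
  rewrite /M map_glue (eval_generic idfun h); congr (glue _ _).
  by apply/matrixP => a b; rewrite !mxE; exact: mevalC.
by move/matrixP => /(_ i j); rewrite mxE.
Qed.

End Glue.

Section GinOfSigma.

Variables (K : fieldType) (sigma : Minf -> Minf) (I : Rinf K -> Prop).
Hypotheses (infK : infinite_field K) (stable : stable_operator K sigma).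
Hypothesis sI : fg_strongly_stable I.

(** The good blocks are those that, put into a fixed good matrix g0, give a
    good matrix again; the block of g0 itself is one of them. That I is
    generated in the variables of sigma(I) also comes from the description of
    its monomials by the block. *)
Lemma gin_sigma : is_gin (restrict (n := max_var_ideal (sigma_ideal sigma I)) (sigma_ideal sigma I))
  (fun f => forall m, m \in msupp f -> up I (emb m)) /\
  truncated (max_var_ideal (sigma_ideal sigma I)) (up I).
Proof.
set L := sigma_ideal sigma I; set n := max_var_ideal L.
have fgI := proj1 sI; have fgL : fg_monomial_ideal L := sigma_fg sigma fgI.
have [N [le_I le_n [p p0 Hp]]] := initials_large stable sI.
have nz1 (q : {mpoly K[N * N]}) : q.@[mxvec (1%:M : 'M[K]_N) 0] != 0 -> q != 0.
  by apply: contraNneq => ->; rewrite meval0.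
have evE (g : 'M[K]_N) : map_mx (meval (mxvec g 0)) (generic_mx K N) = g.
  exact: (eval_generic idfun).
have corE (g : 'M[K]_N) : map_mx (meval (mxvec g 0)) (corner n (generic_mx K N)) = corner n g.
  by rewrite /corner !map_mxM !map_inc_mx evE.
pose D := \det (generic_mx K N); pose E := \det (corner n (generic_mx K N)).
have DE (g : 'M[K]_N) : D.@[mxvec g 0] = \det g.
  by rewrite -[RHS](congr1 determinant (evE g)) -det_map_mx.
have EE (g : 'M[K]_N) : E.@[mxvec g 0] = \det (corner n g).
  by rewrite -corE det_map_mx.
have D0 : D != 0 by apply: nz1; rewrite DE det1 oner_eq0.
have E0 : E != 0.
  by apply: nz1; rewrite EE /corner mulmx1 inc_mxK // det1 oner_eq0.
have [v] : exists v, (p * D * E).@[v] != 0 by apply: (mpoly_nonroot infK); rewrite !mulf_neq0.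
pose g0 : 'M[K]_N := vec_mx (\row_k v k).
have Ev : mxvec g0 0 =1 v by move=> k; rewrite /g0 vec_mxK mxE.
rewrite -(meval_eq _ Ev) (mevalM _ _ E) mulf_eq0 negb_or EE => /andP [pD ubg].
have ci g (ug : g \in unitmx) (good : forall w : 'X_{1..N},
    initials (linear_image g (restrict (n := N) L)) w <-> up I (emb w)) ucg :=
  corner_init le_n fgL fgI (fg_truncated fgL (leqnn _)) (fg_truncated fgI le_I) ug ucg good.
have [pg0 dg0] : p.@[mxvec g0 0] != 0 /\ \det g0 != 0.
  by move: pD; rewrite mevalM mulf_eq0 negb_or DE => /andP.
have ug0 : g0 \in unitmx by rewrite unitmxE unitfE.
have ubg0 : corner n g0 \in unitmx by rewrite unitmxE unitfE.
split; last first.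
  move=> u /(ci g0 ug0 (Hp g0 ug0 pg0) ubg0) iu.
  by apply/(ci g0 ug0 (Hp g0 ug0 pg0) ubg0); rewrite proj_emb.
have [q Hq] := @eval_glue K n N g0 (p * D).
exists (fun g => g \in unitmx /\ q.@[mxvec g 0] != 0); split.
- exists (fun q' => q' = q) => g; split=> [[ug nz]|[ug [q' -> nz]]] //.
  by split=> //; exists q.
- exists (corner n g0); split=> //.
  by rewrite Hq glue_corner.
move=> h [uh]; rewrite Hq mevalM mulf_eq0 negb_or DE => /andP [pg dg] f.
have Eh := corner_glue le_n g0 h; set g := glue g0 h in pg dg Eh.
have ug : g \in unitmx by rewrite unitmxE unitfE.
have good := Hp g ug pg.
have Lup (m a : 'X_{1..n}) : up L (emb m) -> up L (emb (m + a)%MM).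
  by move=> Lm; apply: (fg_upset fgL) Lm _; exists (emb a); exact: embD.
rewrite (initial_ideal_image (restrictP (fg_monomial_set fgL)) Lup uh).
have key m : up I (emb m) <-> initials (linear_image h (restrict (n := n) L)) m.
  have ucg : corner n g \in unitmx by rewrite Eh.
  have := ci g ug good ucg (emb m).
  by rewrite Eh proj_emb.
by split=> H m /H /key.
Qed.

End GinOfSigma.

Lemma extend_restrict (K : fieldType) (I : Rinf K -> Prop) n (J : {mpoly K[n]} -> Prop) :
  fg_monomial_ideal I -> truncated n (up I) ->
  (forall p, J p <-> forall m, m \in msupp p -> up I (emb m)) ->
  forall f, extend J f <-> I f.
Proof.
move=> fgI truncI JE f; have mI := fg_monomial_set fgI; split=> [[s [Hs ->]]|/mI If].
  have [t Ht] := fgI; apply/Ht; apply: ideal_gen_sum => c /Hs [q Jq ->].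
  apply: ideal_genM; apply/Ht; apply/(restrictP mI); exact/JE.
rewrite [f]monalg_decomp; apply: ideal_gen_sum => u /If Iu; apply: ideal_genM.
have [w Ew] := mdivides_trunc n u.
rewrite [X in monom_inf K X]Ew mulmC monom_infM; apply: ideal_genM; apply: ideal_gen_mem.
exists 'X_[proj n u]; last by rewrite incl_X.
by apply/JE => m; rewrite msuppX inE => /eqP ->; exact: truncI.
Qed.

Theorem theorem1p6 (K : fieldType) (sigma : Minf -> Minf) (I : Rinf K -> Prop)
    (K_infinite : infinite_field K)
    (sigma_stable : stable_operator K sigma)
    (I_stable : fg_strongly_stable I) :
  forall f : Rinf K, gin (sigma_ideal sigma I) f <-> I f.
Proof.
have [isg truncI] := gin_sigma K_infinite sigma_stable I_stable.
apply: (extend_restrict (proj1 I_stable) truncI) => p.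
apply: (gin_unique K_infinite _ isg).
exact: (epsilon_spec (inhabits (fun _ => False)) (is_gin _) (ex_intro _ _ isg)).
Qed.
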